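(* Let $x>0$, let $r\in\mathbb{Z}\setminus\mathbb{N}$ and let $\ell\in\mathbb{N}\cup\{0\}$ be arbitrary such that $\ell\ge 1-r$. For fixed $s$, consider $\Theta(r,s,t,x)$ as a meromorphic function of $t$. Then the following hold. **Case I.** For a fixed $s\in\mathbb{Z}$ with $s>r+\ell$ and $s\neq \ell+1$, or a fixed $s\in\mathbb{C}\setminus\mathbb{Z}$, around $t=1-r-\ell$, $$\Theta(r,s,t,x)=(-1)^{r-1}\frac{(r+\ell-1)!}{\ell!}x^{\ell}\,\Gamma(1-r)\,\zeta(s-\ell)+\sum_{k=0}^{r+\ell-1}\frac{(r+\ell-1)!\,\zeta(r-k)}{x^{1-r-\ell+k}\,k!\,(r+\ell-k-1)!}\,\zeta(-r+s-\ell+k+1)+O(|t-(1-r-\ell)|).$$ **Case II.** For a fixed $s\in\mathbb{Z}$ with $s>r+\ell$ and $s=\ell+1$, around $t=1-r-\ell$, $$\Theta(r,s,t,x)=\frac{(-1)^{r-1}(-r)!\,x^{\ell}\,(r+\ell-1)!}{\ell!\,(t-(1-r-\ell))}+(-1)^{r-1}(-r)!\,x^{\ell}\,\frac{(r+\ell-1)!}{\ell!}\big(\gamma-\log(x)+H_{\ell}-H_{r+\ell-1}\big)+\sum_{k=0}^{r+\ell-1}\binom{r+\ell-1}{k}\frac{\zeta(r-k)}{x^{k-r-\ell+1}}\,\zeta(k-r+2)+O(|t-(1-r-\ell)|).$$ **Case III.** For a fixed $s\in\mathbb{Z}\setminus\mathbb{N}$ with $s\le r+\ell$, around $t=1-r-\ell$,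 $$\Theta(r,s,t,x)=(-1)^{r-1}x^{\ell}\frac{(-r)!\,(r+\ell-1)!}{\ell!}\zeta(s-\ell)+\sum_{k=0}^{r+\ell-1}\frac{\zeta(r-k)\,(r+\ell-1)!}{x^{k-r-\ell+1}\,k!\,(r+\ell-k-1)!}\,\zeta(s+1-r-\ell+k)+(-1)^{s-1}x^{s-1}\frac{(r+\ell-1)!\,(-s)!}{(r+\ell-s)!}\,\zeta(s-\ell)+O(|t-(1-r-\ell)|).$$ **Case IV.** For a fixed $s\in\mathbb{N}$ with $s\le r+\ell$, around $t=1-r-\ell$, $$\begin{aligned}\Theta(r,s,t,x)=\;&x^{s-1}\frac{(r+\ell-1)!}{(r+\ell-s)!\,(s-1)!}\,\frac{\zeta(s-\ell)}{t-(1-r-\ell)}\\&+x^{s-1}\frac{(r+\ell-1)!}{(r+\ell-s)!\,(s-1)!}\big(\gamma-H_{r+\ell-1}+H_{s-1}-\log(x)\big)\zeta(s-\ell)-(-1)^{r}x^{\ell}\frac{(-r)!\,(r+\ell-1)!}{\ell!}\zeta(s-\ell)\\&+\sum_{\substack{k=0\\k\neq r+\ell-s}}^{r+\ell-1}\frac{(r+\ell-1)!\,\zeta(r-k)}{(r+\ell-k-1)!\,x^{k-r-\ell+1}\,k!}\,\zeta(s-r-\ell+k+1)+O(|t-(1-r-\ell)|).\end{aligned}$$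
   Context: $\mathbb{N}=\{1,2,3,\dots\}$, so $\mathbb{Z}\setminus\mathbb{N}=\{0,-1,-2,\dots\}$. For $x>0$ the generalized Mordell-Tornheim zeta function is $$\Theta(r,s,t,x)=\sum_{n=1}^{\infty}\sum_{m=1}^{\infty}\frac{1}{n^{r}m^{s}(n+mx)^{t}},$$ absolutely convergent for $(r,s,t)\in\mathbb{C}^3$ with $\Re(r+t)>1$, $\Re(s+t)>1$, $\Re(r+s+t)>2$. It is continued meromorphically to $\mathbb{C}^3$; for fixed $r,s$ it is regarded as a meromorphic function of $t\in\mathbb{C}$ via this continuation. $\zeta$ is the (meromorphically continued) Riemann zeta function, $\Gamma$ the Gamma function, $\gamma$ Euler's constant, $H_n=\sum_{j=1}^n 1/j$ the $n$-th harmonic number with $H_0=0$. The phrase ''around $t=t_0$'' with a term $O(|t-t_0|)$ means as $t\to t_0$, with $r,s,x,\ell$ fixed. *)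

(* Defs.v *)
From Stdlib Require Import Reals ZArith.
From Coquelicot Require Import Coquelicot.
Open Scope R_scope.

(** [f] is complex (Frechet) differentiable at every point near [p]; used with
    [U] equal to [C] and to [C3]. *)
Definition holomorphic_at {U : NormedModule C_AbsRing}
    (f : U -> C_NormedModule) (p : U) : Prop :=
  locally p (fun q => ex_filterdiff f (locally q)).

(** Near [p], [f] is a quotient [g / h] of holomorphic functions, where the
    germ of [h] at [p] is not zero.  Functions being total, the values of [f]
    on the zero set of [h] (poles, points of indeterminacy) are arbitrary. *)
Definition meromorphic_at {U : NormedModule C_AbsRing}
    (f : U -> C_NormedModule) (p : U) : Prop :=
  exists g h : U -> C_NormedModule,
    holomorphic_at g p /\ holomorphic_at h p /\
    ~ locally p (fun q => h q = RtoC 0) /\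
    locally p (fun q => h q <> RtoC 0 -> f q = (g q / h q)%C).

Definition meromorphic {U : NormedModule C_AbsRing}
    (f : U -> C_NormedModule) : Prop :=
  forall p : U, meromorphic_at f p.

Definition C3 : NormedModule C_AbsRing :=
  prod_NormedModule C_AbsRing
    (prod_NormedModule C_AbsRing C_NormedModule C_NormedModule) C_NormedModule.

Definition IZC (n : Z) : C := RtoC (IZR n).

(** [a ^ z = exp (z * ln a)], for [0 < a]. *)
Definition cpow (a : R) (z : C) : C :=
  (RtoC (exp (Re z * ln a)) * (cos (Im z * ln a), sin (Im z * ln a)))%C.

Definition is_Cseries (a : nat -> C) (v : C) : Prop :=
  is_series (K := C_AbsRing) (V := C_NormedModule) a v.

Definition Csum (a : nat -> C) (n : nat) : C := sum_n (G := C_AbelianMonoid) a n.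

(** [zeta] is the Riemann zeta function. Its value at the pole 1 is arbitrary. *)
Definition is_Riemann_zeta (zeta : C -> C) : Prop :=
  (forall s : C, 1 < Re s ->
     is_Cseries (fun n => / cpow (INR (S n)) s)%C (zeta s)) /\
  (forall s : C, s <> RtoC 1 ->
     holomorphic_at (U := C_NormedModule) zeta s) /\
  meromorphic (U := C_NormedModule) zeta.

(** The term of index [(n, m)]; the indices run over the positive integers. *)
Definition Theta_term (x : R) (r s t : C) (n m : nat) : C :=
  (/ (cpow (INR n) r * cpow (INR m) s * cpow (INR n + INR m * x) t))%C.

Definition is_Theta_series (x : R) (r s t v : C) : Prop :=
  exists inner : nat -> C,
    (forall n, is_Cseries (fun m => Theta_term x r s t (S n) (S m)) (inner n)) /\
    is_Cseries inner v.

(** [Theta] is the meromorphic continuation to [C^3] of the double series.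
    The last clause expresses that [Theta r s] may be regarded as a meromorphic
    function of [t] for all fixed [r] and [s], i.e. that no line
    [{(r, s)} x C] lies in the singular locus; it thereby determines
    [Theta r s t] for all [t] outside a discrete set. *)
Definition is_Theta (x : R) (Theta : C -> C -> C -> C) : Prop :=
  (forall r s t : C,
     1 < Re (r + t)%C -> 1 < Re (s + t)%C -> 2 < Re (r + s + t)%C ->
     is_Theta_series x r s t (Theta r s t)) /\
  meromorphic (U := C3) (fun p => Theta (fst (fst p)) (snd (fst p)) (snd p)) /\
  (forall r s : C, meromorphic (U := C_NormedModule) (Theta r s)).

(** Euler's integral, which converges for [0 < z]. *)
Definition Gamma (z : R) : R :=
  RInt_gen (fun u => Rpower u (z - 1) * exp (- u)) (at_right 0) (Rbar_locally p_infty).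

Definition harmonic (n : nat) : R := sum_n_m (fun j => / INR j) 1 n.

Definition Euler_gamma : R := real (Lim_seq (fun n => harmonic n - ln (INR n))).

(** Only meaningful for [0 <= n]. *)
Definition Zfact (n : Z) : R := INR (fact (Z.to_nat n)).

(** [f t = g t + O(|t - t0|)] as [t] tends to [t0], [t <> t0]. *)
Definition eq_up_to_O (t0 : C) (f g : C -> C) : Prop :=
  exists M : R,
    locally' (T := C_UniformSpace) t0
      (fun t => Cmod (f t - g t) <= M * Cmod (t - t0)).

(* Main.v *)
(* For [r = - rho], summing over [n] first, Euler-Maclaurin expands the inner sum of
   [n^rho (n + m x)^(-t)] into a beta integral [rho! / ((t-1) ... (t-rho-1)) (m x)^(rho+1-t)], the
   terms [zeta (- rho - k) binom(-t, k) (m x)^(-t-k)], and a remainder that decays in [m] as fast as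
   one likes.  Summing over [m] against [m^(-s)] replaces the powers of [m] by values of [zeta] at
   [s + t - rho - 1] and [s + t + k], with a remainder holomorphic on as large a half-plane as needed;
   since the summand is a polynomial in [n] when [t = - N], the remainder vanishes there.  The
   identity theorem makes this the expansion of the continued [Theta] around [t0 = - N], and the
   four cases record which argument of [zeta] hits the pole 1: none, the leading one, one with
   [k > N] (where the binomial coefficient vanishes, leaving a finite contribution), or one with
   [k <= N].  Isolated zeros, uniform limits and the identity theorem come from Goursat's theorem. *)
Require Import Defs.
From Stdlib Require Import Reals ZArith Wf_nat Lra Lia Psatz Classical ClassicalEpsilon.
From Coquelicot Require Import Coquelicot.
Open Scope R_scope.

(** * Complex differentiability *)

(** Euler-Maclaurin is carried out only for [r = 0], where the inner sum is a Hurwitz zeta function;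
    writing n = (n + m x) - m x then raises the power of n at the price of shifting [t] or [s] by 1.
    The main terms obey the same recursion, and each step uses up one term of the expansion. Neither
    Bernoulli polynomials nor remainder integrals occur: on a unit interval the error is a
    combination of Taylor remainders, and the coefficients are defined by the recursion that cancels
    the Taylor polynomials. Working with 1 - t times the sum makes this error entire in [t], and its
    bound carries the factor (1 - t)(- t)...(- t - J), which is what makes it vanish at t = - N.
    Vanishing and differentiability there already give O(|t - t0|). [Theta] is known only through
    its series and its meromorphy in [t], so the two sides are compared along a horizontal segment
    reaching into the region of convergence, and always on punctured neighbourhoods. The constant
    term of zeta at 1, hence Euler's constant, comes from the same expansion by termwise
    differentiation, and so do the values of zeta at the nonpositive integers. *)

Lemma C_ext (z w : C) : Re z = Re w -> Im z = Im w -> z = w.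
Proof. destruct z, w; cbn; intros; subst; reflexivity. Qed.

Lemma Cmod_le_abs (z : C) : Cmod z <= Rabs (Re z) + Rabs (Im z).
Proof.
  unfold Cmod. fold (Re z) (Im z).
  pose proof (Rabs_pos (Re z)); pose proof (Rabs_pos (Im z)).
  rewrite <- (sqrt_Rsqr (Rabs (Re z) + Rabs (Im z))) by lra.
  apply sqrt_le_1_alt. unfold Rsqr.
  rewrite <- (pow2_abs (Re z)), <- (pow2_abs (Im z)). nra.
Qed.

Lemma im_le_Cmod (z : C) : Rabs (Im z) <= Cmod z.
Proof.
  eapply Rle_trans; [apply (Rmax_r (Rabs (fst z)))|]. apply Rmax_Cmod.
Qed.

Lemma Cmod_minus_sym (z w : C) : Cmod (z - w) = Cmod (w - z).
Proof. rewrite <- Cmod_opp. f_equal. ring. Qed.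

Lemma Cmod_triangle_minus (z w : C) : Cmod (z - w) <= Cmod z + Cmod w.
Proof. unfold Cminus. rewrite <- (Cmod_opp w). apply Cmod_triangle. Qed.

Lemma Cmod_triangle_inv (z w : C) : Cmod z - Cmod w <= Cmod (z - w).
Proof.
  replace z with ((z - w) + w)%C at 1 by ring.
  pose proof (Cmod_triangle (z - w) w). lra.
Qed.

Lemma RtoC_neq (a b : R) : a <> b -> RtoC a <> RtoC b.
Proof. intros H E. apply H, RtoC_inj, E. Qed.

Lemma INR_RtoC_S_neq (n : nat) : RtoC (INR (S n)) <> 0%C.
Proof. apply RtoC_neq, not_0_INR. discriminate. Qed.

(** * Neighbourhoods measured by the modulus *)

Definition near (p : C) (P : C -> Prop) : Prop :=
  exists d : R, 0 < d /\ forall w : C, Cmod (w - p) < d -> P w.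

Lemma near_imp (p : C) (P Q : C -> Prop) :
  (forall w, P w -> Q w) -> near p P -> near p Q.
Proof. intros H [d [Hd HP]]. exists d; split; auto. Qed.

Lemma near_and (p : C) (P Q : C -> Prop) :
  near p P -> near p Q -> near p (fun w => P w /\ Q w).
Proof.
  intros [d [Hd HP]] [e [He HQ]]. exists (Rmin d e); split.
  - apply Rmin_pos; assumption.
  - intros w Hw. pose proof (Rmin_l d e). pose proof (Rmin_r d e).
    split; [apply HP|apply HQ]; lra.
Qed.

Lemma near_self (p : C) (P : C -> Prop) : near p P -> P p.
Proof.
  intros [d [Hd HP]]. apply HP.
  replace (p - p)%C with (RtoC 0) by ring. rewrite Cmod_0; exact Hd.
Qed.

Lemma near_near (p : C) (P : C -> Prop) : near p P -> near p (fun q => near q P).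
Proof.
  intros [d [Hd HP]]. exists d; split; auto. intros q Hq.
  exists (d - Cmod (q - p)); split; [lra|]. intros w Hw. apply HP.
  replace (w - p)%C with ((w - q) + (q - p))%C by ring.
  pose proof (Cmod_triangle (w - q) (q - p)). lra.
Qed.

Lemma near_True (p : C) (P : C -> Prop) : (forall w, P w) -> near p P.
Proof. intros H. exists 1. split; [lra|auto]. Qed.

Lemma near_ball (p c : C) (r : R) : Cmod (p - c) < r -> near p (fun w => Cmod (w - c) < r).
Proof.
  intros H. exists (r - Cmod (p - c)); split; [lra|]. intros w Hw.
  replace (w - c)%C with ((w - p) + (p - c))%C by ring.
  pose proof (Cmod_triangle (w - p) (p - c)). lra.
Qed.

Lemma near_Re_gt (p : C) (a : R) : a < Re p -> near p (fun w => a < Re w).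
Proof.
  intros H. exists (Re p - a); split; [lra|]. intros w Hw.
  pose proof (re_le_Cmod (w - p)) as H1.
  unfold Cminus in H1. rewrite re_plus, re_opp in H1.
  apply Rabs_le_between in H1. unfold Cminus in Hw. lra.
Qed.

Lemma near_neq (p c : C) : p <> c -> near p (fun w => w <> c).
Proof.
  intros H. exists (Cmod (p - c)); split.
  - apply Cmod_gt_0. intros E. apply H. replace p with (p - c + c)%C by ring. rewrite E; ring.
  - intros w Hw E. subst. rewrite Cmod_minus_sym in Hw. lra.
Qed.

(** The balls of [C_UniformSpace] are squares. The square of half-side [d / 2] lies in the disc of
    radius [d] because the modulus is at most |Re| + |Im|; a disc lies in the square of the same
    size. *)
Lemma near_locally (p : C) (P : C -> Prop) :
  near p P <-> locally (T := C_UniformSpace) p P.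
Proof.
  split.
  - intros [d [Hd HP]].
    assert (Hd2 : 0 < d / 2) by lra.
    exists (mkposreal _ Hd2). intros w [H1 H2]. apply HP.
    change (Rabs (minus (fst w) (fst p)) < d / 2) in H1.
    change (Rabs (minus (snd w) (snd p)) < d / 2) in H2.
    eapply Rle_lt_trans; [apply Cmod_le_abs|].
    unfold minus, plus, opp in *; cbn in *.
    unfold Rminus in *. lra.
  - intros [[d Hd] HP]. exists d; split; auto. intros w Hw. apply HP.
    pose proof (re_le_Cmod (w - p)); pose proof (im_le_Cmod (w - p)).
    split; change (Rabs (minus (fst w) (fst p)) < d) || change (Rabs (minus (snd w) (snd p)) < d);
    unfold minus, plus, opp in *; cbn in *; lra.
Qed.

Lemma near_locally' (p : C) (P : C -> Prop) :
  near p (fun w => w <> p -> P w) <-> locally' (T := C_UniformSpace) p P.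
Proof. unfold locally', within. rewrite near_locally. reflexivity. Qed.

(** * Complex derivatives and their calculus *)

Definition cderiv (f : C -> C) (z l : C) : Prop :=
  forall eps : R, 0 < eps ->
    near z (fun w => Cmod (f w - f z - l * (w - z)) <= eps * Cmod (w - z)).

Definition cdiff (f : C -> C) (z : C) : Prop := exists l, cderiv f z l.

Definition hol (f : C -> C) (p : C) : Prop := near p (cdiff f).

Lemma hol_cdiff (f : C -> C) (p : C) : hol f p -> cdiff f p.
Proof. apply near_self. Qed.

Lemma cdiff_everywhere_hol (f : C -> C) : (forall z, cdiff f z) -> forall p, hol f p.
Proof. intros H p. apply near_True, H. Qed.

(** A complex-linear map is multiplication by its value at 1, which is therefore the derivative. *)
Lemma cdiff_filterdiff (f : C -> C) (z : C) :
  ex_filterdiff (U := C_NormedModule) (V := C_NormedModule) f (locally z) -> cdiff f z.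
Proof.
  intros [l [Hl Hd]]. exists (l (RtoC 1)). intros eps Heps.
  specialize (Hd z (fun P HP => HP) (mkposreal eps Heps)).
  apply near_locally. revert Hd. apply filter_imp. intros w Hw.
  change (Cmod (minus (minus (f w) (f z)) (l (minus w z))) <= eps * Cmod (minus w z)) in Hw.
  replace (f w - f z - l (RtoC 1) * (w - z))%C with (minus (minus (f w) (f z)) (l (minus w z))).
  - exact Hw.
  - assert (E : l (minus w z) = (l (RtoC 1) * (w - z))%C).
    { replace (minus w z) with (scal (K := C_AbsRing) (V := C_NormedModule) (w - z)%C (RtoC 1)).
      - rewrite (linear_scal l Hl).
        change ((w - z) * l (RtoC 1) = l (RtoC 1) * (w - z))%C. ring.
      - change ((w - z) * RtoC 1 = w - z)%C. ring. }
    rewrite E. reflexivity.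
Qed.

Lemma holomorphic_at_hol (f : C -> C) (p : C) :
  holomorphic_at (U := C_NormedModule) f p -> hol f p.
Proof.
  intros [e H]. apply near_locally. exists e.
  intros w Hw. apply cdiff_filterdiff, H, Hw.
Qed.

Lemma cderiv_lip (f : C -> C) (z l : C) : cderiv f z l ->
  near z (fun w => Cmod (f w - f z) <= (Cmod l + 1) * Cmod (w - z)).
Proof.
  intros H. generalize (H 1 Rlt_0_1). apply near_imp. intros w Hw.
  replace (f w - f z)%C with ((f w - f z - l * (w - z)) + l * (w - z))%C by ring.
  eapply Rle_trans; [apply Cmod_triangle|]. rewrite Cmod_mult. lra.
Qed.

Definition ccont (f : C -> C) (z : C) : Prop :=
  forall eps, 0 < eps -> near z (fun w => Cmod (f w - f z) < eps).

Lemma cdiff_ccont (f : C -> C) (z : C) : cdiff f z -> ccont f z.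
Proof.
  intros [l H] eps Heps. pose proof (Cmod_ge_0 l).
  assert (H2 : near z (fun w => Cmod (w - z) < eps / (Cmod l + 1))).
  { exists (eps / (Cmod l + 1)); split; auto. apply Rdiv_lt_0_compat; lra. }
  generalize (near_and _ _ _ (cderiv_lip _ _ _ H) H2). apply near_imp.
  intros w [Ha Hb]. eapply Rle_lt_trans; [apply Ha|].
  apply (Rmult_lt_compat_l (Cmod l + 1)) in Hb; [|lra].
  replace ((Cmod l + 1) * (eps / (Cmod l + 1))) with eps in Hb by (field; lra). exact Hb.
Qed.

Lemma ccont_bounded (f : C -> C) (z : C) : ccont f z ->
  near z (fun w => Cmod (f w) <= Cmod (f z) + 1).
Proof.
  intros H. generalize (H 1 Rlt_0_1). apply near_imp. intros w Hw.
  replace (f w) with ((f w - f z) + f z)%C by ring.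
  pose proof (Cmod_triangle (f w - f z) (f z)). lra.
Qed.

Lemma ccont_neq0 (f : C -> C) (z : C) : ccont f z -> f z <> 0%C ->
  near z (fun w => Cmod (f z) / 2 < Cmod (f w)).
Proof.
  intros H Hz. apply Cmod_gt_0 in Hz.
  generalize (H (Cmod (f z) / 2) ltac:(lra)). apply near_imp. intros w Hw.
  rewrite Cmod_minus_sym in Hw. pose proof (Cmod_triangle_inv (f z) (f w)). lra.
Qed.

Lemma cderiv_near_ext (f g : C -> C) (z l : C) :
  near z (fun w => f w = g w) -> cderiv f z l -> cderiv g z l.
Proof.
  intros He H eps Heps. pose proof (near_self _ _ He) as Ez. cbn in Ez.
  generalize (near_and _ _ _ He (H eps Heps)). apply near_imp.
  intros w [E Hw]. rewrite <- E, <- Ez. exact Hw.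
Qed.

Lemma cdiff_near_ext (f g : C -> C) (z : C) :
  near z (fun w => f w = g w) -> cdiff f z -> cdiff g z.
Proof. intros He [l H]. exists l. eapply cderiv_near_ext; eauto. Qed.

Lemma cdiff_ext (f g : C -> C) (z : C) : (forall w, f w = g w) -> cdiff f z -> cdiff g z.
Proof. intros H. apply cdiff_near_ext, near_True, H. Qed.

Lemma cderiv_const (c z : C) : cderiv (fun _ => c) z 0%C.
Proof.
  intros eps Heps. apply near_True. intros w.
  replace (c - c - 0 * (w - z))%C with (RtoC 0) by ring. rewrite Cmod_0.
  pose proof (Cmod_ge_0 (w - z)). nra.
Qed.

Lemma cderiv_id (z : C) : cderiv (fun w => w) z 1%C.
Proof.
  intros eps Heps. apply near_True. intros w.
  replace (w - z - 1 * (w - z))%C with (RtoC 0) by ring. rewrite Cmod_0.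
  pose proof (Cmod_ge_0 (w - z)). nra.
Qed.

Lemma cderiv_plus (f g : C -> C) (z l m : C) : cderiv f z l -> cderiv g z m ->
  cderiv (fun w => f w + g w)%C z (l + m)%C.
Proof.
  intros Hf Hg eps Heps.
  generalize (near_and _ _ _ (Hf (eps / 2) ltac:(lra)) (Hg (eps / 2) ltac:(lra))).
  apply near_imp. intros w [H1 H2].
  replace (f w + g w - (f z + g z) - (l + m) * (w - z))%C
    with ((f w - f z - l * (w - z)) + (g w - g z - m * (w - z)))%C by ring.
  eapply Rle_trans; [apply Cmod_triangle|]. lra.
Qed.

Lemma cderiv_mult (f g : C -> C) (z l m : C) : cderiv f z l -> cderiv g z m ->
  cderiv (fun w => f w * g w)%C z (l * g z + f z * m)%C.
Proof.
  intros Hf Hg eps Heps.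
  pose proof (Cmod_ge_0 l); pose proof (Cmod_ge_0 m);
  pose proof (Cmod_ge_0 (f z)); pose proof (Cmod_ge_0 (g z)).
  set (K := (Cmod l + 1) * (Cmod m + 1)).
  assert (HK : 0 < K) by (unfold K; nra).
  set (e1 := eps / (3 * (Cmod (g z) + 1))).
  set (e2 := eps / (3 * (Cmod (f z) + 1))).
  assert (He1 : 0 < e1) by (apply Rdiv_lt_0_compat; lra).
  assert (He2 : 0 < e2) by (apply Rdiv_lt_0_compat; lra).
  (* This radius handles the product of the two increments, which is at most K |w - z|^2. *)
  assert (Hs : near z (fun w => Cmod (w - z) < eps / (3 * K))).
  { exists (eps / (3 * K)); split; auto. apply Rdiv_lt_0_compat; lra. }
  generalize (near_and _ _ _ Hs (near_and _ _ _ (near_and _ _ _ (cderiv_lip _ _ _ Hf) (cderiv_lip _ _ _ Hg))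
     (near_and _ _ _ (Hf e1 He1) (Hg e2 He2)))).
  apply near_imp. intros w [Hs0 [[Hg1 Hg2] [Hg3 Hg4]]].
  replace (f w * g w - f z * g z - (l * g z + f z * m) * (w - z))%C
    with ((f w - f z - l * (w - z)) * g z + f z * (g w - g z - m * (w - z))
          + (f w - f z) * (g w - g z))%C by ring.
  eapply Rle_trans; [apply Cmod_triangle|].
  eapply Rle_trans; [apply Rplus_le_compat_r, Cmod_triangle|].
  rewrite !Cmod_mult. set (t := Cmod (w - z)) in *.
  assert (Ht : 0 <= t) by apply Cmod_ge_0.
  assert (A1 : Cmod (f w - f z - l * (w - z)) * Cmod (g z) <= eps / 3 * t).
  { eapply Rle_trans; [apply Rmult_le_compat_r; [lra|exact Hg3]|].
    replace (eps / 3 * t) with (e1 * t * (Cmod (g z) + 1)) by (unfold e1; field; lra).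
    apply Rmult_le_compat_l; nra. }
  assert (A2 : Cmod (f z) * Cmod (g w - g z - m * (w - z)) <= eps / 3 * t).
  { eapply Rle_trans; [apply Rmult_le_compat_l; [lra|exact Hg4]|].
    replace (eps / 3 * t) with ((Cmod (f z) + 1) * (e2 * t)) by (unfold e2; field; lra).
    apply Rmult_le_compat_r; nra. }
  assert (A3 : Cmod (f w - f z) * Cmod (g w - g z) <= eps / 3 * t).
  { eapply Rle_trans; [apply Rmult_le_compat; [apply Cmod_ge_0|apply Cmod_ge_0|exact Hg1|exact Hg2]|].
    replace ((Cmod l + 1) * t * ((Cmod m + 1) * t)) with (K * t * t) by (unfold K; ring).
    apply Rmult_le_compat_r; auto.
    apply (Rmult_lt_compat_l K) in Hs0; auto.
    replace (K * (eps / (3 * K))) with (eps / 3) in Hs0 by (field; lra). lra. }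
  lra.
Qed.

Lemma cderiv_inv (f : C -> C) (z l : C) : cderiv f z l -> f z <> 0%C ->
  cderiv (fun w => / f w)%C z (- l / (f z * f z))%C.
Proof.
  intros Hf Hz eps Heps.
  pose proof (proj1 (Cmod_gt_0 _) Hz) as Hm. set (A := Cmod (f z)) in *.
  pose proof (Cmod_ge_0 l).
  assert (HAA : 0 < A * A) by (apply Rmult_lt_0_compat; auto).
  assert (HeAA : 0 < eps * A * A) by (rewrite Rmult_assoc; apply Rmult_lt_0_compat; auto).
  set (e1 := eps * A * A / 2). assert (He1 : 0 < e1) by (unfold e1; lra).
  set (B := (Cmod l + 1) * (Cmod l + 1)). assert (HB : 0 < B) by (unfold B; nra).
  (* Where |f w| > A / 2, this radius keeps the quadratic part of the error, (f w - f z)^2 divided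
     by f w (f z)^2, below eps / 2 times |w - z|. *)
  set (d := eps * A * A * A / (4 * B)).
  assert (Hd : 0 < d). { unfold d. apply Rdiv_lt_0_compat; [|lra]. repeat apply Rmult_lt_0_compat; auto. }
  assert (Hs : near z (fun w => Cmod (w - z) < d)) by (exists d; split; auto).
  assert (Hc : ccont f z) by (apply cdiff_ccont; exists l; exact Hf).
  generalize (near_and _ _ _ Hs (near_and _ _ _ (ccont_neq0 _ _ Hc Hz)
    (near_and _ _ _ (cderiv_lip _ _ _ Hf) (Hf e1 He1)))).
  apply near_imp. intros w [H0 [H1 [H2 H3]]]. fold A in H1.
  assert (Hw : f w <> 0%C). { apply Cmod_gt_0. lra. }
  replace (/ f w - / f z - - l / (f z * f z) * (w - z))%C
    with (- (f w - f z - l * (w - z)) / (f z * f z)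
          + (f w - f z) * (f w - f z) / (f w * (f z * f z)))%C by (field; auto).
  eapply Rle_trans; [apply Cmod_triangle|].
  assert (Hzz : (f z * f z)%C <> 0%C) by (apply Cmult_neq_0; auto).
  assert (Hwzz : (f w * (f z * f z))%C <> 0%C) by (apply Cmult_neq_0; auto).
  rewrite !Cmod_div by assumption. rewrite Cmod_opp, !Cmod_mult. fold A.
  set (t := Cmod (w - z)) in *. assert (Ht : 0 <= t) by apply Cmod_ge_0.
  assert (A1 : Cmod (f w - f z - l * (w - z)) / (A * A) <= eps / 2 * t).
  { apply Rle_div_l; [nra|]. eapply Rle_trans; [exact H3|]. unfold e1. right; field. }
  assert (A2 : Cmod (f w - f z) * Cmod (f w - f z) / (Cmod (f w) * (A * A)) <= eps / 2 * t).
  { apply Rle_div_l; [assert (0 < A * A) by nra; nra|].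
    eapply Rle_trans; [apply Rmult_le_compat; [apply Cmod_ge_0|apply Cmod_ge_0|exact H2|exact H2]|].
    replace ((Cmod l + 1) * t * ((Cmod l + 1) * t)) with (t * (B * t)) by (unfold B; ring).
    replace (eps / 2 * t * (Cmod (f w) * (A * A))) with (t * (eps / 2 * (A * A) * Cmod (f w))) by ring.
    apply Rmult_le_compat_l; auto.
    apply Rle_trans with (B * d); [apply Rmult_le_compat_l; lra|].
    replace (B * d) with (eps / 2 * (A * A) * (A / 2)) by (unfold d; field; lra).
    apply Rmult_le_compat_l; [|lra]. assert (0 < A * A) by nra. nra. }
  lra.
Qed.

Lemma cderiv_comp (f g : C -> C) (z l m : C) : cderiv g z m -> cderiv f (g z) l ->
  cderiv (fun w => f (g w)) z (l * m)%C.
Proof.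
  intros Hg Hf eps Heps.
  pose proof (Cmod_ge_0 l); pose proof (Cmod_ge_0 m).
  set (e1 := eps / (2 * (Cmod m + 1))). set (e2 := eps / (2 * (Cmod l + 1))).
  assert (He1 : 0 < e1) by (apply Rdiv_lt_0_compat; lra).
  assert (He2 : 0 < e2) by (apply Rdiv_lt_0_compat; lra).
  destruct (Hf e1 He1) as [d [Hd Hfd]].
  assert (Hc : ccont g z) by (apply cdiff_ccont; exists m; exact Hg).
  generalize (near_and _ _ _ (Hc d Hd) (near_and _ _ _ (cderiv_lip _ _ _ Hg) (Hg e2 He2))).
  apply near_imp. intros w [H1 [H2 H3]]. specialize (Hfd _ H1).
  replace (f (g w) - f (g z) - l * m * (w - z))%C
    with ((f (g w) - f (g z) - l * (g w - g z)) + l * (g w - g z - m * (w - z)))%C by ring.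
  eapply Rle_trans; [apply Cmod_triangle|]. rewrite Cmod_mult.
  set (t := Cmod (w - z)) in *. assert (Ht : 0 <= t) by apply Cmod_ge_0.
  assert (A1 : e1 * Cmod (g w - g z) <= eps / 2 * t).
  { eapply Rle_trans; [apply Rmult_le_compat_l; [lra|exact H2]|].
    right. unfold e1. field. lra. }
  assert (A2 : Cmod l * Cmod (g w - g z - m * (w - z)) <= eps / 2 * t).
  { eapply Rle_trans; [apply Rmult_le_compat_l; [lra|exact H3]|].
    replace (eps / 2 * t) with ((Cmod l + 1) * (e2 * t)) by (unfold e2; field; lra).
    apply Rmult_le_compat_r; nra. }
  lra.
Qed.

Lemma cdiff_const (c z : C) : cdiff (fun _ => c) z.
Proof. eexists; apply cderiv_const. Qed.
Lemma cdiff_id (z : C) : cdiff (fun w => w) z.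
Proof. eexists; apply cderiv_id. Qed.
Lemma cdiff_plus (f g : C -> C) (z : C) : cdiff f z -> cdiff g z -> cdiff (fun w => f w + g w)%C z.
Proof. intros [? ?] [? ?]. eexists; apply cderiv_plus; eassumption. Qed.
Lemma cdiff_mult (f g : C -> C) (z : C) : cdiff f z -> cdiff g z -> cdiff (fun w => f w * g w)%C z.
Proof. intros [? ?] [? ?]. eexists; apply cderiv_mult; eassumption. Qed.
Lemma cdiff_inv (f : C -> C) (z : C) : cdiff f z -> f z <> 0%C -> cdiff (fun w => / f w)%C z.
Proof. intros [? ?] ?. eexists; apply cderiv_inv; eassumption. Qed.
Lemma cdiff_comp (f g : C -> C) (z : C) : cdiff g z -> cdiff f (g z) -> cdiff (fun w => f (g w)) z.
Proof. intros [? ?] [? ?]. eexists. eapply cderiv_comp; eassumption. Qed.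
Lemma cdiff_opp (f : C -> C) (z : C) : cdiff f z -> cdiff (fun w => - f w)%C z.
Proof.
  intros H. apply cdiff_ext with (fun w => - (1) * f w)%C.
  - intros w. ring.
  - apply cdiff_mult; auto using cdiff_const.
Qed.
Lemma cdiff_minus (f g : C -> C) (z : C) : cdiff f z -> cdiff g z -> cdiff (fun w => f w - g w)%C z.
Proof. intros. apply cdiff_plus; auto using cdiff_opp. Qed.
Lemma cdiff_div (f g : C -> C) (z : C) : cdiff f z -> cdiff g z -> g z <> 0%C ->
  cdiff (fun w => f w / g w)%C z.
Proof. intros. apply cdiff_mult; auto using cdiff_inv. Qed.
Lemma hol_plus (f g : C -> C) (p : C) : hol f p -> hol g p -> hol (fun w => f w + g w)%C p.
Proof.
  intros Hf Hg. generalize (near_and _ _ _ Hf Hg). apply near_imp.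
  intros w [? ?]. apply cdiff_plus; auto.
Qed.
Lemma hol_mult (f g : C -> C) (p : C) : hol f p -> hol g p -> hol (fun w => f w * g w)%C p.
Proof.
  intros Hf Hg. generalize (near_and _ _ _ Hf Hg). apply near_imp.
  intros w [? ?]. apply cdiff_mult; auto.
Qed.
Lemma hol_inv (f : C -> C) (p : C) : hol f p -> f p <> 0%C -> hol (fun w => / f w)%C p.
Proof.
  intros Hf Hp. pose proof (ccont_neq0 _ _ (cdiff_ccont _ _ (hol_cdiff _ _ Hf)) Hp) as H.
  generalize (near_and _ _ _ Hf H). apply near_imp.
  intros w [? Hw]. apply cdiff_inv; auto. apply Cmod_gt_0. pose proof (Cmod_ge_0 (f p)). lra.
Qed.
Lemma hol_const (c p : C) : hol (fun _ => c) p.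
Proof. apply cdiff_everywhere_hol, cdiff_const. Qed.
Lemma hol_shift (f : C -> C) (a p : C) : hol f (p + a)%C -> hol (fun w => f (w + a)%C) p.
Proof.
  intros [d [Hd H]]. exists d; split; auto. intros w Hw.
  apply (cdiff_comp f (fun w => w + a)%C).
  - apply cdiff_plus; [apply cdiff_id|apply cdiff_const].
  - apply H. replace (w + a - (p + a))%C with (w - p)%C by ring. exact Hw.
Qed.

(** * Integrals of complex-valued functions of a real variable *)

(** Continuity, derivatives and integrals along real parameters are taken componentwise, so that the
    theory of real integrals applies to each part. *)
Definition rcont (f : R -> C) (x : R) : Prop :=
  continuous (fun t => Re (f t)) x /\ continuous (fun t => Im (f t)) x.

Lemma continuous_R_eps (f : R -> R) (x : R) :
  continuous f x <->
  forall eps, 0 < eps -> exists d, 0 < d /\ forall y, Rabs (y - x) < d -> Rabs (f y - f x) < eps.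
Proof.
  split.
  - intros H eps Heps.
    destruct (proj1 (filterlim_locally f (f x)) H (mkposreal eps Heps)) as [[d Hd] Hb].
    exists d; split; auto.
  - intros H. apply filterlim_locally. intros [eps Heps].
    destruct (H eps Heps) as [d [Hd Hb]]. exists (mkposreal d Hd). intros y Hy. apply Hb, Hy.
Qed.

Lemma rcont_eps (f : R -> C) (x : R) :
  rcont f x <->
  forall eps, 0 < eps -> exists d, 0 < d /\ forall y, Rabs (y - x) < d -> Cmod (f y - f x) < eps.
Proof.
  unfold rcont. rewrite !continuous_R_eps. split.
  - intros [H1 H2] eps Heps.
    destruct (H1 (eps / 2) ltac:(lra)) as [d1 [Hd1 Hb1]].
    destruct (H2 (eps / 2) ltac:(lra)) as [d2 [Hd2 Hb2]].
    exists (Rmin d1 d2). split; [apply Rmin_pos; auto|]. intros y Hy.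
    specialize (Hb1 y ltac:(eapply Rlt_le_trans; [exact Hy|apply Rmin_l])).
    specialize (Hb2 y ltac:(eapply Rlt_le_trans; [exact Hy|apply Rmin_r])).
    eapply Rle_lt_trans; [apply Cmod_le_abs|].
    unfold Cminus. rewrite re_plus, re_opp, im_plus, im_opp. unfold Rminus in *. lra.
  - intros H. split; intros eps Heps; destruct (H eps Heps) as [d [Hd Hb]]; exists d; split; auto;
    intros y Hy; specialize (Hb y Hy); (eapply Rle_lt_trans; [|exact Hb]);
    [pose proof (re_le_Cmod (f y - f x)) as Q | pose proof (im_le_Cmod (f y - f x)) as Q];
    unfold Cminus in Q at 1; rewrite ?re_plus, ?re_opp, ?im_plus, ?im_opp in Q; exact Q.
Qed.

Lemma rcont_const (c : C) (x : R) : rcont (fun _ => c) x.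
Proof. split; apply continuous_const. Qed.

Lemma rcont_plus (f g : R -> C) (x : R) : rcont f x -> rcont g x -> rcont (fun t => f t + g t)%C x.
Proof.
  intros [H1 H2] [H3 H4]. split.
  - apply (continuous_plus (fun t => Re (f t)) (fun t => Re (g t))); auto.
  - apply (continuous_plus (fun t => Im (f t)) (fun t => Im (g t))); auto.
Qed.

Lemma rcont_mult (f g : R -> C) (x : R) : rcont f x -> rcont g x -> rcont (fun t => f t * g t)%C x.
Proof.
  intros [H1 H2] [H3 H4]. split.
  - apply (continuous_minus (fun t => Re (f t) * Re (g t)) (fun t => Im (f t) * Im (g t)));
    apply (@continuous_mult R_UniformSpace R_AbsRing); auto.
  - apply (continuous_plus (fun t => Re (f t) * Im (g t)) (fun t => Im (f t) * Re (g t)));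
    apply (@continuous_mult R_UniformSpace R_AbsRing); auto.
Qed.

Lemma rcont_comp (F : C -> C) (g : R -> C) (x : R) : ccont F (g x) -> rcont g x ->
  rcont (fun t => F (g t)) x.
Proof.
  intros HF Hg. rewrite rcont_eps in Hg. apply rcont_eps. intros eps Heps.
  destruct (HF eps Heps) as [d [Hd HFd]]. destruct (Hg d Hd) as [e [He Hge]].
  exists e; split; auto.
Qed.

Lemma rcont_ext (f g : R -> C) (x : R) : (forall t, f t = g t) -> rcont f x -> rcont g x.
Proof.
  intros H [H1 H2]. split; [apply continuous_ext with (fun t => Re (f t))|apply continuous_ext with (fun t => Im (f t))];
  auto; intros; rewrite H; reflexivity.
Qed.

Definition rderiv (f : R -> C) (x : R) (l : C) : Prop :=
  is_derive (fun t => Re (f t)) x (Re l) /\ is_derive (fun t => Im (f t)) x (Im l).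

Lemma rderiv_rcont (f : R -> C) (x : R) (l : C) : rderiv f x l -> rcont f x.
Proof.
  intros [H1 H2]. split.
  - apply (ex_derive_continuous (K := R_AbsRing) (V := R_NormedModule)). eexists; exact H1.
  - apply (ex_derive_continuous (K := R_AbsRing) (V := R_NormedModule)). eexists; exact H2.
Qed.

Lemma rderiv_eq (f : R -> C) (x : R) (l m : C) : l = m -> rderiv f x l -> rderiv f x m.
Proof. intros ->; auto. Qed.

Lemma rderiv_ext (f g : R -> C) (x : R) (l : C) : (forall t, f t = g t) -> rderiv f x l -> rderiv g x l.
Proof.
  intros H [H1 H2]. split; [apply is_derive_ext with (fun t => Re (f t))|apply is_derive_ext with (fun t => Im (f t))];
  auto; intros; rewrite H; reflexivity.
Qed.

Lemma rderiv_const (c : C) (x : R) : rderiv (fun _ => c) x 0%C.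
Proof. split; apply (is_derive_const (K := R_AbsRing) (V := R_NormedModule)). Qed.

Lemma rderiv_plus (f g : R -> C) (x : R) (l m : C) : rderiv f x l -> rderiv g x m ->
  rderiv (fun t => f t + g t)%C x (l + m)%C.
Proof.
  intros [H1 H2] [H3 H4]. split.
  - apply (is_derive_plus (fun t => Re (f t)) (fun t => Re (g t))); auto.
  - apply (is_derive_plus (fun t => Im (f t)) (fun t => Im (g t))); auto.
Qed.

Lemma rderiv_mult (f g : R -> C) (x : R) (l m : C) : rderiv f x l -> rderiv g x m ->
  rderiv (fun t => f t * g t)%C x (l * g x + f x * m)%C.
Proof.
  intros [H1 H2] [H3 H4]. split.
  - eapply (is_derive_ext (fun t => Re (f t) * Re (g t) - Im (f t) * Im (g t))); [intros; reflexivity|].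
    replace (Re (l * g x + f x * m)%C) with
      ((Re l * Re (g x) + Re (f x) * Re m) - (Im l * Im (g x) + Im (f x) * Im m))
      by (rewrite re_plus, !re_mult; ring).
    apply (is_derive_minus (K := R_AbsRing) (V := R_NormedModule)
       (fun t => Re (f t) * Re (g t)) (fun t => Im (f t) * Im (g t)));
    apply (is_derive_mult (K := R_AbsRing)); auto; intros; apply Rmult_comm.
  - eapply (is_derive_ext (fun t => Re (f t) * Im (g t) + Im (f t) * Re (g t))); [intros; reflexivity|].
    replace (Im (l * g x + f x * m)%C) with
      ((Re l * Im (g x) + Re (f x) * Im m) + (Im l * Re (g x) + Im (f x) * Re m))
      by (rewrite im_plus, !im_mult; ring).
    apply (is_derive_plus (K := R_AbsRing) (V := R_NormedModule)
       (fun t => Re (f t) * Im (g t)) (fun t => Im (f t) * Re (g t)));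
    apply (is_derive_mult (K := R_AbsRing)); auto; intros; apply Rmult_comm.
Qed.

Lemma rderiv_scal (c : C) (f : R -> C) (x : R) (l : C) : rderiv f x l ->
  rderiv (fun t => c * f t)%C x (c * l)%C.
Proof.
  intros H. apply rderiv_eq with (0 * f x + c * l)%C; [ring|].
  apply rderiv_mult; auto using rderiv_const.
Qed.

Definition CInt (f : R -> C) (a b : R) : C :=
  (RInt (fun t => Re (f t)) a b, RInt (fun t => Im (f t)) a b).

Definition rcont_on (f : R -> C) (a b : R) : Prop := forall x, a <= x <= b -> rcont f x.

Lemma rcont_on_sub (f : R -> C) (a b c d : R) : rcont_on f a b -> a <= c -> d <= b -> rcont_on f c d.
Proof. intros H ? ? x Hx. apply H. lra. Qed.

Lemma ex_RInt_rcont_on (f : R -> C) (a b : R) : a <= b -> rcont_on f a b ->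
  ex_RInt (fun t => Re (f t)) a b /\ ex_RInt (fun t => Im (f t)) a b.
Proof.
  intros Hab H. split; apply (ex_RInt_continuous (V := R_CompleteNormedModule)); intros x Hx;
  rewrite Rmin_left, Rmax_right in Hx by lra; apply (H x Hx).
Qed.

Lemma CInt_ext (f g : R -> C) (a b : R) : a <= b -> (forall x, a <= x <= b -> f x = g x) ->
  CInt f a b = CInt g a b.
Proof.
  intros Hab H. unfold CInt. f_equal; apply RInt_ext; intros x Hx;
  rewrite Rmin_left, Rmax_right in Hx by lra; rewrite H by lra; reflexivity.
Qed.

Lemma CInt_plus (f g : R -> C) (a b : R) : a <= b -> rcont_on f a b -> rcont_on g a b ->
  CInt (fun t => f t + g t)%C a b = (CInt f a b + CInt g a b)%C.
Proof.
  intros Hab Hf Hg. destruct (ex_RInt_rcont_on _ _ _ Hab Hf), (ex_RInt_rcont_on _ _ _ Hab Hg).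
  unfold CInt. apply C_ext; cbn [Re Im fst snd Cplus].
  - apply (RInt_plus (fun t => Re (f t)) (fun t => Re (g t))); auto.
  - apply (RInt_plus (fun t => Im (f t)) (fun t => Im (g t))); auto.
Qed.

Lemma CInt_scal (c : C) (f : R -> C) (a b : R) : a <= b -> rcont_on f a b ->
  CInt (fun t => c * f t)%C a b = (c * CInt f a b)%C.
Proof.
  intros Hab Hf. destruct (ex_RInt_rcont_on _ _ _ Hab Hf) as [H1 H2].
  unfold CInt. apply C_ext; cbn [Re Im fst snd Cmult]; apply is_RInt_unique.
  - apply (is_RInt_minus (V := R_NormedModule) (fun t => Re c * Re (f t)) (fun t => Im c * Im (f t)));
    apply (is_RInt_scal (V := R_NormedModule)); apply (RInt_correct (V := R_CompleteNormedModule)); auto.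
  - apply (is_RInt_plus (V := R_NormedModule) (fun t => Re c * Im (f t)) (fun t => Im c * Re (f t)));
    apply (is_RInt_scal (V := R_NormedModule)); apply (RInt_correct (V := R_CompleteNormedModule)); auto.
Qed.

Lemma CInt_Chasles (f : R -> C) (a m b : R) : a <= m <= b -> rcont_on f a b ->
  CInt f a b = (CInt f a m + CInt f m b)%C.
Proof.
  intros Hm Hf.
  destruct (ex_RInt_rcont_on f a m ltac:(lra) ltac:(eapply rcont_on_sub; eauto; lra)) as [H1 H2].
  destruct (ex_RInt_rcont_on f m b ltac:(lra) ltac:(eapply rcont_on_sub; eauto; lra)) as [H3 H4].
  unfold CInt. apply C_ext; cbn [Re Im fst snd Cplus]; symmetry;
  apply (RInt_Chasles (V := R_CompleteNormedModule)); auto.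
Qed.

(* The factor 2 comes from bounding real and imaginary parts separately. *)
Lemma CInt_bound (f : R -> C) (a b M : R) : a <= b -> rcont_on f a b ->
  (forall x, a <= x <= b -> Cmod (f x) <= M) -> Cmod (CInt f a b) <= 2 * (M * (b - a)).
Proof.
  intros Hab Hf HM. destruct (ex_RInt_rcont_on _ _ _ Hab Hf) as [H1 H2].
  eapply Rle_trans; [apply Cmod_le_abs|]. unfold CInt; cbn [Re Im fst snd].
  assert (A1 : Rabs (RInt (fun t => Re (f t)) a b) <= (b - a) * M).
  { apply abs_RInt_le_const; auto. intros t Ht. eapply Rle_trans; [apply re_le_Cmod|]; auto. }
  assert (A2 : Rabs (RInt (fun t => Im (f t)) a b) <= (b - a) * M).
  { apply abs_RInt_le_const; auto. intros t Ht. eapply Rle_trans; [apply im_le_Cmod|]; auto. }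
  lra.
Qed.

Lemma CInt_derive (f df : R -> C) (a b : R) : a <= b ->
  (forall x, a <= x <= b -> rderiv f x (df x)) -> rcont_on df a b ->
  CInt df a b = (f b - f a)%C.
Proof.
  intros Hab Hd Hc. unfold CInt. apply C_ext; cbn [Re Im fst snd];
  apply is_RInt_unique; unfold Cminus.
  - rewrite re_plus, re_opp.
    apply (is_RInt_derive (V := R_CompleteNormedModule) (fun t => Re (f t)) (fun t => Re (df t)));
    intros x Hx; rewrite Rmin_left, Rmax_right in Hx by lra; [apply Hd|apply Hc]; auto.
  - rewrite im_plus, im_opp.
    apply (is_RInt_derive (V := R_CompleteNormedModule) (fun t => Im (f t)) (fun t => Im (df t)));
    intros x Hx; rewrite Rmin_left, Rmax_right in Hx by lra; [apply Hd|apply Hc]; auto.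
Qed.

(** Replaces the mean value theorem, which fails for complex values, by the integral of the
    derivative. *)
Lemma rderiv_lip (f df : R -> C) (a b M : R) : a <= b ->
  (forall x, a <= x <= b -> rderiv f x (df x)) -> rcont_on df a b ->
  (forall x, a <= x <= b -> Cmod (df x) <= M) ->
  Cmod (f b - f a) <= 2 * (M * (b - a)).
Proof.
  intros Hab Hd Hc HM. rewrite <- (CInt_derive f df) by auto. apply CInt_bound; auto.
Qed.

(** * Goursat's theorem *)

(* [sg] parametrizes a region of the plane by a rectangle; [su], [sv] are its partial derivatives.
   Allowing curvilinear coordinates lets Goursat's theorem yield Cauchy's formula directly. *)
Record smooth_rect (sg su sv : R -> R -> C) (a0 b0 c0 d0 L : R) : Prop := {
  sr_u : forall u v, a0 <= u <= b0 -> c0 <= v <= d0 -> rderiv (fun t => sg t v) u (su u v);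
  sr_v : forall u v, a0 <= u <= b0 -> c0 <= v <= d0 -> rderiv (fun t => sg u t) v (sv u v);
  sr_cu : forall u v, a0 <= u <= b0 -> c0 <= v <= d0 -> rcont (fun t => su t v) u;
  sr_cv : forall u v, a0 <= u <= b0 -> c0 <= v <= d0 -> rcont (fun t => sv u t) v;
  sr_bu : forall u v, a0 <= u <= b0 -> c0 <= v <= d0 -> Cmod (su u v) <= L;
  sr_bv : forall u v, a0 <= u <= b0 -> c0 <= v <= d0 -> Cmod (sv u v) <= L
}.

(* The integral of [F z dz] along the image under [sg] of the boundary of a rectangle. *)
Definition period (F : C -> C) (sg su sv : R -> R -> C) (a b c d : R) : C :=
  (CInt (fun u => F (sg u c) * su u c) a b + CInt (fun v => F (sg b v) * sv b v) c d
   - CInt (fun u => F (sg u d) * su u d) a b - CInt (fun v => F (sg a v) * sv a v) c d)%C.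

Lemma smooth_rect_sub sg su sv a0 b0 c0 d0 L a b c d :
  smooth_rect sg su sv a0 b0 c0 d0 L -> a0 <= a -> b <= b0 -> c0 <= c -> d <= d0 ->
  smooth_rect sg su sv a b c d L.
Proof. intros [H1 H2 H3 H4 H5 H6] ? ? ? ?; split; intros u v ? ?; [apply H1|apply H2|apply H3|apply H4|apply H5|apply H6]; lra. Qed.

Lemma smooth_rect_lip sg su sv a0 b0 c0 d0 L : smooth_rect sg su sv a0 b0 c0 d0 L ->
  forall u v u' v', a0 <= u <= b0 -> c0 <= v <= d0 -> a0 <= u' <= b0 -> c0 <= v' <= d0 ->
  Cmod (sg u v - sg u' v') <= 2 * L * (Rabs (u - u') + Rabs (v - v')).
Proof.
  intros H.
  assert (Hu : forall u u' v, a0 <= u <= b0 -> c0 <= v <= d0 -> a0 <= u' <= b0 ->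
    Cmod (sg u v - sg u' v) <= 2 * L * Rabs (u - u')).
  { assert (W : forall u u' v, a0 <= u <= b0 -> c0 <= v <= d0 -> a0 <= u' <= b0 -> u' <= u ->
      Cmod (sg u v - sg u' v) <= 2 * L * Rabs (u - u')).
    { intros u u' v Hu Hv Hu' Hle. rewrite Rabs_right by lra. rewrite Rmult_assoc.
      apply (rderiv_lip (fun t => sg t v) (fun t => su t v)); auto; intros t Ht; apply H; lra. }
    intros u u' v A1 A2 A3. destruct (Rle_dec u' u); [apply W; auto|].
    rewrite Cmod_minus_sym, Rabs_minus_sym. apply W; auto; lra. }
  assert (Hv : forall u v v', a0 <= u <= b0 -> c0 <= v <= d0 -> c0 <= v' <= d0 ->
    Cmod (sg u v - sg u v') <= 2 * L * Rabs (v - v')).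
  { assert (W : forall u v v', a0 <= u <= b0 -> c0 <= v <= d0 -> c0 <= v' <= d0 -> v' <= v ->
      Cmod (sg u v - sg u v') <= 2 * L * Rabs (v - v')).
    { intros u v v' Hu' Hv Hv' Hle. rewrite Rabs_right by lra. rewrite Rmult_assoc.
      apply (rderiv_lip (fun t => sg u t) (fun t => sv u t)); auto; intros t Ht; apply H; lra. }
    intros u v v' A1 A2 A3. destruct (Rle_dec v' v); [apply W; auto|].
    rewrite Cmod_minus_sym, Rabs_minus_sym. apply W; auto; lra. }
  intros u v u' v' A1 A2 A3 A4.
  replace (sg u v - sg u' v')%C with ((sg u v - sg u' v) + (sg u' v - sg u' v'))%C by ring.
  eapply Rle_trans; [apply Cmod_triangle|].
  pose proof (Hu u u' v A1 A2 A3). pose proof (Hv u' v v' A3 A2 A4). lra.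
Qed.

Lemma rect_cont_u F sg su sv a b c d L v : smooth_rect sg su sv a b c d L ->
  (forall u v, a <= u <= b -> c <= v <= d -> ccont F (sg u v)) -> c <= v <= d ->
  rcont_on (fun u => F (sg u v) * su u v)%C a b.
Proof.
  intros H HF Hv u Hu. apply rcont_mult; [|eapply sr_cu; eauto].
  apply (rcont_comp F (fun u => sg u v)); auto. eapply rderiv_rcont, sr_u; eauto.
Qed.

Lemma rect_cont_v F sg su sv a b c d L u : smooth_rect sg su sv a b c d L ->
  (forall u v, a <= u <= b -> c <= v <= d -> ccont F (sg u v)) -> a <= u <= b ->
  rcont_on (fun v => F (sg u v) * sv u v)%C c d.
Proof.
  intros H HF Hu v Hv. apply rcont_mult; [|eapply sr_cv; eauto].
  apply (rcont_comp F (fun v => sg u v)); auto. eapply rderiv_rcont, sr_v; eauto.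
Qed.

Lemma period_split_u F sg su sv a m b c d L : smooth_rect sg su sv a b c d L ->
  (forall u v, a <= u <= b -> c <= v <= d -> ccont F (sg u v)) -> a <= m <= b -> c <= d ->
  period F sg su sv a b c d = (period F sg su sv a m c d + period F sg su sv m b c d)%C.
Proof.
  intros H HF Hm Hcd. unfold period.
  rewrite (CInt_Chasles (fun u => F (sg u c) * su u c)%C a m b) by
    (auto; eapply rect_cont_u; eauto; lra).
  rewrite (CInt_Chasles (fun u => F (sg u d) * su u d)%C a m b) by
    (auto; eapply rect_cont_u; eauto; lra).
  ring.
Qed.

Lemma period_split_v F sg su sv a b c m d L : smooth_rect sg su sv a b c d L ->
  (forall u v, a <= u <= b -> c <= v <= d -> ccont F (sg u v)) -> a <= b -> c <= m <= d ->
  period F sg su sv a b c d = (period F sg su sv a b c m + period F sg su sv a b m d)%C.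
Proof.
  intros H HF Hab Hm. unfold period.
  rewrite (CInt_Chasles (fun v => F (sg a v) * sv a v)%C c m d) by
    (auto; eapply rect_cont_v; eauto; lra).
  rewrite (CInt_Chasles (fun v => F (sg b v) * sv b v)%C c m d) by
    (auto; eapply rect_cont_v; eauto; lra).
  ring.
Qed.

(** An affine integrand has the primitive A z + B z^2 / 2, so each edge contributes a difference of
    corner values and the four differences cancel. *)
Lemma period_affine A B sg su sv a b c d L : smooth_rect sg su sv a b c d L -> a <= b -> c <= d ->
  period (fun z => A + B * z)%C sg su sv a b c d = 0%C.
Proof.
  intros H Hab Hcd. unfold period.
  assert (HF : forall u v, a <= u <= b -> c <= v <= d -> ccont (fun z => A + B * z)%C (sg u v)).
  { intros. apply cdiff_ccont, cdiff_plus; [apply cdiff_const|].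
    apply cdiff_mult; auto using cdiff_const, cdiff_id. }
  set (G := fun z => (A * z + B / 2 * (z * z))%C).
  assert (HG : forall (g : R -> C) x l, rderiv g x l -> rderiv (fun t => G (g t)) x ((A + B * g x) * l)%C).
  { intros g x l Hg.
    apply rderiv_eq with (A * l + B / 2 * (l * g x + g x * l))%C; [field|].
    unfold G. apply rderiv_plus; [apply rderiv_scal; auto|].
    apply rderiv_scal, rderiv_mult; auto. }
  assert (Tu : forall v, c <= v <= d ->
    CInt (fun u => (A + B * sg u v) * su u v)%C a b = (G (sg b v) - G (sg a v))%C).
  { intros v Hv. apply (CInt_derive (fun u => G (sg u v))); auto.
    - intros u Hu. apply (HG (fun u => sg u v)), (sr_u _ _ _ _ _ _ _ _ H); auto.
    - apply (rect_cont_u _ _ _ _ _ _ _ _ _ _ H HF Hv). }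
  assert (Tv : forall u, a <= u <= b ->
    CInt (fun v => (A + B * sg u v) * sv u v)%C c d = (G (sg u d) - G (sg u c))%C).
  { intros u Hu. apply (CInt_derive (fun v => G (sg u v))); auto.
    - intros v Hv. apply (HG (fun v => sg u v)), (sr_v _ _ _ _ _ _ _ _ H); auto.
    - apply (rect_cont_v _ _ _ _ _ _ _ _ _ _ H HF Hu). }
  rewrite !Tu, !Tv by lra. ring.
Qed.

Lemma period_minus F G sg su sv a b c d L : smooth_rect sg su sv a b c d L -> a <= b -> c <= d ->
  (forall u v, a <= u <= b -> c <= v <= d -> ccont F (sg u v)) ->
  (forall u v, a <= u <= b -> c <= v <= d -> ccont G (sg u v)) ->
  period (fun z => F z + - (1) * G z)%C sg su sv a b c d
  = (period F sg su sv a b c d - period G sg su sv a b c d)%C.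
Proof.
  intros H Hab Hcd HF HG. unfold period.
  assert (Tu : forall v, c <= v <= d -> CInt (fun u => (F (sg u v) + - (1) * G (sg u v)) * su u v)%C a b =
    (CInt (fun u => F (sg u v) * su u v)%C a b + - (1) * CInt (fun u => G (sg u v) * su u v)%C a b)%C).
  { intros v Hv.
    rewrite <- CInt_scal, <- CInt_plus; auto.
    - apply CInt_ext; auto. intros; ring.
    - eapply rect_cont_u; eauto.
    - intros u Hu. apply rcont_mult; [apply rcont_const|]. eapply rect_cont_u; eauto.
    - eapply rect_cont_u; eauto. }
  assert (Tv : forall u, a <= u <= b -> CInt (fun v => (F (sg u v) + - (1) * G (sg u v)) * sv u v)%C c d =
    (CInt (fun v => F (sg u v) * sv u v)%C c d + - (1) * CInt (fun v => G (sg u v) * sv u v)%C c d)%C).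
  { intros u Hu.
    rewrite <- CInt_scal, <- CInt_plus; auto.
    - apply CInt_ext; auto. intros; ring.
    - eapply rect_cont_v; eauto.
    - intros v Hv. apply rcont_mult; [apply rcont_const|]. eapply rect_cont_v; eauto.
    - eapply rect_cont_v; eauto. }
  rewrite !Tu, !Tv by lra. ring.
Qed.

Lemma Cmod_triangle_4 (z1 z2 z3 z4 : C) :
  Cmod (z1 + z2 - z3 - z4) <= Cmod z1 + Cmod z2 + Cmod z3 + Cmod z4.
Proof.
  pose proof (Cmod_triangle_minus (z1 + z2 - z3) z4).
  pose proof (Cmod_triangle_minus (z1 + z2) z3). pose proof (Cmod_triangle z1 z2). lra.
Qed.

(** The factor 4 is 2 for the two parallel edges times the 2 of [CInt_bound]. *)
Lemma period_bound F sg su sv a b c d L eta : smooth_rect sg su sv a b c d L -> a <= b -> c <= d ->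
  (forall u v, a <= u <= b -> c <= v <= d -> ccont F (sg u v)) ->
  (forall u v, a <= u <= b -> c <= v <= d -> Cmod (F (sg u v)) <= eta) ->
  Cmod (period F sg su sv a b c d) <= 4 * eta * L * ((b - a) + (d - c)).
Proof.
  intros H Hab Hcd HF Hb. unfold period.
  assert (Tu : forall v, c <= v <= d -> Cmod (CInt (fun u => F (sg u v) * su u v)%C a b) <= 2 * (eta * L * (b - a))).
  { intros v Hv. apply CInt_bound; auto; [eapply rect_cont_u; eauto|].
    intros u Hu. rewrite Cmod_mult. apply Rmult_le_compat; auto using Cmod_ge_0. eapply sr_bu; eauto. }
  assert (Tv : forall u, a <= u <= b -> Cmod (CInt (fun v => F (sg u v) * sv u v)%C c d) <= 2 * (eta * L * (d - c))).
  { intros u Hu. apply CInt_bound; auto; [eapply rect_cont_v; eauto|].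
    intros v Hv. rewrite Cmod_mult. apply Rmult_le_compat; auto using Cmod_ge_0. eapply sr_bv; eauto. }
  pose proof (Tu c ltac:(lra)). pose proof (Tu d ltac:(lra)).
  pose proof (Tv a ltac:(lra)). pose proof (Tv b ltac:(lra)).
  eapply Rle_trans; [apply Cmod_triangle_4|]. lra.
Qed.

Lemma period_quarter F sg su sv a w c h L K :
  smooth_rect sg su sv a (a + 2 * w) c (c + 2 * h) L ->
  (forall u v, a <= u <= a + 2 * w -> c <= v <= c + 2 * h -> ccont F (sg u v)) ->
  0 <= w -> 0 <= h ->
  4 * K < Cmod (period F sg su sv a (a + 2 * w) c (c + 2 * h)) ->
  exists a' c', (a' = a \/ a' = a + w) /\ (c' = c \/ c' = c + h) /\
    K < Cmod (period F sg su sv a' (a' + w) c' (c' + h)).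
Proof.
  intros H HF Hw Hh HK. apply NNPP. intros N.
  assert (Q : forall a' c', (a' = a \/ a' = a + w) -> (c' = c \/ c' = c + h) ->
    Cmod (period F sg su sv a' (a' + w) c' (c' + h)) <= K).
  { intros a' c' Ha Hc. apply Rnot_lt_le. intros Hlt. apply N. exists a', c'; auto. }
  rewrite (period_split_u F sg su sv a (a + w) (a + 2 * w) c (c + 2 * h) L) in HK by (auto; lra).
  rewrite (period_split_v F sg su sv a (a + w) c (c + h) (c + 2 * h) L) in HK;
    [|eapply smooth_rect_sub; eauto; lra|intros; apply HF; lra|lra..].
  rewrite (period_split_v F sg su sv (a + w) (a + 2 * w) c (c + h) (c + 2 * h) L) in HK;
    [|eapply smooth_rect_sub; eauto; lra|intros; apply HF; lra|lra..].
  pose proof (Q a c ltac:(auto) ltac:(auto)) as Q1.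
  pose proof (Q (a + w) c ltac:(auto) ltac:(auto)) as Q2.
  pose proof (Q a (c + h) ltac:(auto) ltac:(auto)) as Q3.
  pose proof (Q (a + w) (c + h) ltac:(auto) ltac:(auto)) as Q4.
  replace (a + w + w) with (a + 2 * w) in * by ring.
  replace (c + h + h) with (c + 2 * h) in * by ring.
  match type of HK with _ < Cmod (?x1 + ?x2 + (?x3 + ?x4)) =>
    pose proof (Cmod_triangle (x1 + x2) (x3 + x4));
    pose proof (Cmod_triangle x1 x2); pose proof (Cmod_triangle x3 x4) end.
  lra.
Qed.

Lemma pow_half_small (K eps : R) : 0 < eps -> exists k, K * (/ 2) ^ k < eps.
Proof.
  intros Heps. pose proof (Rabs_pos K).
  destruct (pow_lt_1_zero (/ 2) ltac:(rewrite Rabs_right; lra) (eps / (Rabs K + 1)))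
    as [k Hk]; [apply Rdiv_lt_0_compat; lra|].
  exists k. specialize (Hk k (le_n k)).
  assert (Hp : 0 < (/ 2) ^ k) by (apply pow_lt; lra).
  rewrite Rabs_right in Hk by lra.
  apply Rle_lt_trans with ((Rabs K + 1) * (/ 2) ^ k).
  - apply Rmult_le_compat_r; [lra|]. pose proof (Rle_abs K). lra.
  - apply (Rmult_lt_compat_l (Rabs K + 1)) in Hk; [|lra].
    replace ((Rabs K + 1) * (eps / (Rabs K + 1))) with eps in Hk by (field; lra). exact Hk.
Qed.

Lemma nested_intervals (x : nat -> R) (W : R) :
  (forall k, x k <= x (S k)) ->
  (forall k, x (S k) + W * (/ 2) ^ (S k) <= x k + W * (/ 2) ^ k) -> 0 <= W ->
  exists l, forall k, x k <= l <= x k + W * (/ 2) ^ k.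
Proof.
  intros H1 H2 HW.
  assert (Hp : forall k, 0 <= W * (/ 2) ^ k).
  { intros k. apply Rmult_le_pos; auto. apply pow_le; lra. }
  assert (M1 : forall k j, x k <= x (k + j)%nat).
  { intros k j; induction j; [rewrite Nat.add_0_r; lra|].
    rewrite Nat.add_succ_r. specialize (H1 (k + j)%nat). lra. }
  assert (M2 : forall k j, x (k + j)%nat + W * (/ 2) ^ (k + j) <= x k + W * (/ 2) ^ k).
  { intros k j; induction j; [rewrite Nat.add_0_r; lra|].
    rewrite Nat.add_succ_r. specialize (H2 (k + j)%nat). lra. }
  assert (M3 : forall j k, x j <= x k + W * (/ 2) ^ k).
  { intros j k. pose proof (M1 j k). pose proof (M2 k j).
    rewrite (Nat.add_comm k j) in H0. specialize (Hp (j + k)%nat). lra. }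
  destruct (completeness (fun r => exists k, r = x k)) as [l [Hl1 Hl2]].
  - exists (x 0%nat + W * (/ 2) ^ 0). intros r [k ->]. apply M3.
  - exists (x 0%nat), 0%nat; reflexivity.
  - exists l. intros k. split.
    + apply Hl1. exists k; reflexivity.
    + apply Hl2. intros r [j ->]. apply M3.
Qed.

(** Subtracting the affine tangent of F at the image of (u0, v0) does not change the period. What is
    left is small relative to the size of the rectangle, and the length of the contour is
    proportional to that size too, so the period is small relative to its square. *)
Lemma period_small F sg su sv a b c d L u0 v0 ep :
  smooth_rect sg su sv a b c d L -> a <= b -> c <= d ->
  (forall u v, a <= u <= b -> c <= v <= d -> cdiff F (sg u v)) ->
  a <= u0 <= b -> c <= v0 <= d -> 0 < ep ->
  exists del, 0 < del /\ forall x w y h, a <= x -> x + w <= b -> c <= y -> y + h <= d ->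
    0 <= w -> 0 <= h -> x <= u0 <= x + w -> y <= v0 <= y + h -> w + h < del ->
    Cmod (period F sg su sv x (x + w) y (y + h)) <= ep * ((w + h) * (w + h)).
Proof.
  intros H Hab Hcd HF Hu0 Hv0 Hep.
  assert (HL : 0 <= L).
  { eapply Rle_trans; [apply Cmod_ge_0|]. apply (sr_bu _ _ _ _ _ _ _ _ H u0 v0); auto. }
  destruct (HF u0 v0 Hu0 Hv0) as [l Hl].
  (* The constant 8 L^2 is the 4 L of [period_bound] times the 2 L of [smooth_rect_lip]; the added 1
     covers L = 0. *)
  set (e := ep / (8 * (L * L) + 1)).
  assert (He : 0 < e) by (unfold e; apply Rdiv_lt_0_compat; nra).
  destruct (Hl e He) as [rho [Hrho Hnear]].
  (* A rectangle of this size is mapped into the disc of radius [rho] on which the derivative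
     estimate holds. *)
  exists (rho / (2 * L + 1)). split; [apply Rdiv_lt_0_compat; lra|].
  intros x w y h Hx Hxw Hy Hyh Hw Hh Hxu Hyv Hsmall.
  pose proof (smooth_rect_sub _ _ _ _ _ _ _ _ x (x + w) y (y + h) H Hx Hxw Hy Hyh) as H'.
  set (z0 := sg u0 v0) in *.
  set (Af := fun z => ((F z0 - l * z0) + l * z)%C).
  assert (CF : forall u v, x <= u <= x + w -> y <= v <= y + h -> ccont F (sg u v)).
  { intros. apply cdiff_ccont, HF; lra. }
  assert (CA : forall u v, x <= u <= x + w -> y <= v <= y + h -> ccont Af (sg u v)).
  { intros. apply cdiff_ccont, cdiff_plus; [apply cdiff_const|].
    apply cdiff_mult; auto using cdiff_const, cdiff_id. }
  assert (E : period F sg su sv x (x + w) y (y + h)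
    = period (fun z => F z + - (1) * Af z)%C sg su sv x (x + w) y (y + h)).
  { rewrite (period_minus F Af _ _ _ _ _ _ _ L) by (auto; lra).
    unfold Af. rewrite (period_affine _ _ _ _ _ _ _ _ _ L) by (auto; lra). ring. }
  rewrite E. clear E.
  apply Rle_trans with (4 * (e * (2 * L * (w + h))) * L * ((x + w - x) + (y + h - y))).
  - apply period_bound; auto; try lra.
    + intros u v Hu Hv.
      destruct (HF u v ltac:(lra) ltac:(lra)) as [m Hm].
      apply cdiff_ccont, cdiff_plus; [exists m; exact Hm|].
      apply cdiff_mult; [apply cdiff_const|]. apply cdiff_plus; [apply cdiff_const|].
      apply cdiff_mult; auto using cdiff_const, cdiff_id.
    + intros u v Hu Hv.
      assert (Hd : Cmod (sg u v - z0) <= 2 * L * (w + h)).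
      { eapply Rle_trans; [apply (smooth_rect_lip _ _ _ _ _ _ _ _ H); auto; lra|].
        apply Rmult_le_compat_l; [lra|].
        apply Rplus_le_compat; apply Rabs_le_between; lra. }
      replace (F (sg u v) + - (1) * Af (sg u v))%C with (F (sg u v) - F z0 - l * (sg u v - z0))%C
        by (unfold Af; ring).
      eapply Rle_trans; [apply Hnear|].
      * eapply Rle_lt_trans; [exact Hd|].
        apply Rle_lt_trans with ((2 * L + 1) * (w + h)); [nra|].
        apply (Rmult_lt_compat_l (2 * L + 1)) in Hsmall; [|lra].
        replace ((2 * L + 1) * (rho / (2 * L + 1))) with rho in Hsmall by (field; lra). exact Hsmall.
      * apply Rmult_le_compat_l; lra.
  - replace (4 * (e * (2 * L * (w + h))) * L * (x + w - x + (y + h - y)))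
      with (e * (8 * (L * L)) * ((w + h) * (w + h))) by ring.
    apply Rmult_le_compat_r; [nra|].
    replace ep with (e * (8 * (L * L) + 1)) at 1 by (unfold e; field; nra).
    apply Rmult_le_compat_l; lra.
Qed.

Theorem goursat F sg su sv a b c d L :
  smooth_rect sg su sv a b c d L -> a <= b -> c <= d ->
  (forall u v, a <= u <= b -> c <= v <= d -> cdiff F (sg u v)) ->
  period F sg su sv a b c d = 0%C.
Proof.
  intros H Hab Hcd HF. apply Cmod_eq_0.
  destruct (Rle_lt_or_eq_dec 0 _ (Cmod_ge_0 (period F sg su sv a b c d))) as [Hpos|He]; [exfalso|auto].
  set (D := Cmod (period F sg su sv a b c d)) in *.
  set (W := b - a). set (Ht := d - c).
  assert (HW : 0 <= W) by (unfold W; lra). assert (HH : 0 <= Ht) by (unfold Ht; lra).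
  (* Bisection invariant: the k-th rectangle, with lower left corner [s], keeps more than a fixed
     multiple of 4^(-k) of the period. Taking [D / 2] instead of [D] makes the strict inequality
     true at stage 0. *)
  set (Good := fun k (s : R * R) =>
    a <= fst s /\ fst s + W * (/ 2) ^ k <= b /\ c <= snd s /\ snd s + Ht * (/ 2) ^ k <= d /\ D / 2 * ((/ 2) ^ k * (/ 2) ^ k) <
    Cmod (period F sg su sv (fst s) (fst s + W * (/ 2) ^ k) (snd s) (snd s + Ht * (/ 2) ^ k))).
  set (Sub := fun k (s s' : R * R) =>
    fst s <= fst s' /\ fst s' + W * (/ 2) ^ (S k) <= fst s + W * (/ 2) ^ k /\ snd s <= snd s' /\ snd s' + Ht * (/ 2) ^ (S k) <= snd s + Ht * (/ 2) ^ k).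
  assert (step : forall k (s : {s | Good k s}), {s' : {s | Good (S k) s} | Sub k (proj1_sig s) (proj1_sig s')}).
  { intros k [s Hs]. apply constructive_indefinite_description. cbn.
    destruct Hs as (G1 & G2 & G3 & G4 & G5).
    set (w := W * (/ 2) ^ (S k)). set (h := Ht * (/ 2) ^ (S k)).
    assert (Ew : W * (/ 2) ^ k = 2 * w) by (unfold w; cbn; field).
    assert (Eh : Ht * (/ 2) ^ k = 2 * h) by (unfold h; cbn; field).
    assert (Hp : 0 <= (/ 2) ^ (S k)) by (apply pow_le; lra).
    assert (Hw0 : 0 <= w) by (unfold w; apply Rmult_le_pos; auto).
    assert (Hh0 : 0 <= h) by (unfold h; apply Rmult_le_pos; auto).
    rewrite Ew, Eh in *.
    destruct (period_quarter F sg su sv (fst s) w (snd s) h L (D / 2 * ((/ 2) ^ (S k) * (/ 2) ^ (S k))))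
      as (a' & c' & Ha' & Hc' & HK).
    - eapply smooth_rect_sub; [exact H|lra..].
    - intros u v Hu Hv. apply cdiff_ccont, HF; lra.
    - auto.
    - auto.
    - eapply Rle_lt_trans; [|exact G5]. right. cbn. field.
    - unshelve eexists.
      + exists (a', c'). repeat split; cbn [fst snd]; fold w h; try lra; try (destruct Ha', Hc'; lra).
      + unfold Sub; cbn [proj1_sig fst snd]; fold w h. rewrite Ew, Eh.
        repeat split; destruct Ha', Hc'; lra. }
  assert (G0 : Good 0%nat (a, c)).
  { unfold Good, W, Ht; cbn [fst snd pow].
    replace (a + (b - a) * 1) with b by ring. replace (c + (d - c) * 1) with d by ring.
    fold D. repeat split; lra. }
  (* Dependent choice: each rectangle is carried together with the proof of its invariant. *)
  set (sq := nat_rect (fun k => {s | Good k s}) (exist _ (a, c) G0) (fun k s => proj1_sig (step k s))).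
  assert (Hsub : forall k, Sub k (proj1_sig (sq k)) (proj1_sig (sq (S k)))).
  { intros k. exact (proj2_sig (step k (sq k))). }
  assert (HG : forall k, Good k (proj1_sig (sq k))) by (intros k; exact (proj2_sig (sq k))).
  destruct (nested_intervals (fun k => fst (proj1_sig (sq k))) W) as [u0 Hu0]; [intros k; apply Hsub..|auto|].
  destruct (nested_intervals (fun k => snd (proj1_sig (sq k))) Ht) as [v0 Hv0]; [intros k; apply Hsub..|auto|].
  assert (Iu : a <= u0 <= b).
  { specialize (Hu0 0%nat). specialize (HG 0%nat). destruct HG as (G1 & G2 & _). lra. }
  assert (Iv : c <= v0 <= d).
  { specialize (Hv0 0%nat). specialize (HG 0%nat). destruct HG as (_ & _ & G1 & G2 & _). lra. }
  (* Chosen so that [ep] times (W + Ht)^2 stays below D / 2, also for a degenerate rectangle; this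
     contradicts the invariant once the rectangle is small. *)
  set (ep := D / (2 * ((W + Ht) * (W + Ht) + 1))).
  assert (Hep : 0 < ep) by (unfold ep; apply Rdiv_lt_0_compat; nra).
  destruct (period_small F sg su sv a b c d L u0 v0 ep H Hab Hcd HF Iu Iv Hep) as [del [Hdel Hs]].
  destruct (pow_half_small (W + Ht) del Hdel) as [k Hk].
  assert (Hp : 0 < (/ 2) ^ k) by (apply pow_lt; lra).
  destruct (HG k) as (G1 & G2 & G3 & G4 & G5).
  assert (P1 : 0 <= W * (/ 2) ^ k) by (apply Rmult_le_pos; lra).
  assert (P2 : 0 <= Ht * (/ 2) ^ k) by (apply Rmult_le_pos; lra).
  specialize (Hs _ _ _ _ G1 G2 G3 G4 P1 P2 (Hu0 k) (Hv0 k) ltac:(lra)).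
  assert (ep * ((W * (/ 2) ^ k + Ht * (/ 2) ^ k) * (W * (/ 2) ^ k + Ht * (/ 2) ^ k))
     <= D / 2 * ((/ 2) ^ k * (/ 2) ^ k)).
  { replace (ep * ((W * (/ 2) ^ k + Ht * (/ 2) ^ k) * (W * (/ 2) ^ k + Ht * (/ 2) ^ k)))
      with (ep * ((W + Ht) * (W + Ht)) * ((/ 2) ^ k * (/ 2) ^ k)) by ring.
    apply Rmult_le_compat_r; [nra|].
    replace (D / 2) with (ep * ((W + Ht) * (W + Ht) + 1)) by (unfold ep; field; nra).
    apply Rmult_le_compat_l; lra. }
  lra.
Qed.

(** * Cauchy's formula and isolated zeros *)

(** The sum runs over indices below [n], whereas [sum_n] includes the index [n]; this shift by one
    appears in every conversion between the two. *)
Fixpoint psum (a : nat -> C) (n : nat) : C :=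
  match n with O => RtoC 0 | S m => (psum a m + a m)%C end.

Definition circ (r v : R) : C := (RtoC r * (cos v, sin v))%C.
(** The reciprocal of [circ r v]. With it the Cauchy kernel z / (z - w) on the circle reads 1 / (1 -
    w [icirc]), ready for a geometric expansion. *)
Definition icirc (r v : R) : C := (RtoC (/ r) * (cos v, (- sin v)%R))%C.

Lemma Cmod_cos_sin (v : R) : Cmod (cos v, sin v) = 1.
Proof.
  unfold Cmod; cbn [fst snd]. rewrite <- sqrt_1. f_equal.
  pose proof (sin2_cos2 v). unfold Rsqr in H. lra.
Qed.

Lemma Cmod_circ (r v : R) : 0 < r -> Cmod (circ r v) = r.
Proof.
  intros H. unfold circ. rewrite Cmod_mult, Cmod_cos_sin, Cmod_R, Rabs_right by lra. ring.
Qed.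

Lemma circ_icirc (r v : R) : 0 < r -> (circ r v * icirc r v)%C = 1%C.
Proof.
  intros H. unfold circ, icirc.
  replace (RtoC r * (cos v, sin v) * (RtoC (/ r) * (cos v, (- sin v)%R)))%C
    with (RtoC r * RtoC (/ r) * ((cos v, sin v) * (cos v, (- sin v)%R)))%C by ring.
  rewrite <- RtoC_mult, Rinv_r, Cmult_1_l by lra.
  pose proof (sin2_cos2 v) as S2. unfold Rsqr in S2.
  apply C_ext; [rewrite re_mult|rewrite im_mult]; cbn; lra.
Qed.

Lemma Cmod_icirc (r v : R) : 0 < r -> Cmod (icirc r v) = / r.
Proof.
  intros H. assert (E : Cmod (circ r v * icirc r v) = 1) by (rewrite circ_icirc, Cmod_1; auto).
  rewrite Cmod_mult, Cmod_circ in E by auto.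
  apply Rmult_eq_reg_l with r; [|lra]. rewrite E. field. lra.
Qed.

Lemma icirc_inv (r v : R) : 0 < r -> circ r v = (/ icirc r v)%C.
Proof.
  intros H. assert (Hz : icirc r v <> 0%C).
  { apply Cmod_gt_0. rewrite Cmod_icirc by auto. apply Rinv_0_lt_compat, H. }
  replace (circ r v) with (circ r v * icirc r v * / icirc r v)%C by (field; auto).
  rewrite circ_icirc by auto. field. auto.
Qed.

Lemma rderiv_cos_sin (v : R) : rderiv (fun t => (cos t, sin t)) v (Ci * (cos v, sin v))%C.
Proof.
  split; cbn; auto_derive; auto; ring.
Qed.

Lemma rderiv_circ (r v : R) : rderiv (circ r) v (Ci * circ r v)%C.
Proof.
  unfold circ. eapply rderiv_eq; [|apply rderiv_scal, rderiv_cos_sin]. ring.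
Qed.

Lemma rderiv_icirc (r v : R) : rderiv (icirc r) v (- Ci * icirc r v)%C.
Proof.
  unfold icirc. eapply rderiv_eq; [|apply (rderiv_scal _ (fun t => (cos t, (- sin t)%R)))].
  2: { instantiate (1 := (- Ci * (cos v, (- sin v)%R))%C). split; cbn; auto_derive; auto; ring. }
  ring.
Qed.

Lemma rderiv_icirc_pow (r : R) (n : nat) (v : R) :
  rderiv (fun t => (icirc r t ^ n)%C) v (- Ci * RtoC (INR n) * icirc r v ^ n)%C.
Proof.
  induction n.
  - cbn. eapply rderiv_eq; [|apply rderiv_const]. ring.
  - eapply rderiv_eq; [|apply (rderiv_mult (icirc r) (fun t => icirc r t ^ n)%C v); [apply rderiv_icirc|exact IHn]].
    rewrite S_INR, RtoC_plus, Cpow_S. ring.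
Qed.

Lemma rcont_icirc_pow (r : R) (n : nat) (v : R) : rcont (fun t => (icirc r t ^ n)%C) v.
Proof. eapply rderiv_rcont, rderiv_icirc_pow. Qed.

Lemma two_PI_pos : 0 < 2 * PI.
Proof. pose proof PI_RGT_0. lra. Qed.

(** The derivative of the power is a nonzero multiple of the power itself, and the power is 2
    PI-periodic. *)
Lemma CInt_icirc_pow (r : R) (n : nat) : (1 <= n)%nat ->
  CInt (fun t => (icirc r t ^ n)%C) 0 (2 * PI) = 0%C.
Proof.
  intros Hn. pose proof two_PI_pos.
  set (c := (- Ci * RtoC (INR n))%C).
  assert (Hc : c <> 0%C).
  { unfold c. apply Cmult_neq_0.
    - intros E. apply Ci_nz. replace Ci with (- - Ci)%C by ring. rewrite E. ring.
    - apply RtoC_neq, not_0_INR. lia. }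
  assert (E : (c * CInt (fun t => (icirc r t ^ n)%C) 0 (2 * PI))%C = 0%C).
  { rewrite <- CInt_scal; [|lra|intros x _; apply rcont_icirc_pow].
    rewrite (CInt_derive (fun t => (icirc r t ^ n)%C)).
    - unfold icirc. rewrite cos_2PI, sin_2PI, cos_0, sin_0. ring.
    - lra.
    - intros x _. apply rderiv_icirc_pow.
    - intros x _. apply rcont_mult; [apply rcont_const|apply rcont_icirc_pow]. }
  replace (CInt (fun t => (icirc r t ^ n)%C) 0 (2 * PI))
    with (/ c * (c * CInt (fun t => (icirc r t ^ n)%C) 0 (2 * PI)))%C by (field; auto).
  rewrite E. ring.
Qed.

Lemma kernel_neq (r : R) (w : C) (v : R) : 0 < r -> Cmod w < r ->
  (r - Cmod w) / r <= Cmod (1 - w * icirc r v).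
Proof.
  intros Hr Hw. pose proof (Cmod_triangle_inv 1 (w * icirc r v)) as T.
  rewrite Cmod_1, Cmod_mult, Cmod_icirc in T by auto.
  replace ((r - Cmod w) / r) with (1 - Cmod w * / r) by (field; lra). exact T.
Qed.

Lemma kernel_neq0 (r : R) (w : C) (v : R) : 0 < r -> Cmod w < r -> (1 - w * icirc r v)%C <> 0%C.
Proof.
  intros Hr Hw. apply Cmod_gt_0. eapply Rlt_le_trans; [|apply kernel_neq; eauto].
  apply Rdiv_lt_0_compat; lra.
Qed.

Lemma kernel_bound (r : R) (w : C) (v : R) : 0 < r -> Cmod w < r ->
  Cmod (/ (1 - w * icirc r v)) <= r / (r - Cmod w).
Proof.
  intros Hr Hw. rewrite Cmod_inv by (apply kernel_neq0; auto).
  replace (r / (r - Cmod w)) with (/ ((r - Cmod w) / r)) by (field; lra).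
  apply Rinv_le_contravar; [apply Rdiv_lt_0_compat; lra|]. apply kernel_neq; auto.
Qed.

Lemma rcont_kernel (r : R) (w : C) (v : R) : 0 < r -> Cmod w < r ->
  rcont (fun t => / (1 - w * icirc r t))%C v.
Proof.
  intros Hr Hw. apply (rcont_comp (fun z => / z)%C (fun t => 1 - w * icirc r t)%C).
  - apply cdiff_ccont, (cdiff_inv (fun z => z)); [apply cdiff_id|apply kernel_neq0; auto].
  - apply rcont_ext with (fun t => 1 + - w * icirc r t)%C; [intros; ring|].
    apply rcont_plus; [apply rcont_const|]. apply rcont_mult; [apply rcont_const|].
    eapply rderiv_rcont, rderiv_icirc.
Qed.

(** A finite geometric sum with its exact remainder, so that no limit has to be exchanged with the
    integral. *)
Lemma kernel_expand (g : R -> C) (r : R) (w : C) (N : nat) : 0 < r -> Cmod w < r ->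
  rcont_on g 0 (2 * PI) ->
  CInt (fun t => g t * / (1 - w * icirc r t))%C 0 (2 * PI)
  = (psum (fun n => w ^ n * CInt (fun t => g t * icirc r t ^ n) 0 (2 * PI)) N
     + w ^ N * CInt (fun t => g t * icirc r t ^ N * / (1 - w * icirc r t)) 0 (2 * PI))%C.
Proof.
  intros Hr Hw Hg. pose proof two_PI_pos.
  assert (C1 : forall n, rcont_on (fun t => g t * icirc r t ^ n)%C 0 (2 * PI)).
  { intros n t Ht. apply rcont_mult; [auto|apply rcont_icirc_pow]. }
  assert (C2 : forall n, rcont_on (fun t => g t * icirc r t ^ n * / (1 - w * icirc r t))%C 0 (2 * PI)).
  { intros n t Ht. apply rcont_mult; [apply C1; auto|apply rcont_kernel; auto]. }
  induction N.
  - cbn [psum Cpow]. rewrite Cplus_0_l, Cmult_1_l. apply CInt_ext; [lra|].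
    intros; cbn. ring.
  - rewrite IHN. cbn [psum].
    assert (E : CInt (fun t => g t * icirc r t ^ N * / (1 - w * icirc r t))%C 0 (2 * PI)
      = (CInt (fun t => g t * icirc r t ^ N) 0 (2 * PI)
         + w * CInt (fun t => g t * icirc r t ^ S N * / (1 - w * icirc r t)) 0 (2 * PI))%C).
    { rewrite <- CInt_scal, <- CInt_plus; auto; try lra.
      - apply CInt_ext; [lra|]. intros t _. rewrite Cpow_S. field. apply kernel_neq0; auto.
      - intros t Ht. apply rcont_mult; [apply rcont_const|apply C2; auto]. }
    rewrite E, Cpow_S. ring.
Qed.

Lemma CInt_const (c : C) (a b : R) : a <= b -> CInt (fun _ => c) a b = (RtoC (b - a) * c)%C.
Proof.
  intros H. unfold CInt. rewrite !RInt_const. apply C_ext; rewrite ?re_scal_l, ?im_scal_l; reflexivity.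
Qed.

Lemma eq_of_Cmod_le (z w : C) : (forall eps, 0 < eps -> Cmod (z - w) <= eps) -> z = w.
Proof.
  intros H. replace z with ((z - w) + w)%C by ring.
  replace (z - w)%C with (RtoC 0); [ring|]. symmetry. apply Cmod_eq_0.
  apply Rle_antisym; [|apply Cmod_ge_0]. apply Rle_plus_epsilon. intros e He.
  specialize (H e He). lra.
Qed.

Lemma pow_ratio_small (q K eps : R) : 0 <= q < 1 -> 0 < eps ->
  exists N, forall n, (N <= n)%nat -> K * q ^ n <= eps.
Proof.
  intros Hq He. pose proof (Rabs_pos K).
  destruct (pow_lt_1_zero q ltac:(rewrite Rabs_right; lra) (eps / (Rabs K + 1))) as [N HN].
  { apply Rdiv_lt_0_compat; lra. }
  exists N. intros n Hn. specialize (HN n Hn).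
  assert (Hp : 0 <= q ^ n) by (apply pow_le; lra). rewrite Rabs_right in HN by lra.
  pose proof (Rle_abs K).
  apply (Rmult_lt_compat_l (Rabs K + 1)) in HN; [|lra].
  replace ((Rabs K + 1) * (eps / (Rabs K + 1))) with eps in HN by (field; lra). nra.
Qed.

(** In the expansion for the constant function 1 only the power 0 has a nonzero integral, and the
    remainder tends to 0 like (|w| / r)^N. *)
Lemma CInt_kernel (r : R) (w : C) : 0 < r -> Cmod w < r ->
  CInt (fun t => / (1 - w * icirc r t))%C 0 (2 * PI) = RtoC (2 * PI).
Proof.
  intros Hr Hw. pose proof two_PI_pos as HP.
  assert (E : forall N, CInt (fun t => / (1 - w * icirc r t))%C 0 (2 * PI)
    = (RtoC (2 * PI) + w ^ (S N) * CInt (fun t => 1 * icirc r t ^ (S N) * / (1 - w * icirc r t)) 0 (2 * PI))%C).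
  { intros N. rewrite (CInt_ext _ (fun t => 1 * / (1 - w * icirc r t))%C) by (lra || intros; ring).
    rewrite (kernel_expand (fun _ => 1%C) r w (S N)) by (auto; intros t _; apply rcont_const).
    f_equal. induction N.
    - cbn. rewrite (CInt_ext _ (fun _ => 1%C)) by (lra || intros; ring).
      rewrite CInt_const by lra. replace (2 * PI - 0) with (2 * PI) by ring. ring.
    - change (psum ?a (S (S N))) with (psum a (S N) + a (S N))%C. rewrite IHN.
      rewrite (CInt_ext _ (fun t => icirc r t ^ S N)%C) by (lra || intros; ring).
      rewrite CInt_icirc_pow by lia. ring. }
  apply eq_of_Cmod_le. intros eps Heps.
  set (q := Cmod w / r). pose proof (Cmod_ge_0 w).
  assert (Hq : 0 <= q < 1).
  { unfold q. split; [apply Rdiv_le_0_compat; lra|]. apply Rlt_div_l; lra. }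
  destruct (pow_ratio_small q (2 * (r / (r - Cmod w) * (2 * PI))) eps Hq Heps) as [N HN].
  rewrite (E N).
  replace (RtoC (2 * PI) + w ^ S N * CInt (fun t => 1 * icirc r t ^ S N * / (1 - w * icirc r t)) 0 (2 * PI) - RtoC (2 * PI))%C
    with (w ^ S N * CInt (fun t => 1 * icirc r t ^ S N * / (1 - w * icirc r t)) 0 (2 * PI))%C by ring.
  eapply Rle_trans; [|apply (HN (S N)); lia].
  rewrite Cmod_mult, Cmod_pow.
  assert (B : Cmod (CInt (fun t => 1 * icirc r t ^ S N * / (1 - w * icirc r t))%C 0 (2 * PI))
    <= 2 * ((/ r) ^ S N * (r / (r - Cmod w)) * (2 * PI - 0))).
  { apply CInt_bound; [lra| |].
    - intros t _. apply rcont_mult; [apply rcont_mult; [apply rcont_const|apply rcont_icirc_pow]|apply rcont_kernel; auto].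
    - intros t _. rewrite !Cmod_mult, Cmod_1, Rmult_1_l, Cmod_pow, Cmod_icirc by auto.
      apply Rmult_le_compat_l; [apply pow_le, Rlt_le, Rinv_0_lt_compat; auto|]. apply kernel_bound; auto. }
  eapply Rle_trans; [apply Rmult_le_compat_l; [apply pow_le; auto|exact B]|].
  right. unfold q, Rdiv. rewrite Rpow_mult_distr. ring.
Qed.

Definition cdiff_disc (f : C -> C) (p : C) (r : R) : Prop :=
  forall z, Cmod (z - p) <= r -> cdiff f z.

Lemma sector_smooth (p w : C) (r d : R) : 0 < r -> Cmod w < r -> 0 <= d <= 1 ->
  smooth_rect (fun u v => p + w + RtoC u * (circ r v - w))%C
    (fun u v => circ r v - w)%C (fun u v => RtoC u * (Ci * circ r v))%C d 1 0 (2 * PI) (2 * r).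
Proof.
  intros Hr Hw Hd. split; intros u v Hu Hv.
  - assert (Hid : rderiv (fun t => RtoC t) u 1%C).
    { split; cbn; auto_derive; auto. }
    eapply rderiv_eq; [|apply rderiv_plus; [apply rderiv_const|
      apply (rderiv_mult (fun t => RtoC t) (fun _ => circ r v - w)%C); [exact Hid|apply rderiv_const]]].
    ring.
  - eapply rderiv_eq; [|apply rderiv_plus; [apply rderiv_const|
      apply rderiv_scal, (rderiv_plus (circ r) (fun _ => - w)%C); [apply rderiv_circ|apply rderiv_const]]].
    ring.
  - apply rcont_const.
  - apply rcont_mult; [apply rcont_const|]. apply rcont_mult; [apply rcont_const|].
    eapply rderiv_rcont, rderiv_circ.
  - eapply Rle_trans; [apply Cmod_triangle_minus|]. rewrite Cmod_circ by auto. lra.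
  - rewrite !Cmod_mult, Cmod_Ci, Cmod_R, Cmod_circ, Rabs_right by (auto; lra). nra.
Qed.

Lemma sector_in_disc (w : C) (r u v : R) : 0 < r -> Cmod w <= r -> 0 <= u <= 1 ->
  Cmod (w + RtoC u * (circ r v - w)) <= r.
Proof.
  intros Hr Hw Hu.
  replace (w + RtoC u * (circ r v - w))%C with (RtoC (1 - u) * w + RtoC u * circ r v)%C
    by (rewrite RtoC_minus; ring).
  eapply Rle_trans; [apply Cmod_triangle|].
  rewrite !Cmod_mult, !Cmod_R, Cmod_circ, !Rabs_right by (auto; lra). nra.
Qed.

Lemma circ_2PI (r : R) : circ r (2 * PI) = circ r 0.
Proof. unfold circ. rewrite cos_2PI, sin_2PI, cos_0, sin_0. reflexivity. Qed.

Lemma circ_minus_neq (r : R) (w : C) (v : R) : 0 < r -> Cmod w < r -> (circ r v - w)%C <> 0%C.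
Proof.
  intros Hr Hw E. assert (H : circ r v = w) by (replace (circ r v) with (circ r v - w + w)%C by ring; rewrite E; ring).
  pose proof (Cmod_circ r v Hr). rewrite H in H0. lra.
Qed.

Lemma kernel_circ (r : R) (w : C) (v : R) : 0 < r -> Cmod w < r ->
  (/ (1 - w * icirc r v) = circ r v / (circ r v - w))%C.
Proof.
  intros Hr Hw. pose proof (kernel_neq0 r w v Hr Hw) as H1.
  pose proof (circ_minus_neq r w v Hr Hw) as H2.
  rewrite icirc_inv in * by auto.
  assert (Hz : icirc r v <> 0%C).
  { apply Cmod_gt_0. rewrite Cmod_icirc by auto. apply Rinv_0_lt_compat, Hr. }
  field. repeat split; auto.
Qed.

(* Goursat's theorem for f(z)/(z - p - w) dz in the coordinates z = p + w + u (circ r v - w):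
   the edges v = 0 and v = 2 PI cancel. *)
Lemma sector_period (f : C -> C) (p w : C) (r d : R) : 0 < r -> Cmod w < r -> 0 < d <= 1 ->
  cdiff_disc f p r ->
  CInt (fun v => f (p + w + RtoC 1 * (circ r v - w)) * / (1 - w * icirc r v))%C 0 (2 * PI)
  = CInt (fun v => f (p + w + RtoC d * (circ r v - w)) * / (1 - w * icirc r v))%C 0 (2 * PI).
Proof.
  intros Hr Hw Hd Hf. pose proof two_PI_pos as HP.
  set (F := fun z => (f z / (z - (p + w)))%C).
  pose proof (sector_smooth p w r d Hr Hw ltac:(lra)) as Hs.
  assert (HF : forall u v, d <= u <= 1 -> 0 <= v <= 2 * PI ->
     cdiff F (p + w + RtoC u * (circ r v - w))%C).
  { intros u v Hu Hv. unfold F. apply cdiff_div.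
    - apply Hf. replace (p + w + RtoC u * (circ r v - w) - p)%C with (w + RtoC u * (circ r v - w))%C by ring.
      apply sector_in_disc; auto; lra.
    - apply cdiff_minus; [apply cdiff_id|apply cdiff_const].
    - replace (p + w + RtoC u * (circ r v - w) - (p + w))%C with (RtoC u * (circ r v - w))%C by ring.
      apply Cmult_neq_0; [apply RtoC_neq; lra|]. apply circ_minus_neq; auto. }
  assert (HFc : forall u v, d <= u <= 1 -> 0 <= v <= 2 * PI ->
     ccont F (p + w + RtoC u * (circ r v - w))%C).
  { intros; apply cdiff_ccont, HF; auto. }
  pose proof (goursat F _ _ _ d 1 0 (2 * PI) (2 * r) Hs ltac:(lra) ltac:(lra) HF) as G.
  unfold period in G. rewrite circ_2PI in G.
  (* On an edge of constant u, dz is u i [circ] dv and z - p - w is u ([circ] - w), so u cancels and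
     i times the Cauchy integral remains. *)
  assert (K : forall u, d <= u <= 1 ->
    CInt (fun v => F (p + w + RtoC u * (circ r v - w)) * (RtoC u * (Ci * circ r v)))%C 0 (2 * PI)
    = (Ci * CInt (fun v => f (p + w + RtoC u * (circ r v - w)) * / (1 - w * icirc r v)) 0 (2 * PI))%C).
  { intros u Hu.
    assert (HE : forall v, (f (p + w + RtoC u * (circ r v - w)) * / (1 - w * icirc r v))%C
       = (- Ci * (F (p + w + RtoC u * (circ r v - w)) * (RtoC u * (Ci * circ r v))))%C).
    { intros v. rewrite kernel_circ by auto. unfold F.
      replace (p + w + RtoC u * (circ r v - w) - (p + w))%C with (RtoC u * (circ r v - w))%C by ring.
      assert (Hu0 : RtoC u <> 0%C) by (apply RtoC_neq; lra).
      pose proof (circ_minus_neq r w v Hr Hw) as Hn.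
      replace (circ r v / (circ r v - w))%C with (- Ci * Ci * circ r v / (circ r v - w))%C.
      - field; auto.
      - replace (- Ci * Ci)%C with (RtoC 1); [rewrite Cmult_1_l; reflexivity|].
        apply C_ext; cbn; ring. }
    rewrite (CInt_ext (fun v => f (p + w + RtoC u * (circ r v - w)) * / (1 - w * icirc r v))%C
      (fun v => - Ci * (F (p + w + RtoC u * (circ r v - w)) * (RtoC u * (Ci * circ r v))))%C) by (lra || auto).
    rewrite CInt_scal; [|lra|].
    - rewrite Cmult_assoc. replace (Ci * - Ci)%C with (RtoC 1) by (apply C_ext; cbn; ring). ring.
    - apply (rect_cont_v F _ _ _ _ _ _ _ _ u Hs HFc Hu). }
  rewrite !K in G by lra.
  set (A1 := CInt (fun v => f (p + w + RtoC 1 * (circ r v - w)) * / (1 - w * icirc r v))%C 0 (2 * PI)) in *.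
  set (A2 := CInt (fun v => f (p + w + RtoC d * (circ r v - w)) * / (1 - w * icirc r v))%C 0 (2 * PI)) in *.
  assert (E : (Ci * (A1 - A2))%C = 0%C) by (rewrite <- G; ring).
  replace A1 with (- Ci * (Ci * (A1 - A2)) + A2)%C.
  - rewrite E. ring.
  - rewrite Cmult_assoc. replace (- Ci * Ci)%C with (RtoC 1) by (apply C_ext; cbn; ring). ring.
Qed.

(** By [sector_period] the circle may be contracted by the factor d towards p + w without changing
    the integral; as d tends to 0, f on the contour tends to its value at p + w, and the kernel
    integrates to 2 PI. *)
Lemma cauchy_formula (f : C -> C) (p w : C) (r : R) : 0 < r -> Cmod w < r -> cdiff_disc f p r ->
  CInt (fun v => f (p + circ r v) * / (1 - w * icirc r v))%C 0 (2 * PI) = (RtoC (2 * PI) * f (p + w))%C.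
Proof.
  intros Hr Hw Hf. pose proof two_PI_pos as HP.
  rewrite (CInt_ext _ (fun v => f (p + w + RtoC 1 * (circ r v - w)) * / (1 - w * icirc r v))%C).
  2: lra. 2: { intros v _. do 2 f_equal. ring. }
  assert (Kc : rcont_on (fun v => / (1 - w * icirc r v))%C 0 (2 * PI)).
  { intros v _. apply rcont_kernel; auto. }
  assert (E2 : (RtoC (2 * PI) * f (p + w))%C
    = CInt (fun v => f (p + w) * / (1 - w * icirc r v))%C 0 (2 * PI)).
  { rewrite CInt_scal by (auto; lra). rewrite CInt_kernel by auto. ring. }
  rewrite E2. apply eq_of_Cmod_le. intros eps Heps.
  (* The bound of the kernel times the length 2 PI times the 2 of [CInt_bound]. *)
  set (B := 4 * PI * (r / (r - Cmod w))).
  assert (HB : 0 < B).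
  { unfold B. apply Rmult_lt_0_compat; [lra|]. apply Rdiv_lt_0_compat; lra. }
  assert (Hcw : ccont f (p + w)%C).
  { apply cdiff_ccont, Hf. replace (p + w - p)%C with w by ring. lra. }
  destruct (Hcw (eps / B) ltac:(apply Rdiv_lt_0_compat; auto)) as [e [He Hnear]].
  (* Points of the circle are at distance at most 2 r from p + w, so the contracted contour lies
     within [e] of it. *)
  set (d := Rmin 1 (e / (4 * r))).
  assert (Hd1 : 0 < d) by (unfold d; apply Rmin_pos; [lra|apply Rdiv_lt_0_compat; lra]).
  assert (Hd2 : d <= 1) by apply Rmin_l.
  assert (Hd3 : d * (2 * r) < e).
  { assert (d <= e / (4 * r)) by apply Rmin_r.
    apply Rle_lt_trans with (e / (4 * r) * (2 * r)); [apply Rmult_le_compat_r; lra|].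
    replace (e / (4 * r) * (2 * r)) with (e / 2) by (field; lra). lra. }
  rewrite (sector_period f p w r d) by (auto; lra).
  pose proof (sector_smooth p w r d Hr Hw ltac:(lra)) as Hs.
  assert (Fc : rcont_on (fun v => f (p + w + RtoC d * (circ r v - w)) * / (1 - w * icirc r v))%C 0 (2 * PI)).
  { intros v Hv. apply rcont_mult; [|apply Kc; auto].
    apply (rcont_comp f (fun v => (p + w + RtoC d * (circ r v - w))%C)).
    - apply cdiff_ccont, Hf. replace (p + w + RtoC d * (circ r v - w) - p)%C with (w + RtoC d * (circ r v - w))%C by ring.
      apply sector_in_disc; auto; lra.
    - eapply rderiv_rcont, (sr_v _ _ _ _ _ _ _ _ Hs); lra. }
  assert (Gc : rcont_on (fun v => f (p + w) * / (1 - w * icirc r v))%C 0 (2 * PI)).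
  { intros v Hv. apply rcont_mult; [apply rcont_const|apply Kc; auto]. }
  match goal with |- Cmod (CInt ?F1 _ _ - CInt ?F2 _ _) <= _ =>
    replace (CInt F1 0 (2 * PI) - CInt F2 0 (2 * PI))%C
     with (CInt F1 0 (2 * PI) + - (1) * CInt F2 0 (2 * PI))%C by ring end.
  rewrite <- CInt_scal, <- CInt_plus; auto; try lra.
  2: { intros v Hv. apply rcont_mult; [apply rcont_const|apply Gc; auto]. }
  eapply Rle_trans.
  - apply (CInt_bound _ 0 (2 * PI) (eps / B * (r / (r - Cmod w)))); [lra| |].
    + intros v Hv. apply rcont_plus; [apply Fc; auto|].
      apply rcont_mult; [apply rcont_const|apply Gc; auto].
    + intros v Hv.
      cbv beta; match goal with |- Cmod (?x * ?k + _ * (?y * ?k)) <= _ =>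
        replace (x * k + - (1) * (y * k))%C with ((x - y) * k)%C by ring end.
      rewrite Cmod_mult. apply Rmult_le_compat; try apply Cmod_ge_0.
      * apply Rlt_le, Hnear.
        replace (p + w + RtoC d * (circ r v - w) - (p + w))%C with (RtoC d * (circ r v - w))%C by ring.
        rewrite Cmod_mult, Cmod_R, Rabs_right by lra.
        eapply Rle_lt_trans; [|exact Hd3]. apply Rmult_le_compat_l; [lra|].
        apply (sr_bu _ _ _ _ _ _ _ _ Hs d v); lra.
      * apply kernel_bound; auto.
  - right. unfold B. field. split; [lra|]. pose proof PI_RGT_0. lra.
Qed.

(** * Taylor expansion with an explicit remainder *)

Definition taylor_coef (f : C -> C) (p : C) (r : R) (n : nat) : C :=
  (RtoC (/ (2 * PI)) * CInt (fun v => f (p + circ r v) * icirc r v ^ n) 0 (2 * PI))%C.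

Lemma rcont_circle (f : C -> C) (p : C) (r : R) : 0 < r -> cdiff_disc f p r ->
  rcont_on (fun v => f (p + circ r v)%C) 0 (2 * PI).
Proof.
  intros Hr Hf v Hv. apply (rcont_comp f (fun v => p + circ r v)%C).
  - apply cdiff_ccont, Hf. replace (p + circ r v - p)%C with (circ r v) by ring. rewrite Cmod_circ; lra.
  - apply rcont_plus; [apply rcont_const|]. eapply rderiv_rcont, rderiv_circ.
Qed.

(** Obtained by inserting the finite expansion of the kernel in Cauchy's formula. An estimate valid
    for every N replaces the theory of power series in all that follows. *)
Theorem taylor_bound (f : C -> C) (p : C) (r M : R) : 0 < r -> cdiff_disc f p r ->
  (forall z, Cmod (z - p) <= r -> Cmod (f z) <= M) ->
  forall w N, Cmod w < r ->
  Cmod (f (p + w)%C - psum (fun n => taylor_coef f p r n * w ^ n)%C N)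
  <= 2 * M * (r / (r - Cmod w)) * (Cmod w / r) ^ N.
Proof.
  intros Hr Hf HM w N Hw. pose proof two_PI_pos as HP.
  pose proof (rcont_circle f p r Hr Hf) as Hc.
  pose proof (cauchy_formula f p w r Hr Hw Hf) as E.
  rewrite (kernel_expand (fun v => f (p + circ r v)%C) r w N Hr Hw Hc) in E.
  set (T := CInt (fun t => f (p + circ r t) * icirc r t ^ N * / (1 - w * icirc r t))%C 0 (2 * PI)) in E.
  assert (Ep : forall n, psum (fun n => taylor_coef f p r n * w ^ n)%C n
    = (RtoC (/ (2 * PI)) * psum (fun n => w ^ n * CInt (fun v => f (p + circ r v) * icirc r v ^ n) 0 (2 * PI)) n)%C).
  { induction n; cbn [psum]; [ring|]. rewrite IHn. unfold taylor_coef. ring. }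
  assert (Ef : (f (p + w) - psum (fun n => taylor_coef f p r n * w ^ n) N)%C = (RtoC (/ (2 * PI)) * (w ^ N * T))%C).
  { rewrite Ep. replace (f (p + w)%C) with (RtoC (/ (2 * PI)) * (RtoC (2 * PI) * f (p + w)))%C.
    - rewrite <- E. ring.
    - rewrite Cmult_assoc, <- RtoC_mult, Rinv_l by lra. ring. }
  rewrite Ef, !Cmod_mult, Cmod_R, Cmod_pow.
  rewrite Rabs_right by (apply Rle_ge, Rlt_le, Rinv_0_lt_compat; lra).
  assert (BT : Cmod T <= 2 * (M * (/ r) ^ N * (r / (r - Cmod w)) * (2 * PI - 0))).
  { unfold T. apply CInt_bound; [lra| |].
    - intros t Ht. apply rcont_mult; [apply rcont_mult; [apply Hc; auto|apply rcont_icirc_pow]|apply rcont_kernel; auto].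
    - intros t Ht. rewrite !Cmod_mult, Cmod_pow, Cmod_icirc by auto.
      assert (0 <= (/ r) ^ N) by (apply pow_le, Rlt_le, Rinv_0_lt_compat; auto).
      apply Rmult_le_compat; try apply Cmod_ge_0.
      + apply Rmult_le_pos; [apply Cmod_ge_0|auto].
      + apply Rmult_le_compat_r; auto. apply HM.
        replace (p + circ r t - p)%C with (circ r t) by ring. rewrite Cmod_circ; lra.
      + apply kernel_bound; auto. }
  pose proof (Cmod_ge_0 w).
  assert (Hi : 0 < / (2 * PI)) by (apply Rinv_0_lt_compat; lra).
  eapply Rle_trans; [apply Rmult_le_compat_l; [lra|]; apply Rmult_le_compat_l; [apply pow_le; auto|exact BT]|].
  right. unfold Rdiv. rewrite Rpow_mult_distr. field. split; lra.
Qed.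

Lemma hol_disc (f : C -> C) (p : C) : hol f p ->
  exists r M, 0 < r /\ cdiff_disc f p r /\ forall z, Cmod (z - p) <= r -> Cmod (f z) <= M.
Proof.
  intros H. pose proof (ccont_bounded _ _ (cdiff_ccont _ _ (hol_cdiff _ _ H))) as Hb.
  destruct (near_and _ _ _ H Hb) as [d [Hd Hw]].
  exists (d / 2), (Cmod (f p) + 1). split; [lra|]. split.
  - intros z Hz. apply Hw. lra.
  - intros z Hz. apply Hw. lra.
Qed.

Lemma taylor_coef_bound (f : C -> C) (p : C) (r M : R) (n : nat) : 0 < r -> cdiff_disc f p r ->
  (forall z, Cmod (z - p) <= r -> Cmod (f z) <= M) ->
  Cmod (taylor_coef f p r n) <= 2 * M / r ^ n.
Proof.
  intros Hr Hf HM. pose proof two_PI_pos as HP. unfold taylor_coef.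
  assert (Hi : 0 < / (2 * PI)) by (apply Rinv_0_lt_compat; lra).
  assert (Hn : 0 < r ^ n) by (apply pow_lt; auto).
  rewrite Cmod_mult, Cmod_R, Rabs_right by lra.
  eapply Rle_trans; [apply Rmult_le_compat_l; [lra|]; apply (CInt_bound _ 0 (2 * PI) (M / r ^ n)); [lra| |]|].
  - intros t Ht. apply rcont_mult; [apply rcont_circle; auto|apply rcont_icirc_pow].
  - intros t Ht. rewrite Cmod_mult, Cmod_pow, Cmod_icirc, pow_inv by auto.
    apply Rmult_le_compat_r; [apply Rlt_le, Rinv_0_lt_compat; auto|]. apply HM.
    replace (p + circ r t - p)%C with (circ r t) by ring. rewrite Cmod_circ; lra.
  - right. field. split; lra.
Qed.

Lemma taylor_coef_0 (f : C -> C) (p : C) (r : R) : 0 < r -> cdiff_disc f p r ->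
  taylor_coef f p r 0 = f p.
Proof.
  intros Hr Hf. pose proof two_PI_pos as HP. unfold taylor_coef.
  rewrite (CInt_ext _ (fun v => f (p + circ r v) * / (1 - 0 * icirc r v))%C).
  2: lra. 2: { intros v _. cbn. replace (1 - 0 * icirc r v)%C with (RtoC 1) by ring. field. }
  rewrite (cauchy_formula f p 0 r) by (auto; rewrite Cmod_0; auto).
  rewrite Cmult_assoc, <- RtoC_mult, Rinv_l, Cplus_0_r by lra. ring.
Qed.

(** The case N = 2 of the Taylor estimate. What matters is that both constants are linear in M: for
    a sequence of functions with summable bounds these estimates can be added up. *)
Lemma quadratic_bound (f : C -> C) (p : C) (r M : R) : 0 < r -> cdiff_disc f p r ->
  (forall z, Cmod (z - p) <= r -> Cmod (f z) <= M) ->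
  exists l, Cmod l <= 4 * M / r /\ forall h, Cmod h <= r / 2 ->
    Cmod (f (p + h)%C - f p - l * h) <= 4 * M / (r * r) * (Cmod h * Cmod h).
Proof.
  intros Hr Hf HM.
  assert (HM0 : 0 <= M).
  { eapply Rle_trans; [apply Cmod_ge_0|]. apply (HM p).
    replace (p - p)%C with (RtoC 0) by ring. rewrite Cmod_0; lra. }
  pose proof (taylor_coef_0 f p r Hr Hf) as E0.
  exists (taylor_coef f p r 1). split.
  - eapply Rle_trans; [apply (taylor_coef_bound f p r M); auto|].
    rewrite pow_1. apply Rmult_le_compat_r; [apply Rlt_le, Rinv_0_lt_compat; auto|]. lra.
  - intros h Hh. pose proof (Cmod_ge_0 h).
    pose proof (taylor_bound f p r M Hr Hf HM h 2 ltac:(lra)) as T.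
    cbn [psum] in T. rewrite E0 in T.
    replace (f (p + h) - f p - taylor_coef f p r 1 * h)%C
      with (f (p + h) - (0 + f p * h ^ 0 + taylor_coef f p r 1 * h ^ 1))%C by (cbn; ring).
    eapply Rle_trans; [exact T|].
    replace (4 * M / (r * r) * (Cmod h * Cmod h)) with (2 * M * 2 * (Cmod h / r) ^ 2) by (field; lra).
    apply Rmult_le_compat_r; [apply pow_le, Rdiv_le_0_compat; lra|].
    apply Rmult_le_compat_l; [lra|]. apply Rle_div_l; lra.
Qed.

(** The second-order error is what survives a division by t - p at a simple pole. *)
Lemma hol_cderiv2 (f : C -> C) (p : C) : hol f p ->
  exists l K d, 0 < d /\ forall h, Cmod h <= d ->
    Cmod (f (p + h)%C - f p - l * h) <= K * (Cmod h * Cmod h).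
Proof.
  intros H. destruct (hol_disc f p H) as (r & M & Hr & Hf & HM).
  destruct (quadratic_bound f p r M Hr Hf HM) as (l & _ & Hl).
  exists l, (4 * M / (r * r)), (r / 2). split; [lra|exact Hl].
Qed.

Lemma psum_lead (b : nat -> C) (k : nat) : (forall j, (j < k)%nat -> b j = 0%C) ->
  psum b (S k) = b k.
Proof.
  intros H. cbn [psum]. replace (psum b k) with (RtoC 0); [ring|].
  induction k; auto. cbn [psum]. rewrite <- IHk by (intros; apply H; lia). rewrite H by lia. ring.
Qed.

(** Either some Taylor coefficient is nonzero, and the first such term dominates the remainder near
    p, or all vanish, and the remainder estimate for every N forces f to be 0 in a disc. *)
Theorem isolated_zeros (f : C -> C) (p : C) : hol f p ->
  near p (fun z => f z = 0%C) \/ near p (fun z => z <> p -> f z <> 0%C).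
Proof.
  intros H. destruct (hol_disc f p H) as (r & M & Hr & Hf & HM).
  pose proof (taylor_bound f p r M Hr Hf HM) as T.
  destruct (classic (exists k, taylor_coef f p r k <> 0%C)) as [Hex|Hno].
  - right.
    destruct (dec_inh_nat_subset_has_unique_least_element (fun k => taylor_coef f p r k <> 0%C))
      as [k [[Hk Hmin] _]]; [intros n; apply classic|exact Hex|].
    assert (Hlt : forall j, (j < k)%nat -> taylor_coef f p r j = 0%C).
    { intros j Hj. apply NNPP. intros N. specialize (Hmin j N). lia. }
    set (a := taylor_coef f p r k) in *.
    assert (Ha : 0 < Cmod a) by (apply Cmod_gt_0, Hk).
    assert (HM0 : 0 <= M).
    { eapply Rle_trans; [apply Cmod_ge_0|]. apply (HM p).
      replace (p - p)%C with (RtoC 0) by ring. rewrite Cmod_0; lra. }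
    assert (Hrk : 0 < r ^ S k) by (apply pow_lt; auto).
    (* Within r / 2 the factor r / (r - |w|) is at most 2; the second bound makes the remainder at
       most half of the leading term, so a zero would give |a| <= |a| / 2. *)
    set (d := Rmin (r / 2) (Cmod a * r ^ S k / (8 * (M + 1)))).
    assert (Hd : 0 < d).
    { apply Rmin_pos; [lra|]. apply Rdiv_lt_0_compat; [apply Rmult_lt_0_compat; auto|lra]. }
    exists d. split; auto. intros z Hz Hzp Hfz.
    set (w := (z - p)%C) in *.
    assert (Hw0 : 0 < Cmod w).
    { apply Cmod_gt_0. intros E. apply Hzp. replace z with (w + p)%C by (unfold w; ring). rewrite E. ring. }
    assert (D1 : d <= r / 2) by apply Rmin_l.
    assert (D2 : d <= Cmod a * r ^ S k / (8 * (M + 1))) by apply Rmin_r.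
    specialize (T w (S k) ltac:(lra)).
    rewrite psum_lead in T by (intros j Hj; rewrite Hlt by auto; ring).
    replace (p + w)%C with z in T by (unfold w; ring). rewrite Hfz in T. fold a in T.
    replace (0 - a * w ^ k)%C with (- (a * w ^ k))%C in T by ring.
    rewrite Cmod_opp, Cmod_mult, Cmod_pow in T.
    assert (Hp : 0 < Cmod w ^ k) by (apply pow_lt; auto).
    assert (T2 : Cmod a * Cmod w ^ k <= 2 * M * 2 * (Cmod w / r) ^ S k).
    { eapply Rle_trans; [exact T|]. apply Rmult_le_compat_r; [apply pow_le, Rdiv_le_0_compat; lra|].
      apply Rmult_le_compat_l; [lra|]. apply Rle_div_l; lra. }
    replace ((Cmod w / r) ^ S k) with (Cmod w ^ k * (Cmod w / r ^ S k)) in T2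
      by (unfold Rdiv; rewrite Rpow_mult_distr, pow_inv; cbn; ring).
    assert (T3 : Cmod a <= 4 * M * (Cmod w / r ^ S k)).
    { apply Rmult_le_reg_r with (Cmod w ^ k); auto. lra. }
    assert (T4 : 4 * (M + 1) * (Cmod w / r ^ S k) <= Cmod a / 2).
    { assert (Hwd : Cmod w <= Cmod a * r ^ S k / (8 * (M + 1))) by lra.
      apply Rmult_le_reg_r with (r ^ S k); auto.
      replace (4 * (M + 1) * (Cmod w / r ^ S k) * r ^ S k) with (4 * (M + 1) * Cmod w) by (field; lra).
      replace (Cmod a / 2 * r ^ S k) with (4 * (M + 1) * (Cmod a * r ^ S k / (8 * (M + 1)))) by (field; lra).
      apply Rmult_le_compat_l; lra. }
    assert (0 <= Cmod w / r ^ S k) by (apply Rdiv_le_0_compat; lra). lra.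
  - left. exists r. split; auto. intros z Hz.
    apply eq_of_Cmod_le. intros eps Heps.
    set (w := (z - p)%C) in *. pose proof (Cmod_ge_0 w).
    assert (Hq : 0 <= Cmod w / r < 1).
    { split; [apply Rdiv_le_0_compat; lra|]. apply Rlt_div_l; lra. }
    destruct (pow_ratio_small (Cmod w / r) (2 * M * (r / (r - Cmod w))) eps Hq Heps) as [N HN].
    eapply Rle_trans; [|apply (HN N (le_n N))].
    specialize (T w N Hz). replace (p + w)%C with z in T by (unfold w; ring).
    replace (psum (fun n => (taylor_coef f p r n * w ^ n)%C) N) with (RtoC 0) in T; [exact T|].
    symmetry. clear -Hno. induction N; auto. cbn [psum]. rewrite IHN.
    replace (taylor_coef f p r N) with (RtoC 0); [ring|].
    symmetry. apply NNPP. intros E. apply Hno. exists N; exact E.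
Qed.

(** * Series and Weierstrass's theorem *)

Lemma sum_n_psum (a : nat -> C) (n : nat) :
  sum_n (G := C_AbelianMonoid) a n = psum a (S n).
Proof.
  induction n.
  - rewrite sum_O. cbn. ring.
  - rewrite sum_Sn, IHn. reflexivity.
Qed.

Fixpoint rsum (b : nat -> R) (n : nat) : R :=
  match n with O => 0 | S m => rsum b m + b m end.

Lemma sum_n_rsum (b : nat -> R) (n : nat) : sum_n b n = rsum b (S n).
Proof.
  induction n.
  - rewrite sum_O. cbn. ring.
  - rewrite sum_Sn, IHn. reflexivity.
Qed.

Definition cser (a : nat -> C) (v : C) : Prop :=
  forall eps, 0 < eps -> exists N, forall n, (N <= n)%nat -> Cmod (psum a n - v) <= eps.

Definition rser (b : nat -> R) (v : R) : Prop :=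
  forall eps, 0 < eps -> exists N, forall n, (N <= n)%nat -> Rabs (rsum b n - v) <= eps.

Lemma rser_is_series (b : nat -> R) (v : R) : rser b v <-> is_series b v.
Proof.
  split.
  - intros H. apply filterlim_locally. intros [eps Heps].
    destruct (H (eps / 2) ltac:(lra)) as [N HN]. exists N. intros n Hn.
    change (Rabs (sum_n b n - v) < eps). rewrite sum_n_rsum.
    specialize (HN (S n) ltac:(lia)). lra.
  - intros H eps Heps.
    destruct (proj1 (filterlim_locally (F := eventually) (sum_n b) v) H (mkposreal eps Heps)) as [N HN].
    exists (S N). intros n Hn. destruct n as [|n]; [lia|].
    specialize (HN n ltac:(lia)). change (Rabs (sum_n b n - v) < eps) in HN.
    rewrite sum_n_rsum in HN. lra.
Qed.

Lemma Re_psum (a : nat -> C) (n : nat) : Re (psum a n) = rsum (fun k => Re (a k)) n.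
Proof. induction n; cbn [psum rsum]; [reflexivity|]. rewrite re_plus, IHn. reflexivity. Qed.

Lemma Im_psum (a : nat -> C) (n : nat) : Im (psum a n) = rsum (fun k => Im (a k)) n.
Proof. induction n; cbn [psum rsum]; [reflexivity|]. rewrite im_plus, IHn. reflexivity. Qed.

Lemma cser_is_Cseries (a : nat -> C) (v : C) : cser a v <-> is_Cseries a v.
Proof.
  split.
  - intros H. apply (filterlim_locally (U := C_UniformSpace)). intros eps.
    assert (Hn : near v (fun w => ball (M := C_UniformSpace) v eps w)).
    { apply near_locally. apply (locally_ball (T := C_UniformSpace)). }
    destruct Hn as [d [Hd Hb]].
    destruct (H (d / 2) ltac:(lra)) as [N HN]. exists N. intros n Hn. apply Hb.
    rewrite sum_n_psum. specialize (HN (S n) ltac:(lia)). lra.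
  - intros H eps Heps.
    assert (Hn : locally (T := C_UniformSpace) v (fun w => Cmod (w - v) < eps)).
    { apply near_locally. exists eps; split; auto. }
    specialize (H _ Hn). destruct H as [N HN].
    exists (S N). intros n Hn'. destruct n as [|n]; [lia|].
    specialize (HN n ltac:(lia)). rewrite sum_n_psum in HN. lra.
Qed.

Lemma cser_unique (a : nat -> C) (v w : C) : cser a v -> cser a w -> v = w.
Proof.
  intros Hv Hw. apply eq_of_Cmod_le. intros eps Heps.
  destruct (Hv (eps / 2) ltac:(lra)) as [N1 H1]. destruct (Hw (eps / 2) ltac:(lra)) as [N2 H2].
  specialize (H1 (N1 + N2)%nat ltac:(lia)). specialize (H2 (N1 + N2)%nat ltac:(lia)).
  set (s := psum a (N1 + N2)) in *.
  replace (v - w)%C with ((s - w) - (s - v))%C by ring.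
  pose proof (Cmod_triangle_minus (s - w) (s - v)). lra.
Qed.

Lemma psum_ext (a b : nat -> C) (n : nat) : (forall k, (k < n)%nat -> a k = b k) -> psum a n = psum b n.
Proof. induction n; intros H; cbn; auto. rewrite IHn, H by auto. reflexivity. Qed.

Lemma psum_plus (a b : nat -> C) (n : nat) : psum (fun k => a k + b k)%C n = (psum a n + psum b n)%C.
Proof. induction n; cbn [psum]; [ring|rewrite IHn; ring]. Qed.

Lemma psum_scal (c : C) (a : nat -> C) (n : nat) : psum (fun k => c * a k)%C n = (c * psum a n)%C.
Proof. induction n; cbn [psum]; [ring|rewrite IHn; ring]. Qed.

Lemma cser_ext (a b : nat -> C) (v : C) : (forall n, a n = b n) -> cser a v -> cser b v.
Proof.
  intros H Ha eps Heps. destruct (Ha eps Heps) as [N HN]. exists N. intros n Hn.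
  rewrite <- (psum_ext a b) by auto. auto.
Qed.

Lemma cser_plus (a b : nat -> C) (v w : C) : cser a v -> cser b w ->
  cser (fun n => a n + b n)%C (v + w)%C.
Proof.
  intros Ha Hb eps Heps.
  destruct (Ha (eps / 2) ltac:(lra)) as [N1 H1]. destruct (Hb (eps / 2) ltac:(lra)) as [N2 H2].
  exists (N1 + N2)%nat. intros n Hn. specialize (H1 n ltac:(lia)). specialize (H2 n ltac:(lia)).
  rewrite psum_plus. replace (psum a n + psum b n - (v + w))%C with ((psum a n - v) + (psum b n - w))%C by ring.
  pose proof (Cmod_triangle (psum a n - v) (psum b n - w)). lra.
Qed.

Lemma cser_scal (c : C) (a : nat -> C) (v : C) : cser a v -> cser (fun n => c * a n)%C (c * v)%C.
Proof.
  intros Ha eps Heps. pose proof (Cmod_ge_0 c).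
  destruct (Ha (eps / (Cmod c + 1)) ltac:(apply Rdiv_lt_0_compat; lra)) as [N HN].
  exists N. intros n Hn. specialize (HN n Hn). rewrite psum_scal.
  replace (c * psum a n - c * v)%C with (c * (psum a n - v))%C by ring. rewrite Cmod_mult.
  apply Rle_trans with ((Cmod c + 1) * (eps / (Cmod c + 1))).
  - apply Rmult_le_compat; auto using Cmod_ge_0; lra.
  - right. field. lra.
Qed.

Lemma cser_opp (a : nat -> C) (v : C) : cser a v -> cser (fun n => - a n)%C (- v)%C.
Proof.
  intros H. replace (- v)%C with (- (1) * v)%C by ring.
  apply cser_ext with (fun n => - (1) * a n)%C; [intros; ring|]. apply cser_scal, H.
Qed.

Lemma cser_minus (a b : nat -> C) (v w : C) : cser a v -> cser b w ->
  cser (fun n => a n - b n)%C (v - w)%C.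
Proof. intros. apply cser_plus; auto using cser_opp. Qed.

Lemma cser_zero : cser (fun _ => RtoC 0) 0%C.
Proof.
  intros eps Heps. exists 0%nat. intros n _.
  replace (psum (fun _ => RtoC 0) n) with (RtoC 0).
  - replace (0 - 0)%C with (RtoC 0) by ring. rewrite Cmod_0. lra.
  - induction n; cbn [psum]; [reflexivity|]. rewrite <- IHn. ring.
Qed.

Lemma cser_psum (a : nat -> nat -> C) (v : nat -> C) (K : nat) :
  (forall k, (k < K)%nat -> cser (a k) (v k)) ->
  cser (fun n => psum (fun k => a k n) K) (psum v K).
Proof.
  induction K; intros H; cbn [psum]; [apply cser_zero|].
  apply cser_plus; [apply IHK; intros; apply H; lia|apply H; lia].
Qed.

Lemma rsum_le (a b : nat -> R) (n : nat) : (forall k, a k <= b k) -> rsum a n <= rsum b n.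
Proof. intros H. induction n; cbn [rsum]; [lra|]. specialize (H n). lra. Qed.

Lemma Cmod_psum_le (a : nat -> C) (b : nat -> R) (M n : nat) : (forall k, Cmod (a k) <= b k) ->
  Cmod (psum a (M + n) - psum a M) <= rsum b (M + n) - rsum b M.
Proof.
  intros H. induction n.
  - rewrite Nat.add_0_r. replace (psum a M - psum a M)%C with (RtoC 0) by ring. rewrite Cmod_0. lra.
  - rewrite Nat.add_succ_r. cbn [psum rsum].
    replace (psum a (M + n) + a (M + n)%nat - psum a M)%C with ((psum a (M + n) - psum a M) + a (M + n)%nat)%C by ring.
    pose proof (Cmod_triangle (psum a (M + n) - psum a M) (a (M + n)%nat)).
    specialize (H (M + n)%nat). lra.
Qed.

(** The comparison test in quantitative form: the tail of the majorant controls the tail of the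
    series. *)
Lemma cser_tail (a : nat -> C) (b : nat -> R) (v : C) (B : R) (M : nat) :
  (forall k, Cmod (a k) <= b k) -> cser a v -> rser b B -> Cmod (v - psum a M) <= B - rsum b M.
Proof.
  intros H Ha Hb. apply Rle_plus_epsilon. intros eps Heps.
  destruct (Ha (eps / 2) ltac:(lra)) as [N1 H1]. destruct (Hb (eps / 2) ltac:(lra)) as [N2 H2].
  specialize (H1 (M + (N1 + N2))%nat ltac:(lia)). specialize (H2 (M + (N1 + N2))%nat ltac:(lia)).
  pose proof (Cmod_psum_le a b M (N1 + N2) H) as H3.
  apply Rabs_le_between in H2.
  set (s := psum a (M + (N1 + N2))) in *. rewrite Cmod_minus_sym in H1.
  replace (v - psum a M)%C with ((v - s) + (s - psum a M))%C by ring.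
  pose proof (Cmod_triangle (v - s) (s - psum a M)). lra.
Qed.

Lemma cser_bound (a : nat -> C) (b : nat -> R) (v : C) (B : R) :
  (forall k, Cmod (a k) <= b k) -> cser a v -> rser b B -> Cmod v <= B.
Proof.
  intros H Ha Hb. pose proof (cser_tail a b v B 0 H Ha Hb) as T. cbn in T.
  replace (v - 0)%C with v in T by ring. lra.
Qed.

(** A total function, meaningful only when both real series converge; [CSer_correct] obtains this
    from a summable majorant. *)
Definition CSer (a : nat -> C) : C := (Series (fun n => Re (a n)), Series (fun n => Im (a n))).

Lemma CSer_correct (a : nat -> C) (b : nat -> R) (B : R) :
  (forall n, Cmod (a n) <= b n) -> rser b B -> cser a (CSer a).
Proof.
  intros H Hb. apply rser_is_series in Hb.
  assert (HR : is_series (fun n => Re (a n)) (Series (fun n => Re (a n)))).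
  { apply Series_correct, (ex_series_le (V := R_CompleteNormedModule) _ b); [|eexists; exact Hb].
    intros n. eapply Rle_trans; [apply re_le_Cmod|apply H]. }
  assert (HI : is_series (fun n => Im (a n)) (Series (fun n => Im (a n)))).
  { apply Series_correct, (ex_series_le (V := R_CompleteNormedModule) _ b); [|eexists; exact Hb].
    intros n. eapply Rle_trans; [apply im_le_Cmod|apply H]. }
  apply rser_is_series in HR, HI. intros eps Heps.
  destruct (HR (eps / 2) ltac:(lra)) as [N1 H1]. destruct (HI (eps / 2) ltac:(lra)) as [N2 H2].
  exists (N1 + N2)%nat. intros n Hn. specialize (H1 n ltac:(lia)). specialize (H2 n ltac:(lia)).
  eapply Rle_trans; [apply Cmod_le_abs|]. unfold Cminus, CSer.
  rewrite re_plus, im_plus, re_opp, im_opp, Re_psum, Im_psum. cbn [Re Im fst snd].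
  unfold Rminus in *. lra.
Qed.

Lemma rser_scal (c : R) (b : nat -> R) (B : R) : rser b B -> rser (fun n => c * b n) (c * B).
Proof.
  intros H. apply rser_is_series. apply rser_is_series in H.
  apply (is_series_scal_l (K := R_AbsRing) c b B H).
Qed.

(** A majorant in product form makes the truncation error in m uniform enough to be summed over n,
    so finite sums of columns suffice. *)
Lemma cser_fubini (a : nat -> nat -> C) (al be : nat -> R) (A B : R) (ri cj : nat -> C) (v : C) :
  (forall n m, Cmod (a n m) <= al n * be m) -> rser al A -> rser be B ->
  (forall n, cser (a n) (ri n)) -> (forall m, cser (fun n => a n m) (cj m)) ->
  cser cj v -> cser ri v.
Proof.
  intros Hab HA HB Hr Hc Hv.
  assert (Hri : forall n, Cmod (ri n) <= B * al n).
  { intros n. rewrite Rmult_comm. apply (cser_bound (a n) (fun m => al n * be m)); auto.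
    apply rser_scal, HB. }
  pose proof (CSer_correct ri _ _ Hri (rser_scal B al A HA)) as Hs.
  replace v with (CSer ri); [exact Hs|].
  apply eq_of_Cmod_le. intros eps Heps.
  destruct (Hv (eps / 2) ltac:(lra)) as [N1 H1].
  pose proof (Rabs_pos A).
  destruct (HB (eps / (2 * (Rabs A + 1))) ltac:(apply Rdiv_lt_0_compat; lra)) as [N2 H2].
  set (M := (N1 + N2)%nat). specialize (H1 M ltac:(lia)). specialize (H2 M ltac:(lia)).
  (* The first M columns commute with the sum of the rows; the rest of row n is at most [al n] times
     the tail of [be]. *)
  assert (Hd : Cmod (CSer ri - psum cj M) <= (B - rsum be M) * A).
  { apply (cser_bound (fun n => ri n - psum (a n) M)%C (fun n => (B - rsum be M) * al n)).
    - intros n. eapply Rle_trans; [apply (cser_tail (a n) (fun m => al n * be m) _ (al n * B)); auto|].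
      + apply rser_scal, HB.
      + right. replace (rsum (fun m => al n * be m) M) with (al n * rsum be M); [ring|].
        clear. induction M; cbn [rsum]; [ring|rewrite <- IHM; ring].
    - apply cser_minus; [exact Hs|]. apply (cser_psum (fun m n => a n m)). intros; apply Hc.
    - apply rser_scal, HA. }
  assert (Hd2 : (B - rsum be M) * A <= eps / 2).
  { eapply Rle_trans; [apply Rle_abs|]. rewrite Rabs_mult, (Rabs_minus_sym B).
    apply Rle_trans with (eps / (2 * (Rabs A + 1)) * (Rabs A + 1)).
    - apply Rmult_le_compat; auto using Rabs_pos; lra.
    - right. field. lra. }
  replace (CSer ri - v)%C with ((CSer ri - psum cj M) + (psum cj M - v))%C by ring.
  pose proof (Cmod_triangle (CSer ri - psum cj M) (psum cj M - v)). lra.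
Qed.

(** * Termwise differentiation *)

Lemma cderiv_unique (f : C -> C) (z l m : C) : cderiv f z l -> cderiv f z m -> l = m.
Proof.
  intros Hl Hm. apply eq_of_Cmod_le. intros eps Heps.
  destruct (near_and _ _ _ (Hl (eps / 2) ltac:(lra)) (Hm (eps / 2) ltac:(lra))) as [d [Hd H]].
  assert (E : (z + RtoC (d / 2) - z)%C = RtoC (d / 2)) by ring.
  destruct (H (z + RtoC (d / 2))%C) as [H1 H2]; [rewrite E, Cmod_R, Rabs_right; lra|].
  rewrite E in *. set (D := RtoC (d / 2)) in *.
  assert (HD : Cmod D = d / 2) by (unfold D; rewrite Cmod_R, Rabs_right; lra).
  rewrite HD in *. set (A := (f (z + D) - f z)%C) in *.
  assert (Hle : Cmod ((l - m) * D) <= eps * (d / 2)).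
  { replace ((l - m) * D)%C with ((A - m * D) - (A - l * D))%C by ring.
    pose proof (Cmod_triangle_minus (A - m * D) (A - l * D)). lra. }
  rewrite Cmod_mult, HD in Hle. apply Rmult_le_reg_r with (d / 2); lra.
Qed.

Lemma quadratic_cderiv (f : C -> C) (z l : C) (K d : R) : 0 < d ->
  (forall h, Cmod h <= d -> Cmod (f (z + h)%C - f z - l * h) <= K * (Cmod h * Cmod h)) ->
  cderiv f z l.
Proof.
  intros Hd H eps Heps. pose proof (Rabs_pos K).
  exists (Rmin d (eps / (Rabs K + 1))). split.
  - apply Rmin_pos; [lra|]. apply Rdiv_lt_0_compat; lra.
  - intros w Hw.
    assert (W1 : Cmod (w - z) < d) by (eapply Rlt_le_trans; [exact Hw|apply Rmin_l]).
    assert (W2 : Cmod (w - z) < eps / (Rabs K + 1)) by (eapply Rlt_le_trans; [exact Hw|apply Rmin_r]).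
    pose proof (H (w - z)%C ltac:(lra)) as B.
    replace (z + (w - z))%C with w in B by ring.
    eapply Rle_trans; [exact B|]. rewrite <- Rmult_assoc.
    pose proof (Cmod_ge_0 (w - z)). apply Rmult_le_compat_r; auto.
    apply Rle_trans with ((Rabs K + 1) * (eps / (Rabs K + 1))).
    + pose proof (Rle_abs K).
      apply Rle_trans with ((Rabs K + 1) * Cmod (w - z)); [apply Rmult_le_compat_r; lra|].
      apply Rmult_le_compat_l; lra.
    + right. field. lra.
Qed.

(** The quadratic estimates of the terms, being linear in [M n], add up to a quadratic estimate for
    F. The derivative is returned as the sum of the derivatives because the constant term of zeta at
    its pole is computed in this way. *)
Theorem weierstrass_deriv (f : nat -> C -> C) (F : C -> C) (p : C) (M : nat -> R) (S : R) :
  near p (fun z => forall n, cdiff (f n) z /\ Cmod (f n z) <= M n) ->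
  near p (fun z => cser (fun n => f n z) (F z)) -> rser M S ->
  exists l L, (forall n, cderiv (f n) p (l n)) /\ cser l L /\ cderiv F p L.
Proof.
  intros Hf HF HS.
  destruct (near_and _ _ _ Hf HF) as [r0 [Hr0 H]].
  set (r := r0 / 2). assert (Hr : 0 < r) by (unfold r; lra).
  assert (Hin : forall z, Cmod (z - p) <= r -> Cmod (z - p) < r0) by (unfold r; intros; lra).
  assert (Hq : forall n, exists l, Cmod l <= 4 / r * M n /\ forall h, Cmod h <= r / 2 ->
    Cmod (f n (p + h)%C - f n p - l * h) <= (4 / (r * r) * (Cmod h * Cmod h)) * M n).
  { intros n. destruct (quadratic_bound (f n) p r (M n)) as [l [H1 H2]].
    - exact Hr.
    - intros w Hw. apply (H w); auto.
    - intros w Hw. apply (H w); auto.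
    - exists l. split; [eapply Rle_trans; [exact H1|]; right; field; lra|].
      intros h Hh. eapply Rle_trans; [apply H2; auto|]. right. field. lra. }
  set (l := fun n => proj1_sig (constructive_indefinite_description _ (Hq n))).
  assert (Hl : forall n, Cmod (l n) <= 4 / r * M n /\ forall h, Cmod h <= r / 2 ->
    Cmod (f n (p + h)%C - f n p - l n * h) <= (4 / (r * r) * (Cmod h * Cmod h)) * M n).
  { intros n. exact (proj2_sig (constructive_indefinite_description _ (Hq n))). }
  clearbody l.
  pose proof (CSer_correct l _ _ (fun n => proj1 (Hl n)) (rser_scal _ _ _ HS)) as HL.
  exists l, (CSer l). split; [|split; [exact HL|]].
  - intros n. apply (quadratic_cderiv (f n) p (l n) (4 / (r * r) * M n) (r / 2)); [lra|].
    intros h Hh. eapply Rle_trans; [apply Hl, Hh|]. right. ring.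
  - assert (Hp : Cmod (p - p) < r0) by (replace (p - p)%C with (RtoC 0) by ring; rewrite Cmod_0; lra).
    apply (quadratic_cderiv F p (CSer l) (4 / (r * r) * S) (r / 2)); [lra|].
    intros h Hh.
    replace (4 / (r * r) * S * (Cmod h * Cmod h)) with ((4 / (r * r) * (Cmod h * Cmod h)) * S) by ring.
    apply (cser_bound (fun n => f n (p + h)%C - f n p - l n * h)%C
      (fun n => 4 / (r * r) * (Cmod h * Cmod h) * M n)).
    + intros n. apply Hl, Hh.
    + apply cser_minus; [apply cser_minus; apply H|].
      * replace (p + h - p)%C with h by ring. unfold r in *. lra.
      * exact Hp.
      * apply cser_ext with (fun n => h * l n)%C; [intros; ring|].
        rewrite (Cmult_comm (CSer l)). apply cser_scal, HL.
    + apply rser_scal, HS.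
Qed.

Theorem weierstrass (f : nat -> C -> C) (F : C -> C) (p : C) (M : nat -> R) (S : R) :
  near p (fun z => forall n, cdiff (f n) z /\ Cmod (f n z) <= M n) ->
  near p (fun z => cser (fun n => f n z) (F z)) -> rser M S -> hol F p.
Proof.
  intros Hf HF HS. generalize (near_and _ _ _ (near_near _ _ Hf) (near_near _ _ HF)).
  apply near_imp. intros z [H1 H2].
  destruct (weierstrass_deriv f F z M S H1 H2 HS) as (l & L & _ & _ & HL). exists L; exact HL.
Qed.

(** * Meromorphic functions and the identity theorem *)

(** Punctured neighbourhoods, since the value of a meromorphic function at a pole is arbitrary. *)
Definition pnear (p : C) (P : C -> Prop) : Prop := near p (fun z => z <> p -> P z).

Lemma pnear_and (p : C) (P Q : C -> Prop) : pnear p P -> pnear p Q -> pnear p (fun z => P z /\ Q z).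
Proof. intros H1 H2. generalize (near_and _ _ _ H1 H2). apply near_imp. intuition. Qed.

Lemma pnear_imp (p : C) (P Q : C -> Prop) : (forall z, P z -> Q z) -> pnear p P -> pnear p Q.
Proof. intros H. apply near_imp. auto. Qed.

Lemma near_pnear (p : C) (P : C -> Prop) : near p P -> pnear p P.
Proof. apply near_imp. auto. Qed.

Lemma pnear_ex (p : C) (P : C -> Prop) : pnear p P -> exists z, P z.
Proof.
  intros [d [Hd H]]. exists (p + RtoC (d / 2))%C.
  assert (E : (p + RtoC (d / 2) - p)%C = RtoC (d / 2)) by ring.
  apply H.
  - rewrite E, Cmod_R, Rabs_right; lra.
  - intros E2. rewrite E2 in E. replace (p - p)%C with (RtoC 0) in E by ring.
    apply RtoC_inj in E. lra.
Qed.

Lemma pnear_False (p : C) (P : C -> Prop) : pnear p P -> pnear p (fun z => ~ P z) -> False.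
Proof. intros H1 H2. destruct (pnear_ex _ _ (pnear_and _ _ _ H1 H2)) as [z [? ?]]. auto. Qed.

Definition mero (f : C -> C) (p : C) : Prop :=
  exists g h, hol g p /\ hol h p /\ pnear p (fun z => h z <> 0%C) /\ pnear p (fun z => f z = (g z / h z)%C).

Lemma hol_mero (f : C -> C) (p : C) : hol f p -> mero f p.
Proof.
  intros H. exists f, (fun _ => RtoC 1). repeat split; auto using hol_const.
  - apply near_True. intros _ _ . apply C1_nz.
  - apply near_True. intros z _. field.
Qed.

(** By isolated zeros, a denominator with nonzero germ has no zero in a punctured neighbourhood. *)
Lemma meromorphic_at_mero (f : C -> C) (p : C) :
  meromorphic_at (U := C_NormedModule) f p -> mero f p.
Proof.
  intros (g & h & Hg & Hh & Hn & Hf).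
  apply holomorphic_at_hol in Hg, Hh. exists g, h.
  assert (Hp : pnear p (fun z => h z <> RtoC 0)).
  { destruct (isolated_zeros h p Hh) as [H0|H0]; auto.
    exfalso. apply Hn. apply (near_locally p (fun q => h q = RtoC 0)). exact H0. }
  repeat split; auto.
  assert (Hf' : near p (fun q => h q <> RtoC 0 -> f q = (g q / h q)%C)).
  { apply near_locally. exact Hf. }
  generalize (near_and _ _ _ Hp Hf'). apply near_imp. intuition.
Qed.

Lemma mero_pnear_ext (f g : C -> C) (p : C) : pnear p (fun z => f z = g z) -> mero f p -> mero g p.
Proof.
  intros He (a & b & Ha & Hb & Hn & Hf). exists a, b. repeat split; auto.
  generalize (pnear_and _ _ _ He Hf). apply pnear_imp. intros z [-> H]. exact H.
Qed.

Lemma mero_ext (f g : C -> C) (p : C) : (forall z, f z = g z) -> mero f p -> mero g p.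
Proof. intros H. apply mero_pnear_ext, near_True. auto. Qed.

Lemma mero_plus (f g : C -> C) (p : C) : mero f p -> mero g p -> mero (fun z => f z + g z)%C p.
Proof.
  intros (a & b & Ha & Hb & Hbn & Hf) (c & d & Hc & Hd & Hdn & Hg).
  exists (fun z => a z * d z + c z * b z)%C, (fun z => b z * d z)%C. repeat split.
  - apply hol_plus; apply hol_mult; auto.
  - apply hol_mult; auto.
  - generalize (pnear_and _ _ _ Hbn Hdn). apply pnear_imp. intros z [? ?]. apply Cmult_neq_0; auto.
  - generalize (pnear_and _ _ _ (pnear_and _ _ _ Hbn Hdn) (pnear_and _ _ _ Hf Hg)).
    apply pnear_imp. intros z [[? ?] [-> ->]]. field. auto.
Qed.

Lemma mero_mult (f g : C -> C) (p : C) : mero f p -> mero g p -> mero (fun z => f z * g z)%C p.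
Proof.
  intros (a & b & Ha & Hb & Hbn & Hf) (c & d & Hc & Hd & Hdn & Hg).
  exists (fun z => a z * c z)%C, (fun z => b z * d z)%C. repeat split.
  - apply hol_mult; auto.
  - apply hol_mult; auto.
  - generalize (pnear_and _ _ _ Hbn Hdn). apply pnear_imp. intros z [? ?]. apply Cmult_neq_0; auto.
  - generalize (pnear_and _ _ _ (pnear_and _ _ _ Hbn Hdn) (pnear_and _ _ _ Hf Hg)).
    apply pnear_imp. intros z [[? ?] [-> ->]]. field. auto.
Qed.

Lemma mero_const (c p : C) : mero (fun _ => c) p.
Proof. apply hol_mero, hol_const. Qed.

Lemma mero_minus (f g : C -> C) (p : C) : mero f p -> mero g p -> mero (fun z => f z - g z)%C p.
Proof.
  intros Hf Hg. apply mero_ext with (fun z => f z + - (1) * g z)%C; [intros; ring|].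
  apply mero_plus; auto. apply mero_mult; auto using mero_const.
Qed.

Lemma mero_psum (f : nat -> C -> C) (n : nat) (p : C) : (forall k, (k < n)%nat -> mero (f k) p) ->
  mero (fun z => psum (fun k => f k z) n) p.
Proof.
  induction n; intros H; cbn [psum]; [apply mero_const|]. apply mero_plus; auto.
Qed.

Lemma mero_shift (f : C -> C) (a p : C) : mero f (p + a)%C -> mero (fun z => f (z + a)%C) p.
Proof.
  intros (g & h & Hg & Hh & Hn & Hf).
  assert (Sh : forall P : C -> Prop, pnear (p + a)%C P -> pnear p (fun z => P (z + a)%C)).
  { intros P [d [Hd HP]]. exists d; split; auto. intros w Hw Hne. apply HP.
    - replace (w + a - (p + a))%C with (w - p)%C by ring. exact Hw.
    - intros E. apply Hne. replace w with (w + a - a)%C by ring. rewrite E. ring. }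
  exists (fun z => g (z + a)%C), (fun z => h (z + a)%C). repeat split.
  - apply hol_shift, Hg.
  - apply hol_shift, Hh.
  - apply (Sh (fun z => h z <> 0%C)), Hn.
  - apply (Sh (fun z => f z = (g z / h z)%C)), Hf.
Qed.

Lemma mero_dichotomy (f : C -> C) (p : C) : mero f p ->
  pnear p (fun z => f z = 0%C) \/ pnear p (fun z => f z <> 0%C).
Proof.
  intros (g & h & Hg & Hh & Hn & Hf).
  destruct (isolated_zeros g p Hg) as [H0|H0].
  - left. generalize (pnear_and _ _ _ (near_pnear _ _ H0) Hf). apply pnear_imp.
    intros z [E ->]. rewrite E. unfold Cdiv. ring.
  - right. generalize (pnear_and _ _ _ H0 (pnear_and _ _ _ Hn Hf)). apply pnear_imp.
    intros z [Hz [Hhz ->]] E. apply Hz.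
    replace (g z) with (g z / h z * h z)%C by (field; auto). rewrite E. ring.
Qed.

Lemma pnear_open (p : C) (P : C -> Prop) : pnear p P ->
  exists d, 0 < d /\ forall q, Cmod (q - p) < d -> pnear q P.
Proof.
  intros [d [Hd HP]]. exists d; split; auto. intros q Hq.
  destruct (classic (q = p)) as [->|Hne].
  - exists d; split; auto.
  - apply near_pnear.
    assert (H1 : near q (fun w => Cmod (w - p) < d)) by (apply near_ball, Hq).
    generalize (near_and _ _ _ H1 (near_neq q p Hne)). apply near_imp. intros w [? ?]. auto.
Qed.

(** A connectedness argument on a horizontal segment, run from its right end to its left end [p].
    Segments of this kind suffice because the series involved converge far to the right. *)
Theorem mero_identity (f : C -> C) (p : C) (L : R) : 0 <= L ->
  (forall u, 0 <= u <= L -> mero f (p + RtoC u)%C) ->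
  pnear (p + RtoC L)%C (fun z => f z = 0%C) -> pnear p (fun z => f z = 0%C).
Proof.
  intros HL Hm HZ.
  (* The parameter s is the distance from the right end; m is the supremum of the distances up to
     which f vanishes throughout. *)
  set (Z := fun s => pnear (p + RtoC (L - s))%C (fun z => f z = 0%C)).
  set (G := fun s => 0 <= s <= L /\ forall s', 0 <= s' <= s -> Z s').
  assert (HG0 : G 0).
  { split; [lra|]. intros s' Hs'. replace s' with 0 by lra. unfold Z. rewrite Rminus_0_r. exact HZ. }
  destruct (completeness G) as [m [Hm1 Hm2]].
  { exists L. intros s [Hs _]. lra. }
  { exists 0; exact HG0. }
  assert (Hm0 : 0 <= m) by (apply Hm1, HG0).
  assert (HmL : m <= L) by (apply Hm2; intros s [Hs _]; lra).
  assert (Hbelow : forall s, 0 <= s < m -> Z s).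
  { intros s Hs. apply NNPP. intros N.
    assert (m <= s); [|lra]. apply Hm2. intros s1 [Hs1 Hz1].
    apply Rnot_lt_le. intros Hlt. apply N, Hz1. lra. }
  assert (Hdist : forall a b, Cmod (p + RtoC (L - a) - (p + RtoC (L - b))) = Rabs (a - b)).
  { intros a b. replace (p + RtoC (L - a) - (p + RtoC (L - b)))%C with (RtoC (b - a))
      by (rewrite !RtoC_minus; ring). rewrite Cmod_R, Rabs_minus_sym. reflexivity. }
  (* Closedness: were f nonzero around the limit point, it would be nonzero around nearby points
     where it is already known to vanish. *)
  assert (Zm : Z m).
  { destruct (mero_dichotomy f (p + RtoC (L - m))%C) as [H0|H0]; [apply Hm; lra|exact H0|].
    exfalso. destruct (Rle_lt_or_eq_dec 0 m Hm0) as [Hpos|<-].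
    - destruct (pnear_open _ _ H0) as [d [Hd Hq]].
      set (s := Rmax 0 (m - d / 2)).
      assert (Hs : 0 <= s < m) by (unfold s; split; [apply Rmax_l|apply Rmax_lub_lt; lra]).
      assert (Hs2 : m - d / 2 <= s) by apply Rmax_r.
      apply (pnear_False (p + RtoC (L - s))%C (fun z => f z = 0%C)).
      + apply Hbelow, Hs.
      + apply Hq. rewrite Hdist. apply Rabs_lt_between. lra.
    - apply (pnear_False (p + RtoC (L - 0))%C (fun z => f z = 0%C)); auto.
      apply (proj2 HG0). lra. }
  (* Openness: vanishing around the point at distance m extends beyond m, contrary to the choice of
     m, unless the left end is reached. *)
  destruct (Rle_lt_or_eq_dec m L HmL) as [Hlt|Heq].
  - exfalso. destruct (pnear_open _ _ Zm) as [d [Hd Hq]].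
    set (s := Rmin L (m + d / 2)).
    assert (Hs1 : m < s) by (unfold s; apply Rmin_glb_lt; lra).
    assert (Hs2 : s <= L) by apply Rmin_l. assert (Hs3 : s <= m + d / 2) by apply Rmin_r.
    assert (G s).
    { split; [lra|]. intros s' Hs'. destruct (Rlt_dec s' m) as [Hl|Hl]; [apply Hbelow; lra|].
      apply Hq. rewrite Hdist. apply Rabs_lt_between. lra. }
    specialize (Hm1 s H). lra.
  - unfold Z in Zm. rewrite Heq in Zm. replace (p + RtoC (L - L))%C with p in Zm; [exact Zm|].
    rewrite Rminus_diag. ring.
Qed.

(** * Complex powers *)

Definition cexp (w : C) : C := (RtoC (exp (Re w)) * (cos (Im w), sin (Im w)))%C.

Lemma cexp_plus (z w : C) : cexp (z + w) = (cexp z * cexp w)%C.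
Proof.
  unfold cexp. rewrite re_plus, im_plus, exp_plus, cos_plus, sin_plus, RtoC_mult.
  replace (cos (Im z) * cos (Im w) - sin (Im z) * sin (Im w),
    sin (Im z) * cos (Im w) + cos (Im z) * sin (Im w))
    with ((cos (Im z), sin (Im z)) * (cos (Im w), sin (Im w)))%C.
  - ring.
  - apply C_ext; cbn; ring.
Qed.

Lemma cexp_0 : cexp 0 = 1%C.
Proof. unfold cexp. cbn. rewrite exp_0, cos_0, sin_0. apply C_ext; cbn; ring. Qed.

Lemma Cmod_cexp (w : C) : Cmod (cexp w) = exp (Re w).
Proof.
  unfold cexp. rewrite Cmod_mult, Cmod_cos_sin, Cmod_R, Rabs_right; [ring|].
  left. apply exp_pos.
Qed.

Lemma is_derive_eps (f : R -> R) (x l : R) : is_derive f x l ->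
  forall eps, 0 < eps -> exists d, 0 < d /\ forall h, Rabs h < d ->
    Rabs (f (x + h) - f x - l * h) <= eps * Rabs h.
Proof.
  intros H eps Heps. apply is_derive_Reals in H.
  destruct (H eps Heps) as [[d Hd] Hb]. exists d; split; auto. intros h Hh. cbn in Hb.
  destruct (Req_dec h 0) as [->|Hn].
  - rewrite Rplus_0_r, Rmult_0_r, Rabs_R0. rewrite Rminus_diag, Rminus_0_r, Rabs_R0. lra.
  - specialize (Hb h Hn Hh).
    replace (f (x + h) - f x - l * h) with (((f (x + h) - f x) / h - l) * h) by (field; auto).
    rewrite Rabs_mult. apply Rmult_le_compat_r; [apply Rabs_pos|lra].
Qed.

(** Only at 0 are estimates needed; the addition formula carries the result to every other point. *)
Lemma cderiv_cexp_0 : cderiv cexp 0 1%C.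
Proof.
  intros eps Heps.
  (* The fractions of eps below add up to 7/8; the minimum with 1 provides the crude bound |exp a -
     1| <= 2 |a| used in the mixed terms. *)
  destruct (is_derive_eps exp 0 1 ltac:(auto_derive; [auto|rewrite exp_0; ring]) (Rmin 1 (eps / 8)) ltac:(apply Rmin_pos; lra)) as [d1 [Hd1 H1]].
  destruct (is_derive_eps cos 0 0 ltac:(auto_derive; [auto|rewrite sin_0; ring]) (eps / 16) ltac:(lra)) as [d2 [Hd2 H2]].
  destruct (is_derive_eps sin 0 1 ltac:(auto_derive; [auto|rewrite cos_0; ring]) (eps / 16) ltac:(lra)) as [d3 [Hd3 H3]].
  set (d := Rmin (Rmin d1 d2) (Rmin d3 (Rmin 1 (eps / 8)))).
  assert (E1 : d <= d1) by (eapply Rle_trans; [apply Rmin_l|apply Rmin_l]).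
  assert (E2 : d <= d2) by (eapply Rle_trans; [apply Rmin_l|apply Rmin_r]).
  assert (E3 : d <= d3) by (eapply Rle_trans; [apply Rmin_r|apply Rmin_l]).
  assert (E4 : d <= 1) by (eapply Rle_trans; [apply Rmin_r|]; eapply Rle_trans; [apply Rmin_r|apply Rmin_l]).
  assert (E5 : d <= eps / 8) by (eapply Rle_trans; [apply Rmin_r|]; eapply Rle_trans; [apply Rmin_r|apply Rmin_r]).
  assert (Hd : 0 < d) by (repeat apply Rmin_pos; lra).
  exists d; split; auto. intros w Hw. replace (w - 0)%C with w in * by ring.
  rewrite cexp_0. destruct w as [a b].
  pose proof (re_le_Cmod (a, b)) as Ha. pose proof (im_le_Cmod (a, b)) as Hb. cbn in Ha, Hb.
  set (m := Cmod (a, b)) in *.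
  specialize (H1 a ltac:(lra)). specialize (H2 b ltac:(lra)). specialize (H3 b ltac:(lra)).
  rewrite Rplus_0_l in *. rewrite exp_0 in H1. rewrite cos_0 in H2. rewrite sin_0 in H3.
  assert (K1 : Rabs (exp a - 1 - 1 * a) <= eps / 8 * Rabs a).
  { eapply Rle_trans; [exact H1|]. apply Rmult_le_compat_r; [apply Rabs_pos|apply Rmin_r]. }
  assert (K2 : Rabs (exp a - 1) <= 2 * Rabs a).
  { replace (exp a - 1) with ((exp a - 1 - 1 * a) + a) by ring.
    eapply Rle_trans; [apply Rabs_triang|].
    assert (Rabs (exp a - 1 - 1 * a) <= 1 * Rabs a).
    { eapply Rle_trans; [exact H1|]. apply Rmult_le_compat_r; [apply Rabs_pos|apply Rmin_l]. }
    lra. }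
  assert (K3 : Rabs (exp a) <= 4).
  { replace (exp a) with ((exp a - 1) + 1) by ring.
    eapply Rle_trans; [apply Rabs_triang|]. rewrite Rabs_R1. lra. }
  pose proof (Rabs_pos a). pose proof (Rabs_pos b).
  eapply Rle_trans; [apply Cmod_le_abs|].
  replace (Re (cexp (a, b) - 1 - 1 * (a, b))) with ((exp a - 1 - 1 * a) + exp a * (cos b - 1 - 0 * b))
    by (cbn; ring).
  replace (Im (cexp (a, b) - 1 - 1 * (a, b))) with (exp a * (sin b - 0 - 1 * b) + (exp a - 1) * b)
    by (cbn; ring).
  assert (T1 : Rabs (exp a - 1 - 1 * a + exp a * (cos b - 1 - 0 * b)) <= eps / 8 * m + 4 * (eps / 16 * m)).
  { eapply Rle_trans; [apply Rabs_triang|]. apply Rplus_le_compat.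
    - eapply Rle_trans; [exact K1|]. apply Rmult_le_compat_l; lra.
    - rewrite Rabs_mult. apply Rmult_le_compat; auto using Rabs_pos.
      eapply Rle_trans; [exact H2|]. apply Rmult_le_compat_l; lra. }
  assert (T2 : Rabs (exp a * (sin b - 0 - 1 * b) + (exp a - 1) * b) <= 4 * (eps / 16 * m) + 2 * (eps / 8) * m).
  { eapply Rle_trans; [apply Rabs_triang|]. rewrite !Rabs_mult. apply Rplus_le_compat.
    - apply Rmult_le_compat; auto using Rabs_pos.
      eapply Rle_trans; [exact H3|]. apply Rmult_le_compat_l; lra.
    - apply Rmult_le_compat; auto using Rabs_pos. lra. }
  assert (0 <= eps * m) by (apply Rmult_le_pos; [lra|apply Cmod_ge_0]). lra.
Qed.

Lemma cderiv_cexp (z : C) : cderiv cexp z (cexp z).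
Proof.
  apply cderiv_near_ext with (fun w => cexp z * cexp (w - z))%C.
  - apply near_True. intros w. rewrite <- cexp_plus. f_equal. ring.
  - assert (H1 : cderiv (fun w => w - z)%C z (1 + 0)%C) by (apply cderiv_plus; [apply cderiv_id|apply cderiv_const]).
    assert (H2 : cderiv (fun w => cexp (w - z)) z (1 * (1 + 0))%C).
    { apply (cderiv_comp cexp (fun w => w - z)%C); auto.
      replace (z - z)%C with (RtoC 0) by ring. apply cderiv_cexp_0. }
    pose proof (cderiv_mult _ _ _ _ _ (cderiv_const (cexp z) z) H2) as H3. cbv beta in H3.
    replace (0 * cexp (z - z) + cexp z * (1 * (1 + 0)))%C with (cexp z) in H3 by ring. exact H3.
Qed.

Lemma cpow_cexp (a : R) (z : C) : cpow a z = cexp (z * RtoC (ln a)).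
Proof. unfold cpow, cexp. rewrite re_scal_r, im_scal_r. reflexivity. Qed.

Lemma cderiv_cpow (a : R) (z : C) : cderiv (cpow a) z (cpow a z * RtoC (ln a))%C.
Proof.
  apply cderiv_near_ext with (fun w => cexp (w * RtoC (ln a))).
  - apply near_True. intros w. symmetry. apply cpow_cexp.
  - rewrite cpow_cexp. apply (cderiv_comp cexp (fun w => w * RtoC (ln a))%C); [|apply cderiv_cexp].
    pose proof (cderiv_mult _ _ _ _ _ (cderiv_id z) (cderiv_const (RtoC (ln a)) z)) as H. cbv beta in H.
    replace (1 * RtoC (ln a) + z * 0)%C with (RtoC (ln a)) in H by ring. exact H.
Qed.

Lemma cdiff_cpow (a : R) (f : C -> C) (z : C) : cdiff f z -> cdiff (fun w => cpow a (f w)) z.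
Proof. intros H. apply (cdiff_comp (cpow a) f); auto. eexists; apply cderiv_cpow. Qed.

Lemma cpow_plus (a : R) (z w : C) : cpow a (z + w) = (cpow a z * cpow a w)%C.
Proof. rewrite !cpow_cexp, <- cexp_plus. f_equal. ring. Qed.

Lemma cpow_0 (a : R) : cpow a 0 = 1%C.
Proof. rewrite cpow_cexp, <- cexp_0. f_equal. ring. Qed.

Lemma Cmod_cpow (a : R) (z : C) : Cmod (cpow a z) = exp (Re z * ln a).
Proof. rewrite cpow_cexp, Cmod_cexp, re_scal_r. reflexivity. Qed.

Lemma cpow_neq_0 (a : R) (z : C) : cpow a z <> 0%C.
Proof. apply Cmod_gt_0. rewrite Cmod_cpow. apply exp_pos. Qed.

Lemma cpow_opp (a : R) (z : C) : cpow a (- z) = (/ cpow a z)%C.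
Proof.
  pose proof (cpow_neq_0 a z) as H.
  assert (E : (cpow a (- z) * cpow a z)%C = 1%C).
  { rewrite <- cpow_plus, <- (cpow_0 a). f_equal. ring. }
  replace (cpow a (- z)) with (cpow a (- z) * cpow a z * / cpow a z)%C by (field; auto).
  rewrite E. ring.
Qed.

Lemma cpow_mult (a b : R) (z : C) : 0 < a -> 0 < b -> cpow (a * b) z = (cpow a z * cpow b z)%C.
Proof.
  intros Ha Hb. rewrite !cpow_cexp, <- cexp_plus, ln_mult by auto. f_equal.
  rewrite RtoC_plus. ring.
Qed.

Lemma cpow_1 (a : R) : 0 < a -> cpow a 1 = RtoC a.
Proof.
  intros Ha. unfold cpow. cbn. rewrite Rmult_1_l, exp_ln, Rmult_0_l, cos_0, sin_0 by auto.
  apply C_ext; cbn; ring.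
Qed.

Lemma cpow_base_1 (z : C) : cpow 1 z = 1%C.
Proof. rewrite cpow_cexp, ln_1, <- cexp_0. f_equal. ring. Qed.

Lemma cpow_nat (a : R) (n : nat) : 0 < a -> cpow a (RtoC (INR n)) = RtoC (a ^ n).
Proof.
  intros Ha. induction n.
  - cbn. apply cpow_0.
  - rewrite S_INR, RtoC_plus, cpow_plus, IHn, cpow_1 by auto. cbn [pow]. rewrite RtoC_mult. ring.
Qed.

Lemma rderiv_cpow (z : C) (v : R) : 0 < v -> rderiv (fun u => cpow u z) v (z * cpow v (z - 1))%C.
Proof.
  intros Hv.
  apply rderiv_eq with (z * RtoC (/ v) * cpow v z)%C.
  - unfold Cminus. rewrite cpow_plus, cpow_opp, cpow_1, RtoC_inv by lra. ring.
  - destruct z as [p q]. unfold cpow. split; cbn; auto_derive; auto; field; lra.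
Qed.

Lemma exp_le_mono (x y : R) : x <= y -> exp x <= exp y.
Proof. intros [H| ->]; [left; apply exp_increasing, H|right; reflexivity]. Qed.

(** * Euler-Maclaurin summation *)

(* [em_coef j] is the Taylor coefficient of [- z / (exp z - 1)] at order [j], that is [- B_j / j!];
   the table makes the full-history recursion structural. *)
Fixpoint em_table (n : nat) (i : nat) : R :=
  match n with
  | O => -1
  | S m => if Nat.leb i m then em_table m i
           else - rsum (fun k => em_table m k / INR (fact (S (S m) - k))) (S m)
  end.

Definition em_coef (n : nat) : R := em_table n n.

Lemma em_table_coef (n i : nat) : (i <= n)%nat -> em_table n i = em_coef i.
Proof.
  intros H. induction n.
  - replace i with 0%nat by lia. reflexivity.
  - destruct (Nat.eq_dec i (S n)) as [->|Hn]; [reflexivity|].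
    cbn [em_table]. replace (Nat.leb i n) with true by (symmetry; apply Nat.leb_le; lia).
    apply IHn. lia.
Qed.

Lemma rsum_ext (a b : nat -> R) (n : nat) : (forall k, (k < n)%nat -> a k = b k) -> rsum a n = rsum b n.
Proof. induction n; intros H; cbn; auto. rewrite IHn, H by auto. reflexivity. Qed.

Lemma em_coef_0 : em_coef 0 = - (1).
Proof. unfold em_coef; cbn [em_table]. lra. Qed.

(** This is the vanishing of the coefficient of order j + 1 in the product of - z / (exp z - 1) with
    (exp z - 1) / z, which is the constant - 1. *)
Lemma em_coef_S (j : nat) :
  em_coef (S j) = - rsum (fun k => em_coef k / INR (fact (S (S j) - k))) (S j).
Proof.
  unfold em_coef at 1. cbn [em_table].
  replace (Nat.leb (S j) j) with false by (symmetry; apply Nat.leb_gt; lia).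
  f_equal. apply rsum_ext. intros k Hk. rewrite em_table_coef by lia. reflexivity.
Qed.

Definition taylor_term (c : nat -> C) (h : R) (k : nat) : C := (c k * RtoC (h ^ k / INR (fact k)))%C.

Lemma taylor_term_deriv (c : nat -> C) (h : R) (k : nat) :
  rderiv (fun t => taylor_term c t (S k)) h (taylor_term (fun i => c (S i)) h k).
Proof.
  unfold taylor_term. apply rderiv_scal. split; cbn [Re Im RtoC fst snd].
  - auto_derive; auto.
    change (match k with 0%nat => 1 | S _ => INR k + 1 end) with (INR (S k)).
    change (fact k + k * fact k)%nat with (S k * fact k)%nat. rewrite mult_INR.
    field. split; [apply INR_fact_neq_0|apply not_0_INR; discriminate].
  - apply (is_derive_const (K := R_AbsRing) (V := R_NormedModule)).
Qed.

Lemma taylor_sum_deriv (c : nat -> C) (h : R) (n : nat) :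
  rderiv (fun t => psum (taylor_term c t) (S n)) h (psum (taylor_term (fun i => c (S i)) h) n).
Proof.
  induction n.
  - cbn [psum]. apply rderiv_ext with (fun _ => 0 + c 0%nat)%C.
    + intros t. unfold taylor_term. cbn. rewrite Rdiv_1_r. ring.
    + apply rderiv_const.
  - change (rderiv (fun t => (psum (taylor_term c t) (S n) + taylor_term c t (S n))%C) h
      (psum (taylor_term (fun i => c (S i)) h) n + taylor_term (fun i => c (S i)) h n)%C).
    apply rderiv_plus; [exact IHn|apply taylor_term_deriv].
Qed.

Lemma taylor_sum_0 (c : nat -> C) (n : nat) : psum (taylor_term c 0) (S n) = c 0%nat.
Proof.
  induction n.
  - cbn. unfold taylor_term. cbn. rewrite Rdiv_1_r. ring.
  - change (psum (taylor_term c 0) (S (S n))) with (psum (taylor_term c 0) (S n) + taylor_term c 0 (S n))%C.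
    rewrite IHn. unfold taylor_term. rewrite pow_i by lia. unfold Rdiv. rewrite Rmult_0_l. ring.
Qed.

(** Here [phi] is a chain of successive derivatives. Differentiating the remainder in h gives the
    remainder of one order less for the shifted chain; integrating back over a length at most 1
    costs the factor 2 of [rderiv_lip], whence 2^n. *)
Lemma taylor_real (n : nat) : forall (phi : nat -> R -> C) (v B : R),
  (forall i u, v <= u <= v + 1 -> rderiv (phi i) u (phi (S i) u)) ->
  (forall u, v <= u <= v + 1 -> Cmod (phi n u) <= B) ->
  forall h, 0 <= h <= 1 ->
  Cmod (phi 0%nat (v + h)%R - psum (taylor_term (fun k => phi k v) h) n) <= 2 ^ n * B.
Proof.
  induction n; intros phi v B Hd HB h Hh.
  - cbn [psum pow]. replace (phi 0%nat (v + h)%R - 0)%C with (phi 0%nat (v + h)%R) by ring.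
    rewrite Rmult_1_l. apply HB. lra.
  - set (R := fun t => (phi 0%nat (v + t)%R + - (1) * psum (taylor_term (fun k => phi k v) t) (S n))%C).
    set (R' := fun t => (phi 1%nat (v + t)%R + - (1) * psum (taylor_term (fun k => phi (S k) v) t) n)%C).
    assert (HB0 : 0 <= B) by (eapply Rle_trans; [apply Cmod_ge_0|apply (HB v); lra]).
    assert (Hsh : forall i t, 0 <= t <= 1 -> rderiv (fun s => phi i (v + s)%R) t (phi (S i) (v + t)%R)).
    { intros i t Ht. destruct (Hd i (v + t)%R ltac:(lra)) as [H1 H2].
      assert (Hs : is_derive (fun s => v + s) t 1) by (auto_derive; auto).
      split.
      - pose proof (is_derive_comp (fun s => Re (phi i s)) (fun s => v + s) t _ _ H1 Hs) as H3.
        cbn in H3. unfold scal in H3; cbn in H3; unfold mult in H3; cbn in H3.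
        rewrite Rmult_1_l in H3. exact H3.
      - pose proof (is_derive_comp (fun s => Im (phi i s)) (fun s => v + s) t _ _ H2 Hs) as H3.
        cbn in H3. unfold scal in H3; cbn in H3; unfold mult in H3; cbn in H3.
        rewrite Rmult_1_l in H3. exact H3. }
    assert (HR : forall t, 0 <= t <= 1 -> rderiv R t (R' t)).
    { intros t Ht. apply rderiv_plus; [apply Hsh, Ht|]. apply rderiv_scal, taylor_sum_deriv. }
    assert (HR' : rcont_on R' 0 h).
    { intros t Ht. apply rcont_plus.
      - eapply rderiv_rcont, (Hsh 1%nat). lra.
      - apply rcont_mult; [apply rcont_const|].
        destruct n; [apply rcont_const|]. eapply rderiv_rcont, taylor_sum_deriv. }
    assert (Hb : forall t, 0 <= t <= h -> Cmod (R' t) <= 2 ^ n * B).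
    { intros t Ht. unfold R'.
      replace (phi 1%nat (v + t)%R + - (1) * psum (taylor_term (fun k => phi (S k) v) t) n)%C
        with (phi 1%nat (v + t)%R - psum (taylor_term (fun k => phi (S k) v) t) n)%C by ring.
      apply (IHn (fun i => phi (S i))); auto. lra. }
    pose proof (rderiv_lip R R' 0 h (2 ^ n * B) ltac:(lra) (fun t Ht => HR t ltac:(lra)) HR' Hb) as L.
    assert (E0 : R 0 = 0%C).
    { unfold R. rewrite taylor_sum_0, Rplus_0_r. ring. }
    rewrite E0 in L.
    replace (R h - 0)%C with (phi 0%nat (v + h)%R - psum (taylor_term (fun k => phi k v) h) (S n))%C in L
      by (unfold R; ring).
    eapply Rle_trans; [exact L|]. cbn [pow].
    assert (0 <= 2 ^ n * B) by (apply Rmult_le_pos; auto; apply pow_le; lra). nra.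
Qed.

(* The recursion for [em_coef] cancels all derivatives of orders 2 to [J + 1]. *)
Lemma em_cancel (c : nat -> C) (J : nat) :
  psum (fun i => RtoC (em_coef i) * (psum (taylor_term (fun k => c (i + k)%nat) 1) (J + 2 - i) - c i))%C (S J)
  = (- c 1%nat)%C.
Proof.
  assert (T1 : forall (b : nat -> C) n, taylor_term b 1 n = (b n * RtoC (/ INR (fact n)))%C).
  { intros b n. unfold taylor_term. rewrite pow1. unfold Rdiv. rewrite Rmult_1_l. reflexivity. }
  induction J.
  - cbn [psum Nat.add Nat.sub]. rewrite !T1, em_coef_0. cbn [fact Nat.mul Nat.add INR].
    rewrite Rinv_1, RtoC_opp. ring.
  - change (psum ?a (S (S J))) with (psum a (S J) + a (S J))%C. cbv beta.
    (* Passing from J to J + 1 lengthens every Taylor polynomial by its term in c (J + 2). The new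
       terms together have the coefficient - [em_coef (S J)], which the summand of index S J
       compensates. *)
    assert (E : psum (fun i => RtoC (em_coef i) * (psum (taylor_term (fun k => c (i + k)%nat) 1) (S J + 2 - i) - c i))%C (S J)
      = (psum (fun i => RtoC (em_coef i) * (psum (taylor_term (fun k => c (i + k)%nat) 1) (J + 2 - i) - c i)) (S J)
         + c (J + 2)%nat * RtoC (rsum (fun k => em_coef k / INR (fact (S (S J) - k)))%R (S J)))%C).
    { assert (G : forall n, (n <= S J)%nat ->
        psum (fun i => RtoC (em_coef i) * (psum (taylor_term (fun k => c (i + k)%nat) 1) (S J + 2 - i) - c i))%C n
      = (psum (fun i => RtoC (em_coef i) * (psum (taylor_term (fun k => c (i + k)%nat) 1) (J + 2 - i) - c i)) n
         + c (J + 2)%nat * RtoC (rsum (fun k => em_coef k / INR (fact (S (S J) - k)))%R n))%C).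
      { induction n; intros Hn; [cbn; ring|]. cbn [psum rsum]. rewrite IHn by lia.
        replace (S J + 2 - n)%nat with (S (J + 2 - n)) by lia. cbn [psum]. rewrite T1.
        replace (n + (J + 2 - n))%nat with (J + 2)%nat by lia.
        replace (S (S J) - n)%nat with (J + 2 - n)%nat by lia.
        unfold Rdiv. rewrite RtoC_plus, RtoC_mult. ring. }
      apply G. lia. }
    rewrite E, IHJ. replace (S J + 2 - S J)%nat with 2%nat by lia. cbn [psum]. rewrite !T1.
    rewrite em_coef_S. replace (S J + 0)%nat with (S J) by lia. replace (S J + 1)%nat with (J + 2)%nat by lia.
    cbn [fact Nat.mul Nat.add INR]. rewrite Rinv_1, RtoC_opp. ring.
Qed.

Definition em_const (J : nat) : R := rsum (fun i => Rabs (em_coef i) * 2 ^ (J + 2 - i)) (S J).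

(** One step of Euler-Maclaurin: [phi 1] is the summand, [phi 0] its primitive. Once the Taylor
    polynomials cancel by [em_cancel], only the Taylor remainders of [phi i] at v + 1 are left, all
    governed by the derivative of order J + 2. *)
Lemma em_remainder (J : nat) (phi : nat -> R -> C) (v B : R) :
  (forall i u, v <= u <= v + 1 -> rderiv (phi i) u (phi (S i) u)) ->
  (forall u, v <= u <= v + 1 -> Cmod (phi (J + 2)%nat u) <= B) ->
  Cmod (phi 1%nat v - psum (fun i => RtoC (em_coef i) * phi i v)%C (S J)
        + psum (fun i => RtoC (em_coef i) * phi i (v + 1)%R)%C (S J)) <= em_const J * B.
Proof.
  intros Hd HB.
  set (r := fun i => (phi i (v + 1)%R - psum (taylor_term (fun k => phi (i + k)%nat v) 1) (J + 2 - i))%C).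
  assert (Hr : forall i, (i < S J)%nat -> Cmod (r i) <= 2 ^ (J + 2 - i) * B).
  { intros i Hi. unfold r. replace (phi i (v + 1)%R) with (phi (i + 0)%nat (v + 1)%R) by (f_equal; lia).
    apply (taylor_real (J + 2 - i) (fun k => phi (i + k)%nat)); [| |lra].
    - intros k u Hu. replace (i + S k)%nat with (S (i + k)) by lia. apply Hd, Hu.
    - intros u Hu. replace (i + (J + 2 - i))%nat with (J + 2)%nat by lia. apply HB, Hu. }
  pose proof (em_cancel (fun i => phi i v) J) as HC.
  assert (E : (phi 1%nat v - psum (fun i => RtoC (em_coef i) * phi i v) (S J)
        + psum (fun i => RtoC (em_coef i) * phi i (v + 1)%R) (S J))%C
     = psum (fun i => RtoC (em_coef i) * r i)%C (S J)).
  { replace (phi 1%nat v) with (- (- phi 1%nat v))%C by ring. cbv beta in HC. rewrite <- HC.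
    clear. unfold r. generalize (S J) as n. intros n. induction n; cbn [psum]; [ring|].
    match goal with |- (?x - ?y + ?z = _)%C => replace (x - y + z)%C with (x + - y + z)%C by ring end.
    rewrite <- IHn. ring. }
  rewrite E. unfold em_const. clear E HC.
  assert (G : forall n, (n <= S J)%nat -> Cmod (psum (fun i => RtoC (em_coef i) * r i)%C n)
     <= rsum (fun i => Rabs (em_coef i) * 2 ^ (J + 2 - i)) n * B).
  { induction n; intros Hn; cbn [psum rsum]; [rewrite Cmod_0; lra|].
    eapply Rle_trans; [apply Cmod_triangle|]. rewrite Cmod_mult, Cmod_R, Rmult_plus_distr_r.
    apply Rplus_le_compat; [apply IHn; lia|]. rewrite Rmult_assoc.
    apply Rmult_le_compat_l; [apply Rabs_pos|apply Hr; lia]. }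
  apply G. lia.
Qed.

Fixpoint falling (z : C) (n : nat) : C :=
  match n with O => RtoC 1 | S m => (falling z m * (z - RtoC (INR m)))%C end.

Lemma cdiff_falling (f : C -> C) (n : nat) (z : C) : cdiff f z -> cdiff (fun w => falling (f w) n) z.
Proof.
  intros H. induction n; cbn [falling]; [apply cdiff_const|].
  apply cdiff_mult; auto. apply cdiff_minus; auto using cdiff_const.
Qed.

Lemma falling_nat_zero (N n : nat) : (N < n)%nat -> falling (RtoC (INR N)) n = 0%C.
Proof.
  induction n; intros H; [lia|]. cbn [falling]. destruct (Nat.eq_dec N n) as [->|Hn].
  - ring.
  - rewrite IHn by lia. ring.
Qed.

(** The i-th derivative of v^(1 - t) in v. Starting from this power, and not from its quotient by 1
    - t, avoids a singularity at t = 1; the price is the factor 1 - t in front of v^(- t). *)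
Definition pow_deriv (t : C) (i : nat) (v : R) : C := (falling (1 - t) i * cpow v (1 - t - RtoC (INR i)))%C.

Lemma rderiv_pow_deriv (t : C) (i : nat) (v : R) : 0 < v -> rderiv (pow_deriv t i) v (pow_deriv t (S i) v).
Proof.
  intros Hv. unfold pow_deriv. eapply rderiv_eq; [|apply rderiv_scal, rderiv_cpow, Hv].
  cbn [falling]. rewrite S_INR, RtoC_plus.
  replace (1 - t - (RtoC (INR i) + 1))%C with (1 - t - RtoC (INR i) - 1)%C by ring. ring.
Qed.

Lemma pow_deriv_1 (t : C) (v : R) : pow_deriv t 1 v = ((1 - t) * cpow v (- t))%C.
Proof.
  unfold pow_deriv. cbn [falling INR]. replace (1 - t - 1)%C with (- t)%C by ring. ring.
Qed.

Lemma cdiff_pow_deriv (i : nat) (v : R) (t : C) : cdiff (fun z => pow_deriv z i v) t.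
Proof.
  unfold pow_deriv. apply cdiff_mult.
  - apply (cdiff_falling (fun z => 1 - z)%C), cdiff_minus; [apply cdiff_const|apply cdiff_id].
  - apply (cdiff_cpow v (fun z => 1 - z - RtoC (INR i))%C).
    apply cdiff_minus; [apply cdiff_minus|]; auto using cdiff_const, cdiff_id.
Qed.

(** * Moduli of powers and summable majorants *)

Definition rpow (a s : R) : R := exp (s * ln a).

Lemma rpow_pos (a s : R) : 0 < rpow a s.
Proof. apply exp_pos. Qed.

Lemma rpow_plus (a s u : R) : rpow a (s + u) = rpow a s * rpow a u.
Proof. unfold rpow. rewrite <- exp_plus. f_equal. ring. Qed.

Lemma rpow_mult (a b s : R) : 0 < a -> 0 < b -> rpow (a * b) s = rpow a s * rpow b s.
Proof. intros. unfold rpow. rewrite ln_mult, <- exp_plus by auto. f_equal. ring. Qed.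

Lemma rpow_antitone (a b s : R) : 0 < a -> a <= b -> 0 <= s -> rpow b (- s) <= rpow a (- s).
Proof.
  intros Ha Hab Hs. apply exp_le_mono.
  assert (ln a <= ln b). { destruct Hab as [H| ->]; [left; apply ln_increasing; auto|lra]. }
  nra.
Qed.

Lemma rpow_exp_mono (a s u : R) : 1 <= a -> s <= u -> rpow a s <= rpow a u.
Proof.
  intros Ha Hs. apply exp_le_mono.
  assert (0 <= ln a). { rewrite <- ln_1. destruct Ha as [H| <-]; [left; apply ln_increasing; lra|lra]. }
  nra.
Qed.

Lemma rpow_opp2 (a : R) : 0 < a -> rpow a (- (2)) = / (a * a).
Proof.
  intros Ha. unfold rpow. replace (- (2) * ln a) with (- (ln a + ln a)) by ring.
  rewrite exp_Ropp, exp_plus, exp_ln by auto. reflexivity.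
Qed.

Lemma Cmod_cpow_rpow (a : R) (z : C) : Cmod (cpow a z) = rpow a (Re z).
Proof. apply Cmod_cpow. Qed.

Lemma rsum_inv_sq_bound (n : nat) : rsum (fun k => / (INR (S k) * INR (S k))) (S n) <= 2 - / INR (S n).
Proof.
  induction n.
  - cbn. lra.
  - change (rsum ?b (S (S n))) with (rsum b (S n) + b (S n)). cbv beta.
    assert (H : 0 < INR (S n)) by (apply lt_0_INR; lia).
    rewrite (S_INR (S n)). set (y := INR (S n)) in *.
    assert (E : / ((y + 1) * (y + 1)) <= / y - / (y + 1)).
    { apply Rle_trans with (/ (y * (y + 1))).
      - apply Rinv_le_contravar; nra.
      - right. field. lra. }
    lra.
Qed.

Lemma rser_monotone_ex (b : nat -> R) (K : R) : (forall n, 0 <= b n) -> (forall n, rsum b n <= K) ->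
  exists S, rser b S.
Proof.
  intros H0 HK.
  destruct (ex_finite_lim_seq_incr (rsum b) K) as [S HS]; auto.
  { intros n. cbn. specialize (H0 n). lra. }
  exists S. intros eps Heps. apply is_lim_seq_spec in HS.
  destruct (HS (mkposreal eps Heps)) as [N HN]. exists N. intros n Hn. left. apply HN, Hn.
Qed.

Lemma rser_inv_sq (x : R) : 0 < x -> exists S, rser (fun n => / ((x + INR n) * (x + INR n))) S.
Proof.
  (* With this c, x + n is at least c (n + 1), which reduces the series to the sum of inverse
     squares of positive integers. *)
  intros Hx. set (c := Rmin 1 x). assert (Hc : 0 < c) by (apply Rmin_pos; lra).
  assert (Hc1 : c <= 1) by apply Rmin_l. assert (Hc2 : c <= x) by apply Rmin_r.
  assert (Hp : forall n, 0 < INR (S n)) by (intros; apply lt_0_INR; lia).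
  apply (rser_monotone_ex _ (/ (c * c) * 2)).
  - intros n. pose proof (pos_INR n). left. apply Rinv_0_lt_compat. nra.
  - intros n. apply Rle_trans with (/ (c * c) * rsum (fun k => / (INR (S k) * INR (S k))) n).
    + replace (/ (c * c) * rsum (fun k => / (INR (S k) * INR (S k))) n)
        with (rsum (fun k => / (c * c) * / (INR (S k) * INR (S k))) n).
      * apply rsum_le. intros k. pose proof (pos_INR k). specialize (Hp k).
        rewrite <- Rinv_mult.
        assert (Hcc : 0 < c * INR (S k)) by (apply Rmult_lt_0_compat; auto).
        assert (c * INR (S k) <= x + INR k) by (rewrite S_INR; nra).
        apply Rinv_le_contravar; [|nra].
        replace (c * c * (INR (S k) * INR (S k))) with ((c * INR (S k)) * (c * INR (S k))) by ring. nra.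
      * clear. induction n; cbn [rsum]; [ring|rewrite IHn; ring].
    + apply Rmult_le_compat_l; [left; apply Rinv_0_lt_compat; nra|].
      destruct n; [cbn; lra|]. pose proof (rsum_inv_sq_bound n).
      assert (0 < / INR (S n)) by (apply Rinv_0_lt_compat; auto). lra.
Qed.

Definition em_sum (J : nat) (t : C) (v : R) : C := psum (fun i => RtoC (em_coef i) * pow_deriv t i v)%C (S J).

(* [(1 - t)] times the Euler-Maclaurin error for [v^(-t)] on [[v, v + 1]]; the factor makes it
   entire in [t], including at [t = 1]. *)
Definition em_rem (J : nat) (t : C) (v : R) : C :=
  (pow_deriv t 1 v - em_sum J t v + em_sum J t (v + 1))%C.

(** The factor [falling (1 - t) (J + 2)] is kept in the bound because it is zero at t = - N for N <=
    J: the remainder vanishes there without any further computation. *)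
Lemma em_rem_bound (J : nat) (t : C) (v : R) : 0 < v -> 0 <= Re t + INR J + 1 ->
  Cmod (em_rem J t v) <= em_const J * (Cmod (falling (1 - t) (J + 2)) * rpow v (- (Re t + INR J + 1))).
Proof.
  intros Hv Ht. apply (em_remainder J (pow_deriv t)).
  - intros i u Hu. apply rderiv_pow_deriv. lra.
  - intros u Hu. unfold pow_deriv. rewrite Cmod_mult, Cmod_cpow_rpow.
    apply Rmult_le_compat_l; [apply Cmod_ge_0|].
    replace (Re (1 - t - RtoC (INR (J + 2)))) with (- (Re t + INR J + 1)).
    + apply rpow_antitone; lra.
    + rewrite plus_INR. unfold Cminus. rewrite !re_plus, !re_opp. cbn. ring.
Qed.

Lemma em_const_pos (J : nat) : 0 <= em_const J.
Proof.
  unfold em_const. generalize (S J) at 1 as n.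
  induction n; cbn [rsum]; [lra|].
  assert (0 <= Rabs (em_coef n) * 2 ^ (J + 2 - n)); [|lra].
  apply Rmult_le_pos; [apply Rabs_pos|apply pow_le; lra].
Qed.

(** The exponent is split: two powers make the sum over n converge, with a majorant depending only
    on the lower bound x of a, and the others give a decay in a that will serve the sum over m. *)
Lemma em_rem_sum_bound (J : nat) (t : C) (x a : R) (n : nat) : 0 < x <= a -> 1 <= Re t + INR J ->
  Cmod (em_rem J t (a + INR n)) <=
  em_const J * Cmod (falling (1 - t) (J + 2)) * rpow a (- (Re t + INR J - 1)) * / ((x + INR n) * (x + INR n)).
Proof.
  intros Hx Ht. pose proof (pos_INR n).
  eapply Rle_trans; [apply em_rem_bound; lra|]. rewrite !Rmult_assoc.
  apply Rmult_le_compat_l; [apply em_const_pos|]. apply Rmult_le_compat_l; [apply Cmod_ge_0|].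
  replace (- (Re t + INR J + 1)) with (- (Re t + INR J - 1) + - (2)) by ring.
  rewrite rpow_plus. apply Rmult_le_compat; try (left; apply rpow_pos).
  - apply rpow_antitone; lra.
  - rewrite rpow_opp2 by lra. apply Rinv_le_contravar; nra.
Qed.

Lemma cdiff_em_sum (J : nat) (v : R) (t : C) : cdiff (fun z => em_sum J z v) t.
Proof.
  unfold em_sum. generalize (S J) as n. induction n; cbn [psum]; [apply cdiff_const|].
  apply cdiff_plus; auto. apply cdiff_mult; [apply cdiff_const|apply cdiff_pow_deriv].
Qed.

Lemma cdiff_em_rem (J : nat) (v : R) (t : C) : cdiff (fun z => em_rem J z v) t.
Proof.
  unfold em_rem. apply cdiff_plus; [apply cdiff_minus|]; auto using cdiff_pow_deriv, cdiff_em_sum.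
Qed.

Lemma em_rem_nat_zero (J N : nat) (v : R) : (N <= J)%nat -> 0 < v -> em_rem J (- RtoC (INR N)) v = 0%C.
Proof.
  intros HN Hv. apply Cmod_eq_0, Rle_antisym; [|apply Cmod_ge_0].
  assert (E : Re (- RtoC (INR N)) = - INR N) by reflexivity.
  pose proof (le_INR _ _ HN).
  eapply Rle_trans; [apply em_rem_bound; [auto|rewrite E; lra]|].
  replace (1 - - RtoC (INR N))%C with (RtoC (INR (S N))) by (rewrite S_INR, RtoC_plus; ring).
  rewrite falling_nat_zero by lia. rewrite Cmod_0. lra.
Qed.

Definition em_tail (J : nat) (t : C) (a : R) : C := CSer (fun n => em_rem J t (a + INR n)).

Lemma em_tail_cser (J : nat) (t : C) (a : R) : 0 < a -> 1 <= Re t + INR J ->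
  cser (fun n => em_rem J t (a + INR n)) (em_tail J t a).
Proof.
  intros Ha Ht. destruct (rser_inv_sq a Ha) as [S HS].
  eapply CSer_correct; [|apply rser_scal, HS]. intros n.
  apply (em_rem_sum_bound J t a a n); auto. lra.
Qed.

Lemma em_tail_bound (J : nat) (t : C) (x a S : R) : 0 < x <= a -> 1 <= Re t + INR J ->
  rser (fun n => / ((x + INR n) * (x + INR n))) S ->
  Cmod (em_tail J t a) <= em_const J * Cmod (falling (1 - t) (J + 2)) * rpow a (- (Re t + INR J - 1)) * S.
Proof.
  intros Hx Ht HS. eapply cser_bound; [|apply em_tail_cser; auto; lra|apply rser_scal, HS].
  intros n. apply em_rem_sum_bound; auto.
Qed.

Lemma em_tail_nat_zero (J N : nat) (a : R) : (N < J)%nat -> 0 < a -> em_tail J (- RtoC (INR N)) a = 0%C.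
Proof.
  intros HN Ha. eapply cser_unique; [apply em_tail_cser; auto|].
  - change (1 <= - INR N + INR J). assert (H : INR (S N) <= INR J) by (apply le_INR; lia). rewrite S_INR in H. lra.
  - eapply cser_ext; [|apply cser_zero]. intros n. symmetry. apply em_rem_nat_zero; [lia|].
    pose proof (pos_INR n). lra.
Qed.

Lemma ccont_near_bounded (f : C -> C) (p : C) : cdiff f p -> exists K, 0 < K /\ near p (fun z => Cmod (f z) <= K).
Proof.
  intros H. exists (Cmod (f p) + 1). split; [pose proof (Cmod_ge_0 (f p)); lra|].
  apply ccont_bounded, cdiff_ccont, H.
Qed.

Lemma cdiff_falling_1_minus (n : nat) (t : C) : cdiff (fun z => falling (1 - z) n) t.
Proof. apply (cdiff_falling (fun z => 1 - z)%C), cdiff_minus; [apply cdiff_const|apply cdiff_id]. Qed.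

Lemma rpow_near_bounded (a c : R) (p : C) :
  exists K, 0 < K /\ near p (fun z => rpow a (- (Re z + c)) <= K).
Proof.
  destruct (ccont_near_bounded (fun z => cpow a (- (z + RtoC c)))%C p) as [K [HK H]].
  - apply (cdiff_cpow a (fun z => - (z + RtoC c))%C), cdiff_opp, cdiff_plus; [apply cdiff_id|apply cdiff_const].
  - exists K; split; auto. revert H. apply near_imp. intros z Hz. rewrite Cmod_cpow_rpow in Hz. exact Hz.
Qed.

(** Stated apart from [em_tail_hol] because [zeta_pole] also needs the derivative of the tail as a
    series. *)
Lemma em_tail_weierstrass (J : nat) (p : C) (a : R) : 0 < a -> 1 < Re p + INR J ->
  exists M S, rser M S /\
    near p (fun z => forall n, cdiff (fun z => em_rem J z (a + INR n)) z /\ Cmod (em_rem J z (a + INR n)) <= M n) /\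
    near p (fun z => cser (fun n => em_rem J z (a + INR n)) (em_tail J z a)).
Proof.
  intros Ha Hp.
  destruct (ccont_near_bounded _ _ (cdiff_falling_1_minus (J + 2) p)) as [K1 [HK1 H1]].
  destruct (rpow_near_bounded a (INR J - 1) p) as [K2 [HK2 H2]].
  assert (H3 : near p (fun z => 1 - INR J < Re z)) by (apply near_Re_gt; lra).
  destruct (rser_inv_sq a Ha) as [S HS].
  exists (fun n => em_const J * K1 * K2 * / ((a + INR n) * (a + INR n))), (em_const J * K1 * K2 * S).
  split; [apply rser_scal, HS|]. split.
  - generalize (near_and _ _ _ H3 (near_and _ _ _ H1 H2)). apply near_imp.
    intros z [Hz [Hz1 Hz2]] n. split; [apply cdiff_em_rem|].
    eapply Rle_trans; [apply (em_rem_sum_bound J z a a n); lra|].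
    pose proof (pos_INR n). pose proof (em_const_pos J).
    apply Rmult_le_compat_r; [left; apply Rinv_0_lt_compat; nra|].
    apply Rmult_le_compat; [apply Rmult_le_pos; auto using Cmod_ge_0|left; apply rpow_pos| |].
    + apply Rmult_le_compat_l; auto.
    + replace (Re z + INR J - 1) with (Re z + (INR J - 1)) by ring. exact Hz2.
  - generalize H3. apply near_imp. intros z Hz. apply em_tail_cser; auto. lra.
Qed.

Lemma em_tail_hol (J : nat) (p : C) (a : R) : 0 < a -> 1 < Re p + INR J -> hol (fun z => em_tail J z a) p.
Proof.
  intros Ha Hp. destruct (em_tail_weierstrass J p a Ha Hp) as (M & S & HS & H1 & H2).
  apply (weierstrass (fun n z => em_rem J z (a + INR n)) _ p M S); auto.
Qed.

Definition em_double_tail (J : nat) (x : R) (s t : C) : C :=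
  CSer (fun m => cpow (INR (S m)) (- s) * em_tail J t (INR (S m) * x))%C.

Lemma rser_ge0 (b : nat -> R) (v : R) : (forall n, 0 <= b n) -> rser b v -> 0 <= v.
Proof.
  intros Hb Hv. apply Rle_plus_epsilon. intros e He. destruct (Hv e He) as [N HN].
  specialize (HN N (le_n _)). apply Rabs_le_between in HN.
  assert (H : 0 <= rsum b N); [|lra].
  clear HN. induction N; cbn [rsum]; [lra|]. specialize (Hb N). lra.
Qed.

(** At a = m x the tail decays like m to the power - (t + J - 1); against m^(- s) this is at most
    m^(- 2) exactly when Re s + Re t + J >= 3. *)
Lemma em_double_tail_term_bound (J : nat) (x S : R) (s t : C) (m : nat) : 0 < x -> 1 <= Re t + INR J ->
  3 <= Re s + Re t + INR J -> rser (fun n => / ((x + INR n) * (x + INR n))) S ->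
  Cmod (cpow (INR (Datatypes.S m)) (- s) * em_tail J t (INR (Datatypes.S m) * x))
  <= em_const J * Cmod (falling (1 - t) (J + 2)) * rpow x (- (Re t + INR J - 1)) * S * / ((1 + INR m) * (1 + INR m)).
Proof.
  intros Hx Ht Hst HS. pose proof (pos_INR m). rewrite S_INR, (Rplus_comm _ 1).
  set (y := 1 + INR m) in *. assert (Hy : 1 <= y) by (unfold y; lra).
  assert (HS0 : 0 <= S).
  { eapply rser_ge0; [|exact HS]. intros n. pose proof (pos_INR n).
    left. apply Rinv_0_lt_compat. nra. }
  rewrite Cmod_mult, Cmod_cpow_rpow, re_opp.
  eapply Rle_trans.
  - apply Rmult_le_compat_l; [left; apply rpow_pos|].
    apply (em_tail_bound J t x (y * x) S); auto. split; auto. nra.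
  - rewrite rpow_mult by lra.
    replace (rpow y (- Re s) * (em_const J * Cmod (falling (1 - t) (J + 2)) * (rpow y (- (Re t + INR J - 1)) * rpow x (- (Re t + INR J - 1))) * S))
      with (em_const J * Cmod (falling (1 - t) (J + 2)) * rpow x (- (Re t + INR J - 1)) * S * (rpow y (- Re s) * rpow y (- (Re t + INR J - 1)))) by ring.
    apply Rmult_le_compat_l.
    + repeat apply Rmult_le_pos; auto using em_const_pos, Cmod_ge_0. left; apply rpow_pos.
    + rewrite <- rpow_plus, <- rpow_opp2 by lra. apply rpow_exp_mono; lra.
Qed.

Lemma em_double_tail_cser (J : nat) (x : R) (s t : C) : 0 < x -> 1 <= Re t + INR J ->
  3 <= Re s + Re t + INR J ->
  cser (fun m => cpow (INR (S m)) (- s) * em_tail J t (INR (S m) * x))%C (em_double_tail J x s t).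
Proof.
  intros Hx Ht Hst. destruct (rser_inv_sq x Hx) as [A HA]. destruct (rser_inv_sq 1 Rlt_0_1) as [B HB].
  eapply CSer_correct; [|apply rser_scal, HB]. intros m.
  apply (em_double_tail_term_bound J x A s t m); auto.
Qed.

Lemma em_double_tail_hol (J : nat) (x : R) (s p : C) : 0 < x -> 1 < Re p + INR J ->
  3 < Re s + Re p + INR J -> hol (em_double_tail J x s) p.
Proof.
  intros Hx Hp Hsp.
  destruct (rser_inv_sq x Hx) as [A HA]. destruct (rser_inv_sq 1 Rlt_0_1) as [B HB].
  destruct (ccont_near_bounded _ _ (cdiff_falling_1_minus (J + 2) p)) as [K1 [HK1 H1]].
  destruct (rpow_near_bounded x (INR J - 1) p) as [K2 [HK2 H2]].
  assert (H3 : near p (fun z => 1 - INR J < Re z)) by (apply near_Re_gt; lra).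
  assert (H4 : near p (fun z => 3 - INR J - Re s < Re z)) by (apply near_Re_gt; lra).
  assert (HA0 : 0 <= A).
  { eapply rser_ge0; [|exact HA]. intros n. pose proof (pos_INR n).
    left. apply Rinv_0_lt_compat. nra. }
  apply (weierstrass (fun m z => cpow (INR (S m)) (- s) * em_tail J z (INR (S m) * x))%C _ p
    (fun m => em_const J * K1 * K2 * A * / ((1 + INR m) * (1 + INR m))) (em_const J * K1 * K2 * A * B)).
  - generalize (near_and _ _ _ (near_and _ _ _ H3 H4) (near_and _ _ _ H1 H2)). apply near_imp.
    intros z [[Hz Hsz] [Hz1 Hz2]] m. split.
    + apply cdiff_mult; [apply cdiff_const|]. apply hol_cdiff, em_tail_hol; [|lra].
      apply Rmult_lt_0_compat; auto. apply lt_0_INR. lia.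
    + eapply Rle_trans; [apply (em_double_tail_term_bound J x A s z m); auto; lra|].
      pose proof (pos_INR m). pose proof (em_const_pos J).
      apply Rmult_le_compat_r; [left; apply Rinv_0_lt_compat; nra|].
      apply Rmult_le_compat_r; auto.
      apply Rmult_le_compat; [apply Rmult_le_pos; auto using Cmod_ge_0|left; apply rpow_pos| |].
      * apply Rmult_le_compat_l; auto.
      * replace (Re z + INR J - 1) with (Re z + (INR J - 1)) by ring. exact Hz2.
  - generalize (near_and _ _ _ H3 H4). apply near_imp. intros z [Hz Hsz]. apply em_double_tail_cser; auto; lra.
  - apply rser_scal, HB.
Qed.

Lemma em_double_tail_nat_zero (J N : nat) (x : R) (s : C) : 0 < x -> (N < J)%nat ->
  3 <= Re s - INR N + INR J -> em_double_tail J x s (- RtoC (INR N)) = 0%C.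
Proof.
  intros Hx HN Hs.
  assert (E : Re (- RtoC (INR N)) = - INR N) by reflexivity.
  assert (H : INR (S N) <= INR J) by (apply le_INR; lia). rewrite S_INR in H.
  eapply cser_unique; [apply em_double_tail_cser; auto; rewrite E; lra|].
  eapply cser_ext; [|apply cser_zero]. intros m. cbv beta.
  rewrite em_tail_nat_zero; [ring|auto|]. apply Rmult_lt_0_compat; auto. apply lt_0_INR. lia.
Qed.

(** Every exponent 1 - Re t - i is at most - 1, so the boundary terms of the summation formula
    disappear at infinity. *)
Lemma em_sum_bound_inv (J : nat) (t : C) : 2 <= Re t ->
  exists K, forall v, 1 <= v -> Cmod (em_sum J t v) <= K / v.
Proof.
  intros Ht. unfold em_sum. generalize (S J) as n. induction n as [|n [K HK]].
  - exists 0. intros v Hv. cbn [psum]. rewrite Cmod_0. unfold Rdiv. lra.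
  - exists (K + Cmod (RtoC (em_coef n) * falling (1 - t) n)). intros v Hv. cbn [psum].
    eapply Rle_trans; [apply Cmod_triangle|].
    replace ((K + Cmod (RtoC (em_coef n) * falling (1 - t) n)) / v)
      with (K / v + Cmod (RtoC (em_coef n) * falling (1 - t) n) * / v) by (field; lra).
    apply Rplus_le_compat; [apply HK, Hv|]. unfold pow_deriv. rewrite Cmult_assoc, Cmod_mult.
    apply Rmult_le_compat_l; [apply Cmod_ge_0|]. rewrite Cmod_cpow_rpow.
    replace (/ v) with (rpow v (- (1))).
    + apply rpow_exp_mono; auto. unfold Cminus. rewrite !re_plus, !re_opp. cbn.
      pose proof (pos_INR n). lra.
    + unfold rpow. replace (- (1) * ln v) with (- ln v) by ring. rewrite exp_Ropp, exp_ln; lra.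
Qed.

(** The left side sums to 1 - t times the Hurwitz zeta function. The partial sums telescope by the
    definition of [em_rem], and the boundary term at a + n tends to 0. *)
Theorem hurwitz_em (J : nat) (t : C) (a : R) : 0 < a -> 2 <= Re t ->
  cser (fun n => (1 - t) * cpow (a + INR n) (- t))%C (em_sum J t a + em_tail J t a)%C.
Proof.
  intros Ha Ht. pose proof (pos_INR J).
  pose proof (em_tail_cser J t a Ha ltac:(lra)) as HR.
  assert (Tel : forall n, psum (fun k => (1 - t) * cpow (a + INR k) (- t))%C n
    = (em_sum J t a - em_sum J t (a + INR n) + psum (fun k => em_rem J t (a + INR k)) n)%C).
  { induction n; cbn [psum]; [cbn [INR]; rewrite Rplus_0_r; ring|].
    rewrite IHn, <- pow_deriv_1.
    replace (pow_deriv t 1 (a + INR n)) with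
      (em_sum J t (a + INR n) - em_sum J t (a + INR n + 1) + em_rem J t (a + INR n))%C
      by (unfold em_rem; ring).
    rewrite S_INR, <- Rplus_assoc. ring. }
  destruct (em_sum_bound_inv J t Ht) as [K HK].
  intros eps Heps. destruct (HR (eps / 2) ltac:(lra)) as [N1 H1].
  destruct (INR_unbounded (1 + 2 * Rabs K / eps)) as [N2 H2].
  exists (N1 + N2)%nat. intros n Hn. specialize (H1 n ltac:(lia)). rewrite Tel.
  assert (Hn2 : INR N2 <= INR n) by (apply le_INR; lia).
  pose proof (Rabs_pos K).
  assert (Hq : 0 <= 2 * Rabs K / eps) by (apply Rdiv_le_0_compat; lra).
  set (v := a + INR n). assert (Hv : 1 + 2 * Rabs K / eps < v) by (unfold v; lra).
  specialize (HK v ltac:(lra)).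
  assert (HKv : K / v <= eps / 2).
  { apply Rle_div_l; [lra|]. pose proof (Rle_abs K).
    apply Rle_trans with (eps / 2 * (2 * Rabs K / eps)).
    - replace (eps / 2 * (2 * Rabs K / eps)) with (Rabs K) by (field; lra). auto.
    - apply Rmult_le_compat_l; lra. }
  match goal with |- Cmod (?A - ?B + ?P - (_ + ?R)) <= _ =>
    replace (A - B + P - (A + R))%C with ((P - R) - B)%C by ring;
    pose proof (Cmod_triangle_minus (P - R) B) end.
  lra.
Qed.

(** * The Riemann zeta function *)

Lemma zeta_cser (zeta : C -> C) (s : C) : is_Riemann_zeta zeta -> 1 < Re s ->
  cser (fun n => cpow (INR (S n)) (- s)) (zeta s).
Proof.
  intros [H _] Hs. apply cser_ext with (fun n => / cpow (INR (S n)) s)%C.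
  - intros n. rewrite cpow_opp. reflexivity.
  - apply cser_is_Cseries, H, Hs.
Qed.

Lemma zeta_hol (zeta : C -> C) (s : C) : is_Riemann_zeta zeta -> s <> RtoC 1 -> hol zeta s.
Proof. intros [_ [H _]] Hs. apply holomorphic_at_hol, H, Hs. Qed.

Lemma zeta_mero (zeta : C -> C) (s : C) : is_Riemann_zeta zeta -> mero zeta s.
Proof. intros [_ [_ H]]. apply meromorphic_at_mero, H. Qed.

Lemma hol_one_minus (p : C) : hol (fun z => 1 - z)%C p.
Proof. apply cdiff_everywhere_hol. intros z. apply cdiff_minus; [apply cdiff_const|apply cdiff_id]. Qed.

(** Both sides are meromorphic where Re z + J > 1 and agree for Re z > 2 by [hurwitz_em] at a = 1; a
    segment of length |Re p| + 3 reaches that half-plane. *)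
Lemma zeta_em (zeta : C -> C) (J : nat) (p : C) : is_Riemann_zeta zeta -> 1 < Re p + INR J ->
  pnear p (fun z => (1 - z) * zeta z = em_sum J z 1 + em_tail J z 1)%C.
Proof.
  intros Hz Hp.
  set (D := fun z => ((1 - z) * zeta z - (em_sum J z 1 + em_tail J z 1))%C).
  assert (HD : pnear p (fun z => D z = 0%C)).
  { apply (mero_identity D p (Rabs (Re p) + 3)).
    - pose proof (Rabs_pos (Re p)). lra.
    - intros u Hu. apply mero_minus.
      + apply mero_mult; [apply hol_mero, hol_one_minus|apply zeta_mero, Hz].
      + apply hol_mero, hol_plus.
        * apply cdiff_everywhere_hol, cdiff_em_sum.
        * apply em_tail_hol; [lra|]. rewrite re_plus. cbn. lra.
    - apply near_pnear.
      assert (H2 : near (p + RtoC (Rabs (Re p) + 3))%C (fun z => 2 < Re z)).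
      { apply near_Re_gt. rewrite re_plus. cbn.
        pose proof (Rabs_le_between (Re p) (Rabs (Re p))) as [Hb _].
        specialize (Hb (Rle_refl _)). lra. }
      revert H2. apply near_imp. intros z H2. unfold D.
      assert (E : ((1 - z) * zeta z)%C = (em_sum J z 1 + em_tail J z 1)%C).
      { eapply cser_unique; [|apply hurwitz_em; lra].
        apply cser_ext with (fun n => (1 - z) * cpow (INR (S n)) (- z))%C.
        - intros n. rewrite S_INR, (Rplus_comm _ 1). reflexivity.
        - apply cser_scal, zeta_cser; auto. lra. }
      rewrite E. ring. }
  revert HD. apply pnear_imp. intros z HD. unfold D in HD.
  replace ((1 - z) * zeta z)%C with (((1 - z) * zeta z - (em_sum J z 1 + em_tail J z 1)) + (em_sum J z 1 + em_tail J z 1))%C by ring.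
  rewrite HD. ring.
Qed.

Lemma pnear_ccont_eq (f g : C -> C) (p : C) : ccont f p -> ccont g p -> pnear p (fun z => f z = g z) -> f p = g p.
Proof.
  intros Hf Hg He. apply eq_of_Cmod_le. intros eps Heps.
  destruct (pnear_ex _ _ (pnear_and _ _ _ He (pnear_and _ _ _ (near_pnear _ _ (Hf (eps / 2) ltac:(lra)))
    (near_pnear _ _ (Hg (eps / 2) ltac:(lra)))))) as [z [E [H1 H2]]].
  replace (f p - g p)%C with ((g z - g p) - (f z - f p))%C by (rewrite E; ring).
  pose proof (Cmod_triangle_minus (g z - g p) (f z - f p)). lra.
Qed.

Lemma em_coef_rec (q : nat) : (1 <= q)%nat -> rsum (fun i => em_coef i / INR (fact (S q - i))) (S q) = 0.
Proof.
  intros Hq. destruct q as [|q]; [lia|].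
  change (rsum ?f (S (S q))) with (rsum f (S q) + f (S q)). cbv beta.
  rewrite em_coef_S. replace (S (S q) - S q)%nat with 1%nat by lia. cbn [fact Nat.mul Nat.add INR].
  lra.
Qed.

Lemma falling_nat (N i : nat) : (i <= N)%nat -> falling (RtoC (INR N)) i = RtoC (INR (fact N) / INR (fact (N - i))).
Proof.
  induction i; intros H.
  - rewrite Nat.sub_0_r. cbn [falling]. f_equal. field. apply INR_fact_neq_0.
  - cbn [falling]. rewrite IHi by lia. rewrite <- RtoC_minus, <- RtoC_mult. f_equal.
    replace (N - i)%nat with (S (N - S i)) by lia.
    change (fact (S (N - S i))) with (S (N - S i) * fact (N - S i))%nat.
    rewrite mult_INR, <- minus_INR by lia. replace (N - i)%nat with (S (N - S i)) by lia.
    field. split; [apply INR_fact_neq_0|apply not_0_INR; discriminate].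
Qed.

(* [zeta (- q) = - B_{q+1} / (q + 1)], with [B_1 = + 1/2] *)
Definition zeta_neg_value (q : nat) : R := em_coef (S q) * INR (fact q) - (if Nat.eqb q 0 then 1 else 0).

Lemma zeta_neg (zeta : C -> C) (q : nat) : is_Riemann_zeta zeta ->
  zeta (- RtoC (INR q))%C = RtoC (zeta_neg_value q).
Proof.
  (* The choice J = q + 2 is the least one with 1 < Re p + J. *)
  intros Hz. set (p := (- RtoC (INR q))%C). set (J := (q + 2)%nat).
  assert (Ep : Re p = - INR q) by reflexivity.
  assert (EJ : INR J = INR q + 2) by (unfold J; rewrite plus_INR; reflexivity).
  pose proof (pos_INR q).
  assert (Hp1 : p <> RtoC 1).
  { intros E. apply (f_equal Re) in E. rewrite Ep in E. cbn in E. lra. }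
  assert (E : ((1 - p) * zeta p)%C = (em_sum J p 1 + em_tail J p 1)%C).
  { apply (pnear_ccont_eq (fun z => (1 - z) * zeta z)%C (fun z => em_sum J z 1 + em_tail J z 1)%C).
    - apply cdiff_ccont, cdiff_mult; [apply hol_cdiff, hol_one_minus|apply hol_cdiff, zeta_hol; auto].
    - apply cdiff_ccont, cdiff_plus; [apply cdiff_em_sum|]. apply hol_cdiff, em_tail_hol; lra.
    - apply zeta_em; auto. lra. }
  assert (E0 : em_tail J p 1 = 0%C) by (unfold p; apply em_tail_nat_zero; [unfold J; lia|lra]).
  rewrite E0, Cplus_0_r in E.
  assert (Es : em_sum J p 1 = RtoC (INR (S q) * zeta_neg_value q)).
  { unfold em_sum, J. replace (S (q + 2)) with (S (S (S q))) by lia.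
    assert (Et : forall i, (RtoC (em_coef i) * pow_deriv p i 1)%C = (RtoC (em_coef i) * falling (RtoC (INR (S q))) i)%C).
    { intros i. unfold pow_deriv, p. rewrite cpow_base_1, S_INR, RtoC_plus. replace (1 - - RtoC (INR q))%C with (RtoC (INR q) + 1)%C by ring. ring. }
    rewrite (psum_ext _ _ _ (fun k _ => Et k)).
    (* The term of index q + 2 vanishes with its falling factorial, and that of index q + 1 is the
       Bernoulli term. Those up to q sum to 0 by the recursion, except for q = 0, where the single
       term - 1 is left. *)
    change (psum ?a (S (S (S q)))) with (psum a (S q) + a (S q) + a (S (S q)))%C. cbv beta.
    rewrite (falling_nat_zero (S q) (S (S q))) by lia. rewrite (falling_nat (S q) (S q)) by lia.
    rewrite Nat.sub_diag. change (INR (fact 0)) with 1.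
    assert (G : forall n, (n <= S q)%nat -> psum (fun k => RtoC (em_coef k) * falling (RtoC (INR (S q))) k)%C n
      = RtoC (INR (fact (S q)) * rsum (fun i => em_coef i / INR (fact (S q - i))) n)).
    { induction n; intros Hn; cbn [psum rsum]; [f_equal; ring|].
      rewrite IHn, falling_nat by lia. rewrite <- RtoC_mult, <- RtoC_plus. f_equal. unfold Rdiv. ring. }
    rewrite G by lia. rewrite Cmult_0_r, Cplus_0_r, <- RtoC_mult, <- RtoC_plus. f_equal.
    change (fact (S q)) with (S q * fact q)%nat. rewrite mult_INR. unfold zeta_neg_value.
    destruct q as [|q'].
    - cbn [rsum Nat.eqb Nat.sub fact Nat.mul Nat.add INR]. rewrite em_coef_0. cbn. field.
    - rewrite em_coef_rec by lia. cbn [Nat.eqb]. field. }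
  rewrite Es in E.
  assert (E1 : (1 - p)%C = RtoC (INR (S q))) by (unfold p; rewrite S_INR, RtoC_plus; ring).
  rewrite E1, RtoC_mult in E.
  pose proof (INR_RtoC_S_neq q) as Hn.
  replace (zeta p) with (RtoC (INR (S q)) * zeta p / RtoC (INR (S q)))%C by (field; auto).
  rewrite E. field. auto.
Qed.

(** * The Laurent expansion of zeta at 1 *)

Lemma cderiv_eq (f : C -> C) (z l m : C) : l = m -> cderiv f z l -> cderiv f z m.
Proof. intros ->; auto. Qed.

Lemma harmonic_S (n : nat) : harmonic (S n) = harmonic n + / INR (S n).
Proof.
  unfold harmonic. destruct n as [|n].
  - rewrite sum_n_n, sum_n_m_zero by lia. cbn. unfold zero; cbn. ring.
  - rewrite sum_n_Sm by lia. reflexivity.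
Qed.

Lemma em_coef_1 : em_coef 1 = / 2.
Proof. rewrite em_coef_S. cbn [rsum Nat.sub fact Nat.mul Nat.add INR]. rewrite em_coef_0. cbn. field. Qed.

Lemma em_sum_1 (z : C) (v : R) :
  em_sum 1 z v = (- cpow v (1 - z) + RtoC (/ 2) * ((1 - z) * cpow v (- z)))%C.
Proof.
  unfold em_sum. cbn [psum]. rewrite pow_deriv_1, em_coef_0, em_coef_1, RtoC_opp.
  unfold pow_deriv. cbn [falling INR]. replace (1 - z - 0)%C with (1 - z)%C by ring. ring.
Qed.

(** The error of the trapezoidal rule for 1 / v on [n + 1, n + 2]; it is the derivative at t = 1 of
    the Euler-Maclaurin error with J = 1. *)
Definition gamma_term (n : nat) : R :=
  ln (INR n + 2) - ln (INR n + 1) - / 2 * (/ (INR n + 1) + / (INR n + 2)).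

Lemma cderiv_em_rem_1 (n : nat) : cderiv (fun z => em_rem 1 z (1 + INR n)) 1 (RtoC (gamma_term n)).
Proof.
  pose proof (pos_INR n) as Hn. set (v := 1 + INR n). assert (Hv : 1 <= v) by (unfold v; lra).
  assert (D1 : cderiv (fun z => 1 - z)%C 1 (- (1))%C).
  { eapply cderiv_near_ext; [apply near_True; intros w; instantiate (1 := (fun w => 1 + - (1) * w)%C); cbv beta; ring|].
    eapply cderiv_eq; [|apply cderiv_plus; [apply cderiv_const|apply cderiv_mult; [apply cderiv_const|apply cderiv_id]]].
    cbv beta; ring. }
  assert (D2 : cderiv (fun z => - z)%C 1 (- (1))%C).
  { eapply cderiv_near_ext; [apply near_True; intros w; instantiate (1 := (fun w => - (1) * w)%C); cbv beta; ring|].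
    eapply cderiv_eq; [|apply cderiv_mult; [apply cderiv_const|apply cderiv_id]]. cbv beta; ring. }
  assert (E11 : (1 - 1)%C = RtoC 0) by ring.
  assert (P1 : forall u, 0 < u -> cderiv (fun z => cpow u (1 - z)) 1 (- RtoC (ln u))%C).
  { intros u Hu. eapply cderiv_eq; [|apply (cderiv_comp (cpow u) (fun z => 1 - z)%C); [exact D1|apply cderiv_cpow]].
    cbv beta. rewrite E11, cpow_0. ring. }
  assert (P2 : forall u, 0 < u -> cderiv (fun z => (1 - z) * cpow u (- z))%C 1 (- RtoC (/ u))%C).
  { intros u Hu. eapply cderiv_eq; [|apply cderiv_mult; [exact D1|
      apply (cderiv_comp (cpow u) (fun z => - z)%C); [exact D2|apply cderiv_cpow]]].
    cbv beta. rewrite E11, cpow_opp, cpow_1, RtoC_inv by lra. ring. }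
  apply cderiv_near_ext with (fun z => (RtoC (/ 2) * ((1 - z) * cpow v (- z))) + (cpow v (1 - z))
     + ((- (1) * cpow (v + 1) (1 - z)) + RtoC (/ 2) * ((1 - z) * cpow (v + 1) (- z))))%C.
  - apply near_True. intros z. unfold em_rem. rewrite !em_sum_1, pow_deriv_1.
    set (h := RtoC (/ 2)). assert (E2 : (h + h)%C = RtoC 1) by (unfold h; rewrite <- RtoC_plus; f_equal; field).
    set (A := ((1 - z) * cpow v (- z))%C). set (A1 := ((1 - z) * cpow (v + 1) (- z))%C).
    assert (HA : A = (h * A + h * A)%C) by (rewrite <- Cmult_plus_distr_r, E2; ring).
    transitivity ((h * A + h * A) - (- cpow v (1 - z) + h * A) + (- cpow (v + 1) (1 - z) + h * A1))%C;
      [ring|rewrite <- HA; reflexivity].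
  - eapply cderiv_eq; [|apply cderiv_plus; [apply cderiv_plus|apply cderiv_plus];
      try (apply cderiv_mult; [apply cderiv_const|]); first [apply P1|apply P2]; lra].
    cbv beta. unfold gamma_term. replace (INR n + 1) with v by (unfold v; ring). replace (INR n + 2) with (v + 1) by (unfold v; ring).
    rewrite !RtoC_minus, RtoC_mult, RtoC_plus. ring.
Qed.

Lemma rsum_gamma_term (n : nat) :
  rsum gamma_term n = ln (INR n + 1) - harmonic (S n) + / 2 + / 2 * / (INR n + 1).
Proof.
  induction n.
  - cbn [rsum INR]. unfold harmonic. rewrite sum_n_n. cbn [INR].
    replace (0 + 1) with 1 by ring. rewrite ln_1, Rinv_1. field.
  - cbn [rsum]. rewrite IHn, (harmonic_S (S n)), !S_INR. unfold gamma_term. pose proof (pos_INR n).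
    replace (INR n + 1 + 1) with (INR n + 2) by ring. field. lra.
Qed.

(** The telescoped partial sums are ln (n + 1) - H_(n+1) + 1/2 up to a null sequence. The assumed
    convergence of the series also shows that the limit defining [Euler_gamma] exists, [Lim_seq]
    being total. *)
Lemma gamma_term_gamma (L : C) : cser (fun n => RtoC (gamma_term n)) L -> L = RtoC (/ 2 - Euler_gamma).
Proof.
  intros HL.
  assert (Ep : forall n, psum (fun k => RtoC (gamma_term k)) n = RtoC (rsum gamma_term n)).
  { induction n; cbn [psum rsum]; [reflexivity|]. rewrite IHn, RtoC_plus. reflexivity. }
  assert (Hlim : is_lim_seq (fun n => harmonic n - ln (INR n)) (/ 2 - Re L)).
  { apply is_lim_seq_incr_1. apply is_lim_seq_spec. intros [eps Heps]. cbn [pos].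
    destruct (HL (eps / 3) ltac:(lra)) as [N1 H1].
    destruct (INR_unbounded (/ eps)) as [N2 H2].
    exists (N1 + N2)%nat. intros n Hn. specialize (H1 n ltac:(lia)). rewrite Ep in H1.
    pose proof (re_le_Cmod (RtoC (rsum gamma_term n) - L)) as Hre.
    unfold Cminus in Hre at 1. rewrite re_plus, re_opp, re_RtoC in Hre.
    assert (Hn2 : INR N2 <= INR n) by (apply le_INR; lia).
    assert (Hi : 0 < / eps) by (apply Rinv_0_lt_compat; auto).
    assert (Hsm : / (INR n + 1) < eps).
    { rewrite <- (Rinv_inv eps). apply Rinv_lt_contravar; [apply Rmult_lt_0_compat; lra|lra]. }
    assert (Hpos : 0 < / (INR n + 1)) by (apply Rinv_0_lt_compat; lra).
    pose proof (Rle_trans _ _ _ Hre H1) as Hre2. rewrite rsum_gamma_term in Hre2. rewrite S_INR.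
    apply Rabs_le_between in Hre2. apply Rabs_lt_between. lra. }
  assert (HR : Re L = / 2 - Euler_gamma).
  { unfold Euler_gamma. apply is_lim_seq_unique in Hlim.
    match goal with |- context [Lim_seq ?f] => change (Lim_seq f) with (Lim_seq (fun n => harmonic n - ln (INR n))) end.
    rewrite Hlim. cbn [real]. ring. }
  apply C_ext; rewrite ?re_RtoC, ?im_RtoC; [exact HR|].
  apply Rle_antisym; apply Rle_plus_epsilon; intros eps Heps;
  destruct (HL eps Heps) as [N HN]; specialize (HN N (le_n _)); rewrite Ep in HN;
  pose proof (im_le_Cmod (RtoC (rsum gamma_term N) - L)) as Him;
  unfold Cminus in Him at 1; rewrite im_plus, im_opp, im_RtoC in Him;
  assert (Him2 : Rabs (0 + - Im L) <= eps) by lra; apply Rabs_le_between in Him2; lra.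
Qed.

(** With h = z - 1 and J = 1 the expansion reads h zeta = 1 + h / 2 - R, where R vanishes at 1 with
    derivative 1/2 - gamma. Dividing by h requires the second-order estimate of R. *)
Theorem zeta_pole (zeta : C -> C) : is_Riemann_zeta zeta ->
  exists K, pnear 1 (fun z => Cmod (zeta z - / (z - 1) - RtoC Euler_gamma) <= K * Cmod (z - 1))%C.
Proof.
  intros Hz.
  assert (E1 : 1 < Re (RtoC 1) + INR 1) by (cbn; lra).
  pose proof (zeta_em zeta 1 1 Hz E1) as He.
  destruct (em_tail_weierstrass 1 1 1 Rlt_0_1 E1) as (M & S & HS & W1 & W2).
  destruct (weierstrass_deriv (fun n z => em_rem 1 z (1 + INR n)) (fun z => em_tail 1 z 1) 1 M S W1 W2 HS) as (l & L & Hl & HL & HR).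
  assert (EL : L = RtoC (/ 2 - Euler_gamma)).
  { apply gamma_term_gamma. apply cser_ext with l; [|exact HL]. intros n.
    eapply cderiv_unique; [apply Hl|apply cderiv_em_rem_1]. }
  assert (R1 : em_tail 1 1 1 = 0%C).
  { apply Cmod_eq_0, Rle_antisym; [|apply Cmod_ge_0].
    destruct (rser_inv_sq 1 Rlt_0_1) as [T HT].
    eapply Rle_trans; [apply (em_tail_bound 1 1 1 1 T); auto; cbn; lra|].
    replace (falling (1 - 1) (1 + 2)) with (RtoC 0) by (cbn; ring). rewrite Cmod_0. lra. }
  destruct (hol_cderiv2 (fun z => em_tail 1 z 1) 1) as (l2 & K & d & Hd & HK).
  { apply em_tail_hol; auto; lra. }
  assert (El2 : l2 = L).
  { apply (cderiv_unique (fun z => em_tail 1 z 1) 1); [|exact HR].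
    exact (quadratic_cderiv (fun z => em_tail 1 z 1) 1 l2 K d Hd HK). }
  subst l2. exists K.
  assert (Hb : pnear 1 (fun z => z <> 1 /\ Cmod (z - 1) <= d)%C).
  { exists d; split; auto. intros w Hw Hne. split; [exact Hne|]. apply Rlt_le, Hw. }
  generalize (pnear_and _ _ _ He Hb). apply pnear_imp. intros z [Ez [Hne Hzd]].
  specialize (HK (z - 1)%C Hzd). rewrite R1 in HK. replace (1 + (z - 1))%C with z in HK by ring.
  set (h := (z - 1)%C) in *.
  assert (Hh : h <> 0%C).
  { intros E. apply Hne. replace z with (h + 1)%C by (unfold h; ring). rewrite E. ring. }
  assert (Hhp : 0 < Cmod h) by (apply Cmod_gt_0, Hh).
  rewrite em_sum_1, !cpow_base_1 in Ez.
  assert (Ezt : (h * zeta z)%C = (1 + RtoC (/ 2) * h - em_tail 1 z 1)%C).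
  { replace (h * zeta z)%C with (- ((1 - z) * zeta z))%C by (unfold h; ring). rewrite Ez. unfold h. ring. }
  assert (Ed : (zeta z - / h - RtoC Euler_gamma)%C = (- (em_tail 1 z 1 - 0 - L * h) / h)%C).
  { replace (zeta z) with (h * zeta z / h)%C by (field; auto). rewrite Ezt, EL, RtoC_minus. field. auto. }
  rewrite Ed, Cmod_div, Cmod_opp by auto. apply Rle_div_l; auto. rewrite Rmult_assoc. exact HK.
Qed.

(** * Theta for large t *)

Lemma psum_head (a : nat -> C) (n : nat) : psum a (S n) = (a 0%nat + psum (fun k => a (S k)) n)%C.
Proof.
  induction n; [cbn; ring|].
  change (psum a (S (S n))) with (psum a (S n) + a (S n))%C. rewrite IHn. cbn [psum]. ring.
Qed.

Lemma cser_tail_S (b : nat -> C) (v : C) : cser b v -> cser (fun n => b (S n)) (v - b 0%nat)%C.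
Proof.
  intros H eps Heps. destruct (H eps Heps) as [N HN]. exists N. intros n Hn.
  specialize (HN (S n) ltac:(lia)). rewrite psum_head in HN.
  replace (psum (fun k => b (S k)) n - (v - b 0%nat))%C with (b 0%nat + psum (fun k => b (S k)) n - v)%C by ring.
  exact HN.
Qed.

Lemma falling_head (z : C) (n : nat) : falling z (S n) = (z * falling (z - 1) n)%C.
Proof.
  induction n; [cbn; ring|].
  change (falling z (S (S n))) with (falling z (S n) * (z - RtoC (INR (S n))))%C. rewrite IHn.
  cbn [falling]. rewrite S_INR, RtoC_plus. ring.
Qed.

Lemma falling_diff (z : C) (n : nat) : (falling (z + 1) (S n) - falling z (S n) = RtoC (INR (S n)) * falling z n)%C.
Proof.
  rewrite falling_head. replace (z + 1 - 1)%C with z by ring. cbn [falling].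
  rewrite S_INR, RtoC_plus. ring.
Qed.

(** The beta integral of u^rho (1 + u)^(- t) over the positive half-line, in closed form. *)
Definition lead_coef (rho : nat) (t : C) : C := (RtoC (INR (fact rho)) * / falling (t - 1) (S rho))%C.

Lemma falling_neq_0 (z : C) (n : nat) : (forall j, (j < n)%nat -> z <> RtoC (INR j)) -> falling z n <> 0%C.
Proof.
  induction n; intros H; cbn [falling]; [apply C1_nz|].
  apply Cmult_neq_0; [apply IHn; auto|]. apply Cminus_eq_contra, H. lia.
Qed.

Lemma falling_neq_0_Re (z : C) (n : nat) : INR n <= Re z -> falling z n <> 0%C.
Proof.
  intros H. apply falling_neq_0. intros j Hj ->. rewrite re_RtoC in H. apply INR_le in H. lia.
Qed.

(** Integrated form of u^(rho + 1) (1 + u)^(- t) = u^rho (1 + u)^(1 - t) - u^rho (1 + u)^(- t). *)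
Lemma lead_coef_rec (rho : nat) (t : C) : INR rho + 3 <= Re t ->
  (lead_coef rho (t - 1) - lead_coef rho t)%C = lead_coef (S rho) t.
Proof.
  intros Ht. unfold lead_coef.
  assert (Hre : Re (t - 1) = Re t - 1) by (unfold Cminus; rewrite re_plus, re_opp; cbn; ring).
  assert (N1 : falling (t - 1) (S rho) <> 0%C) by (apply falling_neq_0_Re; rewrite S_INR; lra).
  assert (N2 : falling (t - 1 - 1) (S rho) <> 0%C).
  { apply falling_neq_0_Re. unfold Cminus at 1. rewrite re_plus, re_opp, Hre, S_INR. cbn. lra. }
  assert (N3 : falling (t - 1) (S (S rho)) <> 0%C) by (apply falling_neq_0_Re; rewrite !S_INR; lra).
  pose proof (falling_head (t - 1) (S rho)) as E1.
  assert (E2 : falling (t - 1) (S (S rho)) = (falling (t - 1) (S rho) * (t - 1 - RtoC (INR (S rho))))%C) by reflexivity.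
  assert (Hf : RtoC (INR (fact (S rho))) = (RtoC (INR (S rho)) * RtoC (INR (fact rho)))%C).
  { rewrite <- RtoC_mult, <- mult_INR. reflexivity. }
  rewrite Hf. set (P := falling (t - 1 - 1) (S rho)) in *. set (Q := falling (t - 1) (S rho)) in *.
  set (W := falling (t - 1) (S (S rho))) in *.
  assert (I1 : (/ P)%C = ((t - 1) / W)%C).
  { rewrite E1. assert ((t - 1)%C <> 0%C) by (intros E; apply N3; rewrite E1, E; ring). field. auto. }
  assert (I2 : (/ Q)%C = ((t - 1 - RtoC (INR (S rho))) / W)%C).
  { rewrite E2. assert ((t - 1 - RtoC (INR (S rho)))%C <> 0%C) by (intros E; apply N3; rewrite E2, E; ring). field. auto. }
  rewrite I1, I2. field. auto.
Qed.

Definition theta_main (zeta : C -> C) (x : R) (rho K : nat) (s t : C) : C :=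
  (lead_coef rho t * cpow x (RtoC (INR rho) + 1 - t) * zeta (t + (s - RtoC (INR rho) - 1))
   + psum (fun k => RtoC (zeta_neg_value (rho + k) / INR (fact k)) * falling (- t) k * cpow x (- t - RtoC (INR k))
            * zeta (t + (s + RtoC (INR k)))) K)%C.

(** The recursion is that of [Theta_term_rec]; dividing by 1 - t at the bottom undoes the factor
    introduced in [em_rem]. *)
Fixpoint theta_rem (x : R) (J rho : nat) (s t : C) : C :=
  match rho with
  | O => (em_double_tail J x s t * / (1 - t))%C
  | S m => (theta_rem x J m s (t - 1) - RtoC x * theta_rem x J m (s - 1) t)%C
  end.

Lemma zeta_sum_x (zeta : C -> C) (x : R) (s w : C) : is_Riemann_zeta zeta -> 0 < x -> 1 < Re (s - w)%C ->
  cser (fun m => cpow (INR (S m)) (- s) * cpow (INR (S m) * x) w)%C (cpow x w * zeta (s - w))%C.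
Proof.
  intros Hz Hx Hs.
  apply cser_ext with (fun m => cpow x w * cpow (INR (S m)) (- (s - w)))%C.
  - intros m. assert (0 < INR (S m)) by (apply lt_0_INR; lia).
    rewrite cpow_mult by auto. replace (- (s - w))%C with (- s + w)%C by ring. rewrite cpow_plus. ring.
  - apply cser_scal, zeta_cser; auto.
Qed.

Lemma Theta_term_eq (x : R) (rho : nat) (s t : C) (n m : nat) : 0 < x -> (0 < n)%nat -> (0 < m)%nat ->
  Theta_term x (- RtoC (INR rho)) s t n m
  = (RtoC (INR n ^ rho) * cpow (INR m) (- s) * cpow (INR n + INR m * x) (- t))%C.
Proof.
  intros Hx Hn Hm. apply lt_0_INR in Hn, Hm. unfold Theta_term.
  rewrite !cpow_opp, cpow_nat by auto.
  assert (H1 : RtoC (INR n ^ rho) <> 0%C) by (apply RtoC_neq, pow_nonzero; lra).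
  pose proof (cpow_neq_0 (INR m) s). pose proof (cpow_neq_0 (INR n + INR m * x) t).
  field. auto.
Qed.

(* [n = (n + m x) - m x] trades a power of [n] for shifts of [t] and [s]. *)
Lemma Theta_term_rec (x : R) (rho : nat) (s t : C) (n m : nat) : 0 < x -> (0 < n)%nat -> (0 < m)%nat ->
  Theta_term x (- RtoC (INR (S rho))) s t n m
  = (Theta_term x (- RtoC (INR rho)) s (t - 1) n m - RtoC x * Theta_term x (- RtoC (INR rho)) (s - 1) t n m)%C.
Proof.
  intros Hx Hn Hm. rewrite !Theta_term_eq by auto. apply lt_0_INR in Hn, Hm.
  assert (0 < INR n + INR m * x) by nra.
  replace (- (t - 1))%C with (- t + 1)%C by ring. replace (- (s - 1))%C with (- s + 1)%C by ring.
  rewrite !cpow_plus, !cpow_1 by auto. rewrite RtoC_plus, RtoC_mult. cbn [pow]. rewrite RtoC_mult. ring.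
Qed.

Lemma Theta_series_rec (x : R) (rho : nat) (s t v1 v2 : C) : 0 < x ->
  is_Theta_series x (- RtoC (INR rho)) s (t - 1) v1 ->
  is_Theta_series x (- RtoC (INR rho)) (s - 1) t v2 ->
  is_Theta_series x (- RtoC (INR (S rho))) s t (v1 - RtoC x * v2)%C.
Proof.
  intros Hx [i1 [H1 S1]] [i2 [H2 S2]]. exists (fun n => i1 n - RtoC x * i2 n)%C. split.
  - intros n. specialize (H1 n). specialize (H2 n). apply cser_is_Cseries in H1, H2.
    apply cser_is_Cseries.
    eapply cser_ext; [|apply cser_minus; [exact H1|apply (cser_scal (RtoC x)), H2]].
    intros m. cbv beta. symmetry. apply Theta_term_rec; auto; lia.
  - apply cser_is_Cseries in S1, S2. apply cser_is_Cseries.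
    apply cser_minus; auto. apply cser_scal; auto.
Qed.

(** The term of index 0 is the integral, and index k + 1 becomes the correction of order k because
    [falling (1 - t) (S k)] starts with the factor 1 - t. *)
Lemma em_sum_split (J : nat) (t : C) (v : R) : (t <> 1)%C ->
  (em_sum J t v * / (1 - t))%C
  = (/ (t - 1) * cpow v (1 - t)
     + psum (fun k => RtoC (em_coef (S k)) * falling (- t) k * cpow v (- t - RtoC (INR k))) J)%C.
Proof.
  intros Ht. assert (N1 : (1 - t)%C <> 0%C) by (apply Cminus_eq_contra; auto).
  assert (N2 : (t - 1)%C <> 0%C) by (apply Cminus_eq_contra; auto).
  unfold em_sum. rewrite psum_head, Cmult_plus_distr_r. f_equal.
  - unfold pow_deriv. rewrite em_coef_0, RtoC_opp. cbn [falling INR]. replace (1 - t - 0)%C with (1 - t)%C by ring. field. auto.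
  - rewrite Cmult_comm, <- psum_scal. apply psum_ext. intros k _.
    unfold pow_deriv. rewrite falling_head, S_INR, RtoC_plus.
    replace (1 - t - 1)%C with (- t)%C by ring.
    replace (1 - t - (RtoC (INR k) + 1))%C with (- t - RtoC (INR k))%C by ring. field. auto.
Qed.

Lemma zeta_neg_value_0 : zeta_neg_value 0 = em_coef 1 - 1.
Proof. unfold zeta_neg_value. cbn [Nat.eqb fact INR]. ring. Qed.

Lemma zeta_neg_value_S (k : nat) : zeta_neg_value (S k) / INR (fact (S k)) = em_coef (S (S k)).
Proof. unfold zeta_neg_value. cbn [Nat.eqb]. field. apply INR_fact_neq_0. Qed.

Lemma theta_column (x : R) (J m : nat) (s t : C) : 0 < x -> (1 <= J)%nat -> 2 <= Re t ->
  cser (fun n => Theta_term x (- RtoC (INR 0)) s t (S n) (S m))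
    (cpow (INR (S m)) (- s) * (/ (t - 1) * cpow (INR (S m) * x) (1 - t)
     + psum (fun k => RtoC (zeta_neg_value k / INR (fact k)) * falling (- t) k * cpow (INR (S m) * x) (- t - RtoC (INR k))) J
     + em_tail J t (INR (S m) * x) * / (1 - t)))%C.
Proof.
  intros Hx HJ Ht. assert (Hm : 0 < INR (S m)) by (apply lt_0_INR; lia).
  set (a := INR (S m) * x). assert (Ha : 0 < a) by (apply Rmult_lt_0_compat; auto).
  assert (Ht1 : (t <> 1)%C) by (intros ->; cbn in Ht; lra).
  assert (N1 : (1 - t)%C <> 0%C) by (apply Cminus_eq_contra; auto).
  pose proof (cser_scal (/ (1 - t)) _ _ (hurwitz_em J t a Ha Ht)) as H1.
  apply cser_ext with (b := fun n => cpow (a + INR n) (- t)) in H1.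
  2: { intros n. field. auto. }
  (* The Hurwitz sum starts at n = 0 and the Theta sum at n = 1. Dropping the first term lowers the
     coefficient of order 0 from 1/2 to - 1/2, the value of zeta at 0. *)
  pose proof (cser_tail_S _ _ H1) as H2. cbv beta in H2.
  pose proof (cser_scal (cpow (INR (S m)) (- s)) _ _ H2) as H3.
  eapply cser_ext in H3.
  - replace (cpow (INR (S m)) (- s) * (/ (t - 1) * cpow a (1 - t)
     + psum (fun k => RtoC (zeta_neg_value k / INR (fact k)) * falling (- t) k * cpow a (- t - RtoC (INR k))) J
     + em_tail J t a * / (1 - t)))%C
     with (cpow (INR (S m)) (- s) * (/ (1 - t) * (em_sum J t a + em_tail J t a) - cpow (a + INR 0) (- t)))%C; [exact H3|].
    f_equal. rewrite Cmult_plus_distr_l, (Cmult_comm (/ (1 - t)) (em_sum J t a)), em_sum_split by auto.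
    destruct J as [|J']; [lia|]. rewrite !psum_head.
    rewrite (psum_ext (fun k => RtoC (zeta_neg_value (S k) / INR (fact (S k))) * falling (- t) (S k) * cpow a (- t - RtoC (INR (S k))))%C
      (fun k => RtoC (em_coef (S (S k))) * falling (- t) (S k) * cpow a (- t - RtoC (INR (S k))))%C)
      by (intros k _; rewrite zeta_neg_value_S; reflexivity).
    rewrite zeta_neg_value_0. cbn [falling fact INR]. rewrite Rplus_0_r.
    replace (- t - 0)%C with (- t)%C by ring. unfold Rdiv. rewrite Rinv_1, Rmult_1_r, RtoC_minus. ring.
  - intros n. cbv beta. rewrite Theta_term_eq by (auto; lia).
    cbn [pow]. rewrite Cmult_1_l. fold a. rewrite (Rplus_comm a). reflexivity.
Qed.

Lemma rpow_le_inv_sq (y u : R) : 1 <= y -> 2 <= u -> rpow y (- u) <= / (y * y).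
Proof. intros Hy Hu. rewrite <- rpow_opp2 by lra. apply rpow_exp_mono; lra. Qed.

(** The product form required by [cser_fubini]: from the power of n + m x, two factors are bounded
    through n and the other Re t - 2 through m x. *)
Lemma Theta_term_bound (x : R) (s t : C) (n m : nat) : 0 < x -> 2 <= Re t -> 4 <= Re s + Re t ->
  Cmod (Theta_term x (- RtoC (INR 0)) s t (S n) (S m))
  <= / ((1 + INR n) * (1 + INR n)) * (rpow x (- (Re t - 2)) * / ((1 + INR m) * (1 + INR m))).
Proof.
  intros Hx Ht Hst. rewrite Theta_term_eq by (auto; lia).
  pose proof (pos_INR n). pose proof (pos_INR m).
  rewrite !S_INR, !(Rplus_comm _ 1). set (y := 1 + INR n) in *. set (z := 1 + INR m) in *.
  assert (Hy : 1 <= y) by (unfold y; lra). assert (Hz : 1 <= z) by (unfold z; lra).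
  cbn [pow]. rewrite Cmult_1_l, Cmod_mult, !Cmod_cpow_rpow, !re_opp.
  assert (Hzx : 0 < z * x) by (apply Rmult_lt_0_compat; lra).
  replace (- Re t) with (- (2) + - (Re t - 2)) by ring. rewrite (rpow_plus (y + z * x)).
  assert (B1 : rpow (y + z * x) (- (2)) <= / (y * y)).
  { rewrite <- rpow_opp2 by lra. apply rpow_antitone; lra. }
  assert (B2 : rpow (y + z * x) (- (Re t - 2)) <= rpow z (- (Re t - 2)) * rpow x (- (Re t - 2))).
  { rewrite <- rpow_mult by lra. apply rpow_antitone; lra. }
  assert (B3 : rpow z (- Re s) * rpow z (- (Re t - 2)) <= / (z * z)).
  { rewrite <- rpow_plus. replace (- Re s + - (Re t - 2)) with (- (Re s + Re t - 2)) by ring.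
    apply rpow_le_inv_sq; lra. }
  apply Rle_trans with (rpow z (- Re s) * (/ (y * y) * (rpow z (- (Re t - 2)) * rpow x (- (Re t - 2))))).
  - apply Rmult_le_compat_l; [left; apply rpow_pos|].
    apply Rmult_le_compat; auto; left; apply rpow_pos.
  - replace (rpow z (- Re s) * (/ (y * y) * (rpow z (- (Re t - 2)) * rpow x (- (Re t - 2)))))
      with (/ (y * y) * (rpow x (- (Re t - 2)) * (rpow z (- Re s) * rpow z (- (Re t - 2))))) by ring.
    apply Rmult_le_compat_l; [left; apply Rinv_0_lt_compat; nra|].
    apply Rmult_le_compat_l; [left; apply rpow_pos|exact B3].
Qed.

Lemma Re_minus (z w : C) : Re (z - w) = Re z - Re w.
Proof. unfold Cminus. rewrite re_plus, re_opp. reflexivity. Qed.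

Lemma theta_base (zeta : C -> C) (x : R) (K : nat) (s t : C) : is_Riemann_zeta zeta -> 0 < x -> (1 <= K)%nat ->
  8 <= Re t -> 8 <= Re s + Re t ->
  is_Theta_series x (- RtoC (INR 0)) s t (theta_main zeta x 0 K s t + theta_rem x K 0 s t)%C.
Proof.
  intros Hz Hx HK Ht Hst. pose proof (pos_INR K).
  destruct (rser_inv_sq 1 Rlt_0_1) as [B HB].
  set (a := fun n m => Theta_term x (- RtoC (INR 0)) s t (S n) (S m)).
  assert (Hb : forall n m, Cmod (a n m) <= / ((1 + INR n) * (1 + INR n)) * (rpow x (- (Re t - 2)) * / ((1 + INR m) * (1 + INR m)))).
  { intros n m. apply Theta_term_bound; auto; lra. }
  assert (HB2 : rser (fun m => rpow x (- (Re t - 2)) * / ((1 + INR m) * (1 + INR m))) (rpow x (- (Re t - 2)) * B))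
    by (apply rser_scal, HB).
  assert (Hrow : forall n, cser (a n) (CSer (a n))).
  { intros n. eapply CSer_correct; [apply (Hb n)|]. apply rser_scal, HB2. }
  exists (fun n => CSer (a n)). split.
  - intros n. apply cser_is_Cseries, Hrow.
  - apply cser_is_Cseries.
    eapply (cser_fubini a _ _ _ _ _ _ _ Hb HB HB2 Hrow).
    + intros m. apply (theta_column x K m s t); auto. lra.
    + cbv beta.
      pose proof (zeta_sum_x zeta x s (1 - t) Hz Hx ltac:(rewrite !Re_minus; cbn; lra)) as S1.
      apply (cser_scal (/ (t - 1))) in S1.
      assert (S2 : cser (fun m => psum (fun k => RtoC (zeta_neg_value k / INR (fact k)) * falling (- t) k *
           (cpow (INR (S m)) (- s) * cpow (INR (S m) * x) (- t - RtoC (INR k)))) K)%C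
         (psum (fun k => RtoC (zeta_neg_value k / INR (fact k)) * falling (- t) k * (cpow x (- t - RtoC (INR k))
            * zeta (s - (- t - RtoC (INR k))))) K)%C).
      { apply (cser_psum (fun k m => RtoC (zeta_neg_value k / INR (fact k)) * falling (- t) k *
           (cpow (INR (S m)) (- s) * cpow (INR (S m) * x) (- t - RtoC (INR k))))%C).
        intros k _. apply cser_scal. apply zeta_sum_x; auto.
        rewrite !Re_minus, re_opp, re_RtoC. pose proof (pos_INR k). lra. }
      pose proof (em_double_tail_cser K x s t Hx ltac:(lra) ltac:(lra)) as S3.
      apply (cser_scal (/ (1 - t))) in S3.
      pose proof (cser_plus _ _ _ _ (cser_plus _ _ _ _ S1 S2) S3) as S4.
      eapply cser_ext in S4.
      * match type of S4 with cser _ ?v => replace (theta_main zeta x 0 K s t + theta_rem x K 0 s t)%C with v; [exact S4|] end.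
        unfold theta_main. cbn [theta_rem]. f_equal; [f_equal|ring].
        -- unfold lead_coef. cbn [fact falling INR].
           replace (t - 1 - 0)%C with (t - 1)%C by ring. replace (0 + 1 - t)%C with (1 - t)%C by ring.
           replace (s - (1 - t))%C with (t + (s - 0 - 1))%C by ring. rewrite !Cmult_1_l. ring.
        -- apply psum_ext. intros k _. cbn [Nat.add].
           replace (s - (- t - RtoC (INR k)))%C with (t + (s + RtoC (INR k)))%C by ring. ring.
      * intros m. cbv beta. rewrite !Cmult_plus_distr_l. f_equal; [f_equal|ring]; [ring|].
        rewrite <- psum_scal. apply psum_ext. intros k _. ring.
Qed.

(** The two terms with k = 0 cancel, and those with k + 1 merge by the Pascal rule [falling_diff]
    into the term k for rho + 1. So one term is lost at each step, which is why K + 1 terms are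
    taken for rho. *)
Lemma theta_main_rec (zeta : C -> C) (x : R) (rho K : nat) (s t : C) : 0 < x -> INR rho + 3 <= Re t ->
  (theta_main zeta x rho (S K) s (t - 1) - RtoC x * theta_main zeta x rho (S K) (s - 1) t)%C
  = theta_main zeta x (S rho) K s t.
Proof.
  intros Hx Ht. unfold theta_main. rewrite <- lead_coef_rec by auto.
  assert (E0 : (t - 1 + (s - RtoC (INR rho) - 1))%C = (t + (s - RtoC (INR (S rho)) - 1))%C)
    by (rewrite S_INR, RtoC_plus; ring).
  assert (E1 : (t + (s - 1 - RtoC (INR rho) - 1))%C = (t + (s - RtoC (INR (S rho)) - 1))%C)
    by (rewrite S_INR, RtoC_plus; ring).
  assert (E2 : cpow x (RtoC (INR rho) + 1 - (t - 1)) = cpow x (RtoC (INR (S rho)) + 1 - t))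
    by (rewrite S_INR, RtoC_plus; f_equal; ring).
  assert (E3 : (RtoC x * cpow x (RtoC (INR rho) + 1 - t))%C = cpow x (RtoC (INR (S rho)) + 1 - t)).
  { rewrite <- (cpow_1 x) at 1 by auto. rewrite <- cpow_plus. f_equal. rewrite S_INR, RtoC_plus. ring. }
  rewrite E0, E1, E2.
  set (Z := zeta (t + (s - RtoC (INR (S rho)) - 1))%C). rewrite <- E3.
  assert (ES : (psum (fun k => RtoC (zeta_neg_value (rho + k) / INR (fact k)) * falling (- (t - 1)) k
       * cpow x (- (t - 1) - RtoC (INR k)) * zeta (t - 1 + (s + RtoC (INR k)))) (S K)
     - RtoC x * psum (fun k => RtoC (zeta_neg_value (rho + k) / INR (fact k)) * falling (- t) k
       * cpow x (- t - RtoC (INR k)) * zeta (t + (s - 1 + RtoC (INR k)))) (S K))%C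
    = psum (fun k => RtoC (zeta_neg_value (S rho + k) / INR (fact k)) * falling (- t) k
       * cpow x (- t - RtoC (INR k)) * zeta (t + (s + RtoC (INR k))))%C K).
  { match goal with |- (?P - RtoC x * ?Q)%C = _ => replace (P - RtoC x * Q)%C with (P + - RtoC x * Q)%C by ring end.
    rewrite <- psum_scal, <- psum_plus, psum_head.
    assert (EX : forall k, cpow x (- (t - 1) - RtoC (INR k)) = (RtoC x * cpow x (- t - RtoC (INR k)))%C).
    { intros k. rewrite <- (cpow_1 x) at 1 by auto. rewrite <- cpow_plus. f_equal. ring. }
    rewrite EX. change (falling (- (t - 1)) 0) with (RtoC 1). change (falling (- t) 0) with (RtoC 1).
    replace (t - 1 + (s + RtoC (INR 0)))%C with (t + (s - 1 + RtoC (INR 0)))%C by ring.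
    match goal with |- (?A + ?B)%C = _ => replace A with (RtoC 0) by ring end.
    rewrite Cplus_0_l. apply psum_ext. intros k _. rewrite EX.
    replace (t - 1 + (s + RtoC (INR (S k))))%C with (t + (s + RtoC (INR k)))%C by (rewrite S_INR, RtoC_plus; ring).
    replace (t + (s - 1 + RtoC (INR (S k))))%C with (t + (s + RtoC (INR k)))%C by (rewrite S_INR, RtoC_plus; ring).
    replace (- (t - 1))%C with (- t + 1)%C by ring.
    replace (rho + S k)%nat with (S rho + k)%nat by lia.
    set (zz := zeta (t + (s + RtoC (INR k)))%C).
    set (cc := zeta_neg_value (S rho + k)).
    cbv beta. transitivity (RtoC (cc / INR (fact (S k))) * (falling (- t + 1) (S k) - falling (- t) (S k)) * (RtoC x * cpow x (- t - RtoC (INR (S k)))) * zz)%C; [ring|].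
    rewrite falling_diff.
    replace (RtoC x * cpow x (- t - RtoC (INR (S k))))%C with (cpow x (- t - RtoC (INR k))).
    - change (fact (S k)) with (S k * fact k)%nat. rewrite mult_INR.
      replace (cc / INR (fact k)) with (cc / (INR (S k) * INR (fact k)) * INR (S k)).
      + rewrite (RtoC_mult _ (INR (S k))). ring.
      + field. split; [apply INR_fact_neq_0|apply not_0_INR; discriminate].
    - rewrite <- (cpow_1 x) at 1 by auto. rewrite <- cpow_plus. f_equal. rewrite S_INR, RtoC_plus. ring. }
  rewrite <- ES. ring.
Qed.

(** A step of the induction lowers Re t or Re s by 1, hence the rho in the bounds; the order rho + K
    of the remainder stays fixed while K grows. *)
Theorem theta_series (zeta : C -> C) (x : R) (rho : nat) : is_Riemann_zeta zeta -> 0 < x ->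
  forall (K : nat) (s t : C), (1 <= K)%nat -> INR rho + 8 <= Re t -> INR rho + 8 <= Re s + Re t ->
  is_Theta_series x (- RtoC (INR rho)) s t (theta_main zeta x rho K s t + theta_rem x (rho + K) rho s t)%C.
Proof.
  intros Hz Hx. induction rho as [|rho IH]; intros K s t HK Ht Hst.
  - cbn [INR] in Ht, Hst. apply theta_base; auto; lra.
  - rewrite S_INR in Ht, Hst.
    replace (theta_main zeta x (S rho) K s t + theta_rem x (S rho + K) (S rho) s t)%C with
     ((theta_main zeta x rho (S K) s (t - 1) + theta_rem x (rho + S K) rho s (t - 1))
      - RtoC x * (theta_main zeta x rho (S K) (s - 1) t + theta_rem x (rho + S K) rho (s - 1) t))%C.
    + apply Theta_series_rec; auto; apply IH; try lia; rewrite ?Re_minus, ?re_RtoC; lra.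
    + rewrite <- theta_main_rec by (auto; lra). cbn [theta_rem].
      replace (rho + S K)%nat with (S rho + K)%nat by lia. ring.
Qed.

(** * Continuation in t *)

Lemma mero_inv_hol (h : C -> C) (p : C) : hol h p -> pnear p (fun z => h z <> 0%C) -> mero (fun z => / h z)%C p.
Proof.
  intros Hh Hn. exists (fun _ => RtoC 1), h. repeat split; auto using hol_const.
  apply near_True. intros z _. unfold Cdiv. ring.
Qed.

Lemma pnear_neq (p a : C) : pnear p (fun z => z <> a).
Proof.
  destruct (classic (p = a)) as [->|Hp].
  - apply near_True. auto.
  - apply near_pnear, near_neq, Hp.
Qed.

Lemma hol_falling_comp (f : C -> C) (n : nat) (p : C) : (forall z, cdiff f z) -> hol (fun z => falling (f z) n) p.
Proof. intros H. apply cdiff_everywhere_hol. intros z. apply cdiff_falling, H. Qed.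

Lemma cdiff_minus_const (a z : C) : cdiff (fun t => t - a)%C z.
Proof. apply cdiff_minus; [apply cdiff_id|apply cdiff_const]. Qed.

Lemma cdiff_Copp (z : C) : cdiff (fun t => - t)%C z.
Proof. apply cdiff_opp, cdiff_id. Qed.

Lemma pnear_falling_neq (a : C) (n : nat) (p : C) : pnear p (fun z => falling (z - a) n <> 0%C).
Proof.
  induction n.
  - apply near_True. intros z _. apply C1_nz.
  - generalize (pnear_and _ _ _ IHn (pnear_neq p (a + RtoC (INR n))%C)). apply pnear_imp.
    intros z [H1 H2]. cbn [falling]. apply Cmult_neq_0; auto. intros E. apply H2.
    replace z with (z - a - RtoC (INR n) + (a + RtoC (INR n)))%C by ring. rewrite E. ring.
Qed.

Lemma mero_lead_coef (rho : nat) (p : C) : mero (lead_coef rho) p.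
Proof.
  apply mero_mult; [apply mero_const|]. apply mero_inv_hol; [|apply pnear_falling_neq].
  apply (hol_falling_comp (fun z => z - 1)%C). intros z; apply cdiff_minus_const.
Qed.

(** The poles are at 1, ..., rho + 1, to the right of every expansion point considered. *)
Lemma hol_lead_coef (rho : nat) (p : C) : Re p < 1 -> hol (lead_coef rho) p.
Proof.
  intros Hp. apply hol_mult; [apply hol_const|]. apply hol_inv.
  - apply (hol_falling_comp (fun z => z - 1)%C). intros z; apply cdiff_minus_const.
  - apply falling_neq_0. intros j _ E. apply (f_equal Re) in E. rewrite Re_minus, !re_RtoC in E.
    pose proof (pos_INR j). lra.
Qed.

Lemma hol_cpow_minus (x : R) (a p : C) : hol (fun t => cpow x (a - t)) p.
Proof.
  apply cdiff_everywhere_hol. intros z. apply (cdiff_cpow x (fun t => a - t)%C).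
  apply cdiff_minus; [apply cdiff_const|apply cdiff_id].
Qed.

Lemma hol_cpow_opp_minus (x : R) (a p : C) : hol (fun t => cpow x (- t - a)) p.
Proof.
  apply cdiff_everywhere_hol. intros z. apply (cdiff_cpow x (fun t => - t - a)%C).
  apply cdiff_minus; [apply cdiff_Copp|apply cdiff_const].
Qed.

Definition theta_weight (x : R) (rho k : nat) (t : C) : C :=
  (RtoC (zeta_neg_value (rho + k) / INR (fact k)) * falling (- t) k * cpow x (- t - RtoC (INR k)))%C.

Definition theta_lead (x : R) (rho : nat) (t : C) : C := (lead_coef rho t * cpow x (RtoC (INR rho) + 1 - t))%C.

Lemma hol_theta_weight (x : R) (rho k : nat) (p : C) : hol (theta_weight x rho k) p.
Proof.
  apply hol_mult; [apply hol_mult; [apply hol_const|]|apply hol_cpow_opp_minus].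
  apply (hol_falling_comp (fun z => - z)%C), cdiff_Copp.
Qed.

Lemma theta_main_eq (zeta : C -> C) (x : R) (rho K : nat) (s t : C) :
  theta_main zeta x rho K s t
  = (theta_lead x rho t * zeta (t + (s - RtoC (INR rho) - 1))
     + psum (fun k => theta_weight x rho k t * zeta (t + (s + RtoC (INR k)))) K)%C.
Proof. reflexivity. Qed.

Lemma mero_theta_main (zeta : C -> C) (x : R) (rho K : nat) (s p : C) : is_Riemann_zeta zeta ->
  mero (theta_main zeta x rho K s) p.
Proof.
  intros Hz. apply mero_plus.
  - apply mero_mult; [apply mero_mult; [apply mero_lead_coef|apply hol_mero, hol_cpow_minus]|].
    apply (mero_shift zeta), zeta_mero, Hz.
  - apply (mero_psum (fun k t => theta_weight x rho k t * zeta (t + (s + RtoC (INR k))))%C).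
    intros k _. apply mero_mult; [apply hol_mero, hol_theta_weight|].
    apply (mero_shift zeta), zeta_mero, Hz.
Qed.

Lemma mero_theta_rem (x : R) (J rho : nat) : 0 < x -> forall s p : C,
  INR rho + 1 < Re p + INR J -> INR rho + 3 < Re s + Re p + INR J -> mero (theta_rem x J rho s) p.
Proof.
  intros Hx. induction rho as [|rho IH]; intros s p H1 H2.
  - cbn [INR] in H1, H2. apply mero_mult; [apply hol_mero, em_double_tail_hol; auto; lra|].
    apply mero_inv_hol; [apply hol_one_minus|].
    generalize (pnear_neq p 1). apply pnear_imp. intros z Hz. apply Cminus_eq_contra. auto.
  - rewrite S_INR in H1, H2. cbn [theta_rem]. apply mero_minus.
    + apply (mero_shift (theta_rem x J rho s) (- (1))%C). apply IH; rewrite re_plus, re_opp, re_RtoC; lra.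
    + apply mero_mult; [apply mero_const|]. apply IH; rewrite ?Re_minus, ?re_RtoC; lra.
Qed.

Lemma cdiff_theta_rem (x : R) (J rho : nat) : 0 < x -> forall s p : C,
  INR rho + 1 < Re p + INR J -> INR rho + 3 < Re s + Re p + INR J -> Re p < 1 -> cdiff (theta_rem x J rho s) p.
Proof.
  intros Hx. induction rho as [|rho IH]; intros s p H1 H2 H3.
  - cbn [INR] in H1, H2. apply cdiff_mult; [apply hol_cdiff, em_double_tail_hol; auto; lra|].
    apply (cdiff_inv (fun t => 1 - t)%C); [apply hol_cdiff, hol_one_minus|].
    apply Cminus_eq_contra. intros <-. cbn in H3. lra.
  - rewrite S_INR in H1, H2. cbn [theta_rem]. apply cdiff_minus.
    + apply (cdiff_comp (theta_rem x J rho s) (fun t => t - 1)%C); [apply cdiff_minus_const|].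
      apply IH; rewrite Re_minus, re_RtoC; lra.
    + apply cdiff_mult; [apply cdiff_const|]. apply IH; rewrite ?Re_minus, ?re_RtoC; lra.
Qed.

(** Unfolding the recursion moves t = - N down to at most - N - rho, so J must exceed N + rho for
    all the tails involved to vanish. *)
Lemma theta_rem_zero (x : R) (J rho : nat) : 0 < x -> forall (s : C) (N : nat), (N + rho < J)%nat ->
  INR rho + 3 <= Re s - INR N + INR J -> theta_rem x J rho s (- RtoC (INR N)) = 0%C.
Proof.
  intros Hx. induction rho as [|rho IH]; intros s N H1 H2.
  - cbn [theta_rem INR] in *. rewrite em_double_tail_nat_zero; [ring|auto|lia|lra].
  - rewrite S_INR in H2. cbn [theta_rem].
    replace (- RtoC (INR N) - 1)%C with (- RtoC (INR (S N)))%C by (rewrite S_INR, RtoC_plus; ring).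
    rewrite !IH; [ring| | | |]; try lia; rewrite ?S_INR, ?Re_minus, ?re_RtoC; lra.
Qed.

(** The identity theorem is applied in t alone, with r and s fixed. Far to the right both sides are
    values of the same iterated series, hence equal by uniqueness of sums. *)
Theorem theta_continuation (zeta : C -> C) (Theta : C -> C -> C -> C) (x : R) (rho K : nat) (s p : C) :
  is_Riemann_zeta zeta -> 0 < x -> is_Theta x Theta -> (1 <= K)%nat ->
  1 < Re p + INR K -> 3 < Re s + Re p + INR K ->
  pnear p (fun t => Theta (- RtoC (INR rho))%C s t
    = (theta_main zeta x rho K s t + theta_rem x (rho + K) rho s t)%C).
Proof.
  intros Hz Hx (HT1 & _ & HT3) HK H1 H2.
  set (D := fun t => (Theta (- RtoC (INR rho))%C s t
    - (theta_main zeta x rho K s t + theta_rem x (rho + K) rho s t))%C).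
  assert (HD : pnear p (fun t => D t = 0%C)).
  (* Large enough for the right end to satisfy the hypotheses of [theta_series] and those under
     which [Theta] equals its series. *)
  { set (L := Rabs (Re p) + Rabs (Re s) + INR rho + 10).
    pose proof (Rabs_pos (Re p)). pose proof (Rabs_pos (Re s)). pose proof (pos_INR rho).
    apply (mero_identity D p L).
    - unfold L. lra.
    - intros u Hu. apply mero_minus.
      + apply meromorphic_at_mero, HT3.
      + apply mero_plus; [apply mero_theta_main, Hz|].
        apply mero_theta_rem; auto; rewrite plus_INR, re_plus, re_RtoC; lra.
    - apply near_pnear.
      assert (Hn : near (p + RtoC L)%C (fun z => INR rho + Rabs (Re s) + 9 < Re z)).
      { apply near_Re_gt. rewrite re_plus, re_RtoC. unfold L.
        pose proof (Rabs_le_between (Re p) (Rabs (Re p))) as [Hb _].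
        specialize (Hb (Rle_refl _)). lra. }
      revert Hn. apply near_imp. intros z Hn.
      pose proof (Rabs_le_between (Re s) (Rabs (Re s))) as [Hb _]. specialize (Hb (Rle_refl _)).
      assert (S1 : is_Theta_series x (- RtoC (INR rho)) s z (Theta (- RtoC (INR rho))%C s z)).
      { apply HT1; rewrite ?re_plus, ?re_opp, ?re_RtoC; lra. }
      assert (S2 := theta_series zeta x rho Hz Hx K s z HK ltac:(lra) ltac:(lra)).
      destruct S1 as [i1 [A1 B1]], S2 as [i2 [A2 B2]].
      unfold D. replace (Theta (- RtoC (INR rho))%C s z) with
        (theta_main zeta x rho K s z + theta_rem x (rho + K) rho s z)%C; [ring|].
      apply cser_is_Cseries in B1, B2. eapply cser_unique; [|exact B1].
      eapply cser_ext; [|exact B2]. intros n.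
      eapply cser_unique; apply cser_is_Cseries; [apply A2|apply A1]. }
  revert HD. apply pnear_imp. intros t HD. unfold D in HD.
  match goal with |- ?A = ?B => replace A with ((A - B) + B)%C by ring end.
  rewrite HD. ring.
Qed.

(** * Expansions up to a first-order error *)

Definition bigO (p : C) (f : C -> C) : Prop :=
  exists M, pnear p (fun t => Cmod (f t) <= M * Cmod (t - p)).

Lemma bigO_eq_up_to_O (p : C) (f g : C -> C) : bigO p (fun t => f t - g t)%C -> eq_up_to_O p f g.
Proof. intros [M H]. exists M. apply (near_locally' p). exact H. Qed.

Lemma bigO_pnear_ext (p : C) (f g : C -> C) : pnear p (fun t => f t = g t) -> bigO p f -> bigO p g.
Proof.
  intros He [M H]. exists M. generalize (pnear_and _ _ _ He H). apply pnear_imp. intros t [<- Ht]. exact Ht.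
Qed.

Lemma bigO_ext (p : C) (f g : C -> C) : (forall t, f t = g t) -> bigO p f -> bigO p g.
Proof. intros H. apply bigO_pnear_ext, near_True. auto. Qed.

Lemma bigO_plus (p : C) (f g : C -> C) : bigO p f -> bigO p g -> bigO p (fun t => f t + g t)%C.
Proof.
  intros [M H] [M' H']. exists (M + M'). generalize (pnear_and _ _ _ H H'). apply pnear_imp.
  intros t [H1 H2]. eapply Rle_trans; [apply Cmod_triangle|]. lra.
Qed.

Lemma bigO_psum (p : C) (f : nat -> C -> C) (n : nat) : (forall k, (k < n)%nat -> bigO p (f k)) ->
  bigO p (fun t => psum (fun k => f k t) n).
Proof.
  induction n; intros H; cbn [psum].
  - exists 0. apply near_True. intros t _. rewrite Cmod_0. lra.
  - apply bigO_plus; auto.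
Qed.

Lemma bigO_const (p : C) (f : C -> C) : cdiff f p -> bigO p (fun t => f t - f p)%C.
Proof. intros [l H]. exists (Cmod l + 1). apply near_pnear, cderiv_lip, H. Qed.

(** The product of a p + l h + O(h^2) with 1 / h + gamma + O(h), where h = t - p. If a p = 0 there
    is no pole, and the value l remains. *)
Lemma pole_term (zeta : C -> C) (a : C -> C) (p c l : C) : is_Riemann_zeta zeta ->
  hol a p -> cderiv a p l -> (p + c)%C = RtoC 1 ->
  bigO p (fun t => a t * zeta (t + c) - (a p / (t - p) + (a p * RtoC Euler_gamma + l)))%C.
Proof.
  intros Hz Ha Hl Hc.
  destruct (zeta_pole zeta Hz) as [K1 H1].
  assert (H1' : pnear p (fun t => Cmod (zeta (t + c)%C - / (t - p) - RtoC Euler_gamma) <= K1 * Cmod (t - p))%C).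
  { destruct H1 as [d [Hd H1]]. exists d; split; auto. intros t Ht Hne.
    assert (E : (t + c - 1)%C = (t - p)%C) by (rewrite <- Hc; ring).
    specialize (H1 (t + c)%C). rewrite E in H1. apply H1; auto.
    intros E2. apply Hne. replace t with (t + c - c)%C by ring. rewrite E2, <- Hc. ring. }
  destruct (hol_cderiv2 a p Ha) as (l2 & K2 & d & Hd & HK).
  assert (El : l2 = l) by (eapply cderiv_unique; [apply (quadratic_cderiv a p l2 K2 d Hd HK)|exact Hl]).
  subst l2.
  assert (H2 : pnear p (fun t => Cmod (a t - a p - l * (t - p)) <= K2 * (Cmod (t - p) * Cmod (t - p)) /\ t <> p)).
  { exists d; split; auto. intros t Ht Hne. split; auto. specialize (HK (t - p)%C ltac:(lra)).
    replace (p + (t - p))%C with t in HK by ring. exact HK. }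
  pose proof (near_pnear _ _ (ccont_bounded _ _ (cdiff_ccont _ _ (hol_cdiff _ _ Ha)))) as H3.
  pose proof (near_pnear _ _ (cderiv_lip _ _ _ Hl)) as H4.
  set (g := RtoC Euler_gamma) in *.
  exists ((Cmod (a p) + 1) * Rabs K1 + K2 + Cmod g * (Cmod l + 1)).
  generalize (pnear_and _ _ _ (pnear_and _ _ _ H1' H2) (pnear_and _ _ _ H3 H4)). apply pnear_imp.
  intros t [[B1 [B2 Hne]] [B3 B4]].
  set (h := (t - p)%C) in *.
  assert (Hh : h <> 0%C) by (apply Cminus_eq_contra, Hne).
  assert (Hhp : 0 < Cmod h) by (apply Cmod_gt_0, Hh).
  replace (a t * zeta (t + c) - (a p / h + (a p * g + l)))%C
    with (a t * (zeta (t + c) - / h - g) + (a t - a p - l * h) / h + g * (a t - a p))%C by (field; auto).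
  eapply Rle_trans; [apply Cmod_triangle|].
  eapply Rle_trans; [apply Rplus_le_compat_r, Cmod_triangle|].
  rewrite !Cmod_mult, Cmod_div by auto.
  assert (C1 : Cmod (a t) * Cmod (zeta (t + c)%C - / h - g) <= (Cmod (a p) + 1) * Rabs K1 * Cmod h).
  { rewrite Rmult_assoc. apply Rmult_le_compat; try apply Cmod_ge_0; [exact B3|].
    eapply Rle_trans; [exact B1|]. apply Rmult_le_compat_r; [lra|apply Rle_abs]. }
  assert (C2 : Cmod (a t - a p - l * h) / Cmod h <= K2 * Cmod h).
  { apply Rle_div_l; auto. rewrite Rmult_assoc. exact B2. }
  assert (C3 : Cmod g * Cmod (a t - a p) <= Cmod g * (Cmod l + 1) * Cmod h).
  { rewrite Rmult_assoc. apply Rmult_le_compat_l; [apply Cmod_ge_0|exact B4]. }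
  lra.
Qed.

(** * Values and derivatives at t = -N *)

Lemma cderiv_opp_minus (a z : C) : cderiv (fun t => - t - a)%C z (- (1))%C.
Proof.
  eapply cderiv_near_ext; [apply near_True; intros w; instantiate (1 := (fun w => - (1) * w + - a)%C); cbv beta; ring|].
  eapply cderiv_eq; [|apply cderiv_plus; [apply cderiv_mult; [apply cderiv_const|apply cderiv_id]|apply cderiv_const]].
  cbv beta; ring.
Qed.

Lemma cderiv_minus_const (a z : C) : cderiv (fun t => t - a)%C z 1%C.
Proof. eapply cderiv_eq; [|apply cderiv_plus; [apply cderiv_id|apply cderiv_const]]. ring. Qed.

Lemma falling_opp_nat (N k : nat) : falling (- - RtoC (INR N)) k = falling (RtoC (INR N)) k.
Proof. f_equal. ring. Qed.

(** Logarithmic derivative: the factors at t = - N are N, ..., N - k + 1, with reciprocals adding up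
    to H_N - H_(N-k). *)
Lemma falling_deriv_low (N k : nat) : (k <= N)%nat ->
  cderiv (fun t => falling (- t) k) (- RtoC (INR N))
    (- RtoC (INR (fact N) / INR (fact (N - k)) * (harmonic N - harmonic (N - k))))%C.
Proof.
  induction k; intros Hk.
  - cbn [falling]. eapply cderiv_eq; [|apply cderiv_const]. rewrite Nat.sub_0_r, Rminus_diag, Rmult_0_r. ring.
  - cbn [falling]. eapply cderiv_eq; [|apply cderiv_mult; [apply IHk; lia|apply cderiv_opp_minus]].
    cbv beta. rewrite falling_opp_nat, falling_nat by lia.
    replace (- - RtoC (INR N) - RtoC (INR k))%C with (RtoC (INR (N - k))) by (rewrite minus_INR, RtoC_minus by lia; ring).
    replace (N - k)%nat with (S (N - S k)) by lia. set (j := (N - S k)%nat).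
    rewrite harmonic_S. change (fact (S j)) with (S j * fact j)%nat. rewrite mult_INR.
    rewrite <- !RtoC_opp, <- !RtoC_mult, <- RtoC_plus. f_equal.
    field. split; [apply INR_fact_neq_0|apply not_0_INR; discriminate].
Qed.

(** Just one factor, - t - N, vanishes at t = - N, so the derivative is minus the product of the
    others: N! from those before it and (-1)^j j! from those after it. *)
Lemma falling_deriv_high (N j : nat) :
  cderiv (fun t => falling (- t) (S (N + j))) (- RtoC (INR N))
    (- RtoC (INR (fact N) * ((-1) ^ j * INR (fact j))))%C.
Proof.
  induction j.
  - rewrite Nat.add_0_r. cbn [falling].
    eapply cderiv_eq; [|apply cderiv_mult; [apply (falling_deriv_low N N); lia|apply cderiv_opp_minus]].
    cbv beta. rewrite falling_opp_nat, falling_nat, Nat.sub_diag by lia. change (INR (fact 0)) with 1. cbn [pow].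
    rewrite Rdiv_1_r, !Rmult_1_r. ring.
  - replace (S (N + S j)) with (S (S (N + j))) by lia.
    change (fun t => falling (- t) (S (S (N + j)))) with (fun t => falling (- t) (S (N + j)) * (- t - RtoC (INR (S (N + j)))))%C.
    eapply cderiv_eq; [|apply cderiv_mult; [apply IHj|apply cderiv_opp_minus]].
    cbv beta. rewrite falling_opp_nat, falling_nat_zero by lia.
    change (fact (S j)) with (S j * fact j)%nat. rewrite mult_INR, S_INR, plus_INR, S_INR.
    cbn [pow]. rewrite !RtoC_mult, !RtoC_plus.
    replace (RtoC (-1)) with (- (1))%C by (rewrite <- RtoC_opp; f_equal; ring). ring.
Qed.

Lemma falling_neg_value (N n : nat) :
  falling (- RtoC (INR N) - 1) n = RtoC ((-1) ^ n * (INR (fact (N + n)) / INR (fact N))).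
Proof.
  induction n.
  - rewrite Nat.add_0_r. cbn [falling pow]. f_equal. field. apply INR_fact_neq_0.
  - cbn [falling]. rewrite IHn, Nat.add_succ_r. change (fact (S (N + n))) with (S (N + n) * fact (N + n))%nat.
    rewrite mult_INR, S_INR, plus_INR. cbn [pow].
    replace (- RtoC (INR N) - 1 - RtoC (INR n))%C with (RtoC (- (INR N + INR n + 1)))
      by (rewrite RtoC_opp, !RtoC_plus; ring).
    rewrite <- RtoC_mult. f_equal. field. apply INR_fact_neq_0.
Qed.

(** Again a logarithmic derivative: the factors are - (N + 1), ..., - (N + n). *)
Lemma falling_neg_deriv (N n : nat) :
  cderiv (fun t => falling (t - 1) n) (- RtoC (INR N))
    (- (falling (- RtoC (INR N) - 1) n * RtoC (harmonic (N + n) - harmonic N)))%C.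
Proof.
  induction n.
  - rewrite Nat.add_0_r, Rminus_diag. cbn [falling]. eapply cderiv_eq; [|apply cderiv_const]. ring.
  - cbn [falling]. eapply cderiv_eq; [|apply cderiv_mult; [apply IHn|]].
    2: { eapply cderiv_near_ext; [apply near_True; intros w; instantiate (1 := (fun w => w - (1 + RtoC (INR n)))%C); cbv beta; ring|].
         apply cderiv_minus_const. }
    cbv beta. rewrite Nat.add_succ_r, harmonic_S.
    set (F := falling (- RtoC (INR N) - 1) n). set (H1 := harmonic (N + n)). set (H0 := harmonic N).
    replace (- RtoC (INR N) - (1 + RtoC (INR n)))%C with (- RtoC (INR (S (N + n))))%C
      by (rewrite S_INR, plus_INR, !RtoC_plus; ring).
    replace (- RtoC (INR N) - 1 - RtoC (INR n))%C with (- RtoC (INR (S (N + n))))%C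
      by (rewrite S_INR, plus_INR, !RtoC_plus; ring).
    pose proof (INR_RtoC_S_neq (N + n)) as Hn.
    rewrite !RtoC_minus, RtoC_plus, RtoC_inv by (apply not_0_INR; discriminate).
    field. exact Hn.
Qed.

Definition lead_value (rho N : nat) : R :=
  (-1) ^ S rho * (INR (fact rho) * INR (fact N) / INR (fact (N + S rho))).

Lemma pow_m1_sq (n : nat) : (-1) ^ n * (-1) ^ n = 1.
Proof. rewrite <- Rpow_mult_distr. replace (-1 * -1) with 1 by ring. apply pow1. Qed.

Lemma lead_coef_value (rho N : nat) : lead_coef rho (- RtoC (INR N)) = RtoC (lead_value rho N).
Proof.
  unfold lead_coef. rewrite falling_neg_value.
  pose proof (pow_m1_sq (S rho)) as E. set (sg := (-1) ^ S rho) in *.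
  pose proof (INR_fact_neq_0 N). pose proof (INR_fact_neq_0 (N + S rho)).
  assert (Hs : sg <> 0) by (intros E0; rewrite E0 in E; lra).
  rewrite <- RtoC_inv, <- RtoC_mult.
  - f_equal. unfold lead_value. fold sg.
    replace (/ (sg * (INR (fact (N + S rho)) / INR (fact N)))) with (sg * sg / (sg * (INR (fact (N + S rho)) / INR (fact N))))
      by (rewrite E; unfold Rdiv; ring).
    field. auto.
  - apply Rmult_integral_contrapositive_currified; auto.
    apply Rmult_integral_contrapositive_currified; auto. apply Rinv_neq_0_compat; auto.
Qed.

Lemma lead_coef_deriv (rho N : nat) :
  cderiv (lead_coef rho) (- RtoC (INR N)) (RtoC (lead_value rho N * (harmonic (N + S rho) - harmonic N))).
Proof.
  assert (Hn : falling (- RtoC (INR N) - 1) (S rho) <> 0%C).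
  { apply falling_neq_0. intros j _ E. apply (f_equal Re) in E. rewrite Re_minus, re_opp, !re_RtoC in E.
    pose proof (pos_INR j). pose proof (pos_INR N). lra. }
  unfold lead_coef. eapply cderiv_eq; [|apply cderiv_mult; [apply cderiv_const|
    apply (cderiv_inv (fun t => falling (t - 1) (S rho))); [apply falling_neg_deriv|exact Hn]]].
  cbv beta. rewrite RtoC_mult, <- lead_coef_value. unfold lead_coef. field. exact Hn.
Qed.

Lemma cpow_INR (x : R) (z : C) (n : nat) : 0 < x -> z = RtoC (INR n) -> cpow x z = RtoC (x ^ n).
Proof. intros Hx ->. apply cpow_nat, Hx. Qed.

Lemma theta_lead_value (x : R) (rho N : nat) : 0 < x ->
  theta_lead x rho (- RtoC (INR N)) = RtoC (lead_value rho N * x ^ (N + S rho)).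
Proof.
  intros Hx. unfold theta_lead. rewrite lead_coef_value, RtoC_mult. f_equal.
  apply cpow_INR; auto. rewrite plus_INR, S_INR, !RtoC_plus. ring.
Qed.

Lemma cderiv_cpow_minus (x : R) (a z : C) :
  cderiv (fun t => cpow x (a - t)) z (- (cpow x (a - z) * RtoC (ln x)))%C.
Proof.
  eapply cderiv_near_ext; [apply near_True; intros w; instantiate (1 := (fun w => cpow x (- w - - a))%C); cbv beta; f_equal; ring|].
  eapply cderiv_eq; [|apply (cderiv_comp (cpow x) (fun w => - w - - a)%C); [apply cderiv_opp_minus|apply cderiv_cpow]].
  cbv beta. replace (- z - - a)%C with (a - z)%C by ring. ring.
Qed.

Lemma theta_lead_deriv (x : R) (rho N : nat) : 0 < x ->
  cderiv (theta_lead x rho) (- RtoC (INR N))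
    (RtoC (lead_value rho N * x ^ (N + S rho) * (harmonic (N + S rho) - harmonic N - ln x))).
Proof.
  intros Hx. unfold theta_lead.
  eapply cderiv_eq; [|apply cderiv_mult; [apply lead_coef_deriv|apply cderiv_cpow_minus]].
  cbv beta. rewrite lead_coef_value.
  rewrite (cpow_INR x _ (N + S rho)) by (auto; rewrite plus_INR, S_INR, !RtoC_plus; ring).
  rewrite <- !RtoC_mult, <- RtoC_opp, <- RtoC_mult, <- RtoC_plus. f_equal. ring.
Qed.

Definition weight_value (x : R) (rho N k : nat) : R :=
  zeta_neg_value (rho + k) * (INR (fact N) / (INR (fact k) * INR (fact (N - k)))) * x ^ (N - k).

Lemma theta_weight_low (x : R) (rho N k : nat) : 0 < x -> (k <= N)%nat ->
  theta_weight x rho k (- RtoC (INR N)) = RtoC (weight_value x rho N k).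
Proof.
  intros Hx Hk. unfold theta_weight. rewrite falling_opp_nat, falling_nat by auto.
  rewrite (cpow_INR x _ (N - k)) by (auto; rewrite minus_INR, RtoC_minus by auto; ring).
  rewrite <- !RtoC_mult. f_equal. unfold weight_value. field. split; apply INR_fact_neq_0.
Qed.

Lemma theta_weight_high (x : R) (rho N k : nat) : (N < k)%nat -> theta_weight x rho k (- RtoC (INR N)) = 0%C.
Proof. intros Hk. unfold theta_weight. rewrite falling_opp_nat, falling_nat_zero by auto. ring. Qed.

Lemma cderiv_cpow_opp_minus (x : R) (a z : C) :
  cderiv (fun t => cpow x (- t - a)) z (- (cpow x (- z - a) * RtoC (ln x)))%C.
Proof.
  eapply cderiv_eq; [|apply (cderiv_comp (cpow x) (fun w => - w - a)%C); [apply cderiv_opp_minus|apply cderiv_cpow]].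
  cbv beta. ring.
Qed.

Lemma theta_weight_deriv_low (x : R) (rho N k : nat) : 0 < x -> (k <= N)%nat ->
  cderiv (theta_weight x rho k) (- RtoC (INR N))
    (RtoC (weight_value x rho N k * (harmonic (N - k) - harmonic N - ln x))).
Proof.
  intros Hx Hk. unfold theta_weight.
  eapply cderiv_eq; [|apply cderiv_mult; [apply cderiv_mult; [apply cderiv_const|apply falling_deriv_low, Hk]|apply cderiv_cpow_opp_minus]].
  cbv beta. rewrite falling_opp_nat, falling_nat by auto.
  rewrite (cpow_INR x _ (N - k)) by (auto; rewrite minus_INR, RtoC_minus by auto; ring).
  rewrite <- !RtoC_opp, <- !RtoC_mult, <- ?RtoC_opp, <- ?RtoC_plus, <- ?RtoC_mult, <- ?RtoC_plus, <- ?RtoC_mult, <- ?RtoC_opp, <- ?RtoC_mult, <- ?RtoC_plus. f_equal.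
  unfold weight_value. field. split; apply INR_fact_neq_0.
Qed.

Lemma theta_weight_deriv_high (x : R) (rho N j : nat) : 0 < x ->
  cderiv (theta_weight x rho (S (N + j))) (- RtoC (INR N))
    (RtoC (- (zeta_neg_value (rho + S (N + j)) * (-1) ^ j * (INR (fact N) * INR (fact j) / INR (fact (S (N + j)))) / x ^ S j))).
Proof.
  intros Hx. unfold theta_weight.
  eapply cderiv_eq; [|apply cderiv_mult; [apply cderiv_mult; [apply cderiv_const|apply falling_deriv_high]|apply cderiv_cpow_opp_minus]].
  cbv beta. rewrite falling_opp_nat, falling_nat_zero by lia.
  assert (Ec : cpow x (- - RtoC (INR N) - RtoC (INR (S (N + j)))) = RtoC (/ x ^ S j)).
  { rewrite RtoC_inv by (apply pow_nonzero; lra). rewrite <- cpow_nat, <- cpow_opp by auto. f_equal.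
    rewrite !S_INR, plus_INR, !RtoC_plus. ring. }
  rewrite Ec.
  transitivity (RtoC (zeta_neg_value (rho + S (N + j)) / INR (fact (S (N + j)))) * RtoC (- (INR (fact N) * ((-1) ^ j * INR (fact j)))) * RtoC (/ x ^ S j))%C.
  - rewrite RtoC_opp. ring.
  - rewrite <- !RtoC_mult. f_equal. field. repeat split; try apply INR_fact_neq_0; try apply pow_nonzero; lra.
Qed.

(** * The Gamma integral *)

(** The primitive of u^n exp (- u) given by integration by parts, normalized to vanish at
    infinity. *)
Fixpoint gamma_prim (n : nat) (u : R) : R :=
  match n with
  | O => - exp (- u)
  | S m => - (u ^ S m * exp (- u)) + INR (S m) * gamma_prim m u
  end.

Lemma gamma_prim_derive (n : nat) (u : R) : is_derive (gamma_prim n) u (u ^ n * exp (- u)).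
Proof.
  induction n.
  - cbn [gamma_prim pow]. auto_derive; auto. ring.
  - cbn [gamma_prim].
    replace (u ^ S n * exp (- u)) with
      ((- (INR (S n) * u ^ n * exp (- u)) + u ^ S n * exp (- u)) + INR (S n) * (u ^ n * exp (- u))) by ring.
    apply (is_derive_plus (K := R_AbsRing) (V := R_NormedModule)).
    + auto_derive; auto.
      change (match n with 0%nat => 1 | S _ => INR n + 1 end) with (INR (S n)). cbn [pow]. ring.
    + apply (is_derive_scal (gamma_prim n)). exact IHn.
Qed.

Lemma gamma_prim_0 (n : nat) : gamma_prim n 0 = - INR (fact n).
Proof.
  induction n.
  - cbn. rewrite Ropp_0, exp_0. reflexivity.
  - cbn [gamma_prim]. rewrite IHn, pow_i by lia. change (fact (S n)) with (S n * fact n)%nat.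
    rewrite mult_INR. ring.
Qed.

(** With m = n + 1, exp u is the m-th power of exp (u / m), which is at least u / m. *)
Lemma pow_exp_opp_bound (n : nat) (u : R) : 0 < u -> u ^ n * exp (- u) <= INR (S n) ^ S n * / u.
Proof.
  intros Hu. set (m := INR (S n)). assert (Hm : 0 < m) by (apply lt_0_INR; lia).
  assert (He : (u / m) ^ S n <= exp u).
  { replace (exp u) with (exp (u / m) ^ S n).
    - apply pow_incr. pose proof (exp_ineq1_le (u / m)).
      assert (0 < u / m) by (apply Rdiv_lt_0_compat; auto). lra.
    - rewrite <- Rpower_pow by apply exp_pos. unfold Rpower. rewrite ln_exp. f_equal.
      fold m. field. lra. }
  rewrite exp_Ropp. pose proof (exp_pos u).
  assert (Hmn : 0 < m ^ S n) by (apply pow_lt; auto).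
  apply Rmult_le_reg_r with (exp u * u); [nra|].
  replace (u ^ n * / exp u * (exp u * u)) with (u ^ S n) by (cbn [pow]; field; lra).
  replace (m ^ S n * / u * (exp u * u)) with (m ^ S n * exp u) by (field; lra).
  replace (u ^ S n) with (m ^ S n * (u / m) ^ S n).
  - apply Rmult_le_compat_l; lra.
  - rewrite <- Rpow_mult_distr. f_equal. field. lra.
Qed.

Lemma gamma_prim_lim (n : nat) : is_lim (gamma_prim n) p_infty 0.
Proof.
  assert (HP : forall k, is_lim (fun u => u ^ k * exp (- u)) p_infty 0).
  { intros k. apply (is_lim_le_le_loc (fun _ => 0) (fun u => INR (S k) ^ S k * / u)).
    - exists 0. intros u Hu. split; [|apply pow_exp_opp_bound; auto].
      apply Rmult_le_pos; [apply pow_le; lra|left; apply exp_pos].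
    - apply is_lim_const.
    - replace (Finite 0) with (Rbar_mult (INR (S k) ^ S k) 0) by (cbn; f_equal; ring).
      apply is_lim_scal_l. apply (is_lim_inv (fun u => u) p_infty p_infty); [apply is_lim_id|discriminate]. }
  induction n.
  - cbn [gamma_prim].
    apply is_lim_ext with (fun u => - (u ^ 0 * exp (- u))); [intros; cbn; ring|].
    replace (Finite 0) with (Rbar_opp 0) by (cbn; f_equal; ring). apply is_lim_opp, HP.
  - cbn [gamma_prim]. replace (Finite 0) with (Rbar_plus (Rbar_opp 0) (Rbar_mult (INR (S n)) 0)) by (cbn -[INR]; f_equal; ring).
    apply is_lim_plus with (Rbar_opp 0) (Rbar_mult (INR (S n)) 0).
    + apply is_lim_opp, HP.
    + apply is_lim_scal_l, IHn.
    + reflexivity.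
Qed.

Lemma Gamma_fact (n : nat) : Gamma (1 + INR n) = INR (fact n).
Proof.
  unfold Gamma. apply (is_RInt_gen_unique (V := R_CompleteNormedModule)).
  assert (HD : forall u, Derive (gamma_prim n) u = u ^ n * exp (- u)).
  { intros u. apply is_derive_unique, gamma_prim_derive. }
  apply (is_RInt_gen_ext (Derive (gamma_prim n))).
  (* Both bounds are kept positive because [Rpower] agrees with the natural power only for a
     positive base. *)
  - apply (Filter_prod _ _ _ (fun a => 0 < a) (fun b => 0 < b)).
    + exists (mkposreal 1 Rlt_0_1). intros y _ Hy. exact Hy.
    + exists 0. auto.
    + intros a b Ha Hb u Hu. cbn [fst snd] in Hu.
      assert (0 < u) by (eapply Rlt_trans; [|apply Hu]; apply Rmin_glb_lt; auto).
      rewrite HD. replace (1 + INR n - 1) with (INR n) by ring. rewrite Rpower_pow; auto.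
  - replace (INR (fact n)) with (0 - - INR (fact n)) by ring.
    apply is_RInt_gen_Derive.
    + apply (Filter_prod _ _ _ (fun _ => True) (fun _ => True)).
      * apply filter_true. * apply filter_true.
      * intros a b _ _ u _. eexists. apply gamma_prim_derive.
    + apply (Filter_prod _ _ _ (fun _ => True) (fun _ => True)).
      * apply filter_true. * apply filter_true.
      * intros a b _ _ u _. apply continuous_ext with (fun u => u ^ n * exp (- u)); [intros; symmetry; apply HD|].
        apply (ex_derive_continuous (K := R_AbsRing) (V := R_NormedModule)). auto_derive. auto.
    + rewrite <- gamma_prim_0.
      assert (Hc : continuous (gamma_prim n) 0).
      { apply (ex_derive_continuous (K := R_AbsRing) (V := R_NormedModule)). eexists; apply gamma_prim_derive. }
      intros P HP. specialize (Hc P HP). unfold filtermap in *.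
      destruct Hc as [e He]. exists e. intros u Hu _. apply He, Hu.
    + apply gamma_prim_lim.
Qed.

(** * Expansion at t = -N *)

Lemma psum_trunc (b : nat -> C) (M K : nat) : (M <= K)%nat ->
  (forall k, (M <= k < K)%nat -> b k = 0%C) -> psum b K = psum b M.
Proof.
  intros HMK. induction K; intros H.
  - replace M with 0%nat by lia. reflexivity.
  - destruct (Nat.eq_dec M (S K)) as [->|Hn]; [reflexivity|].
    cbn [psum]. rewrite IHK by (lia || intros; apply H; lia). rewrite H by lia. ring.
Qed.

Lemma psum_extract (b : nat -> C) (c : C) (k0 K : nat) : (k0 < K)%nat ->
  psum (fun k => if Nat.eqb k k0 then c else b k) K
  = (psum (fun k => if Nat.eqb k k0 then RtoC 0 else b k) K + c)%C.
Proof.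
  induction K; intros H; [lia|]. cbn [psum].
  destruct (Nat.eqb_spec K k0) as [->|Hn].
  - rewrite (psum_ext (fun k => if Nat.eqb k k0 then c else b k) (fun k => if Nat.eqb k k0 then RtoC 0 else b k)).
    + ring.
    + intros k Hk. destruct (Nat.eqb_spec k k0); [lia|reflexivity].
  - rewrite IHK by lia. ring.
Qed.

Lemma bigO_psum_minus (p : C) (f V : nat -> C -> C) (K : nat) :
  (forall k, (k < K)%nat -> bigO p (fun t => f k t - V k t)%C) ->
  bigO p (fun t => psum (fun k => f k t) K - psum (fun k => V k t) K)%C.
Proof.
  intros H. eapply bigO_ext; [|apply (bigO_psum p (fun k t => f k t - V k t)%C K H)].
  intros t. cbv beta. clear H. induction K; cbn [psum]; [ring|]. rewrite IHK. ring.
Qed.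

Lemma term_regular (zeta : C -> C) (a : C -> C) (p c : C) : is_Riemann_zeta zeta ->
  cdiff a p -> (p + c)%C <> RtoC 1 ->
  bigO p (fun t => a t * zeta (t + c) - a p * zeta (p + c))%C.
Proof.
  intros Hz Ha Hc. apply (bigO_const p (fun t => a t * zeta (t + c))%C).
  apply cdiff_mult; auto. apply (cdiff_comp zeta (fun t => t + c)%C).
  - apply cdiff_plus; [apply cdiff_id|apply cdiff_const].
  - apply hol_cdiff, zeta_hol; auto.
Qed.

Definition sum_term (zeta : C -> C) (x : R) (rho N : nat) (s : C) (k : nat) : C :=
  (RtoC (weight_value x rho N k) * zeta (- RtoC (INR N) + (s + RtoC (INR k))))%C.

(** At t = - N the weights beyond N are zero, so the result does not depend on the truncation K. The
    predicate [b] leaves room for removing the index of the pole. *)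
Lemma weight_term_value (zeta : C -> C) (x : R) (rho N K : nat) (s : C) (b : nat -> bool) : 0 < x -> (N < K)%nat ->
  psum (fun k => if b k then RtoC 0 else theta_weight x rho k (- RtoC (INR N)) * zeta (- RtoC (INR N) + (s + RtoC (INR k))))%C K
  = psum (fun k => if b k then RtoC 0 else sum_term zeta x rho N s k) (S N).
Proof.
  intros Hx HK. rewrite (psum_trunc _ (S N) K) by
    (lia || (intros k Hk; destruct (b k); auto; rewrite theta_weight_high by lia; ring)).
  apply psum_ext. intros k Hk. destruct (b k); auto.
  rewrite theta_weight_low by (auto; lia). reflexivity.
Qed.

Lemma sum_regular (zeta : C -> C) (x : R) (rho N K : nat) (s : C) : is_Riemann_zeta zeta -> 0 < x ->
  (N < K)%nat -> (forall k, (- RtoC (INR N) + (s + RtoC (INR k)))%C <> RtoC 1) ->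
  bigO (- RtoC (INR N)) (fun t => psum (fun k => theta_weight x rho k t * zeta (t + (s + RtoC (INR k)))) K
     - psum (sum_term zeta x rho N s) (S N))%C.
Proof.
  intros Hz Hx HK Hs.
  assert (E : psum (sum_term zeta x rho N s) (S N) = psum (fun k => theta_weight x rho k (- RtoC (INR N)) * zeta (- RtoC (INR N) + (s + RtoC (INR k))))%C K)
    by (symmetry; apply (weight_term_value zeta x rho N K s (fun _ => false) Hx HK)).
  rewrite E.
  apply bigO_psum_minus with (V := fun k _ => (theta_weight x rho k (- RtoC (INR N)) * zeta (- RtoC (INR N) + (s + RtoC (INR k))))%C).
  intros k _. apply term_regular; auto. apply hol_cdiff, hol_theta_weight.
Qed.

(** The arguments of zeta are distinct, so [k0] is the only index at the pole. Nothing is assumed on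
    whether [k0] exceeds N, which lets the same statement serve both when the weight vanishes there
    and when it does not. *)
Lemma sum_pole (zeta : C -> C) (x : R) (rho N K k0 : nat) (s l : C) : is_Riemann_zeta zeta -> 0 < x ->
  (N < K)%nat -> (k0 < K)%nat -> (- RtoC (INR N) + (s + RtoC (INR k0)))%C = RtoC 1 ->
  cderiv (theta_weight x rho k0) (- RtoC (INR N)) l ->
  bigO (- RtoC (INR N)) (fun t => psum (fun k => theta_weight x rho k t * zeta (t + (s + RtoC (INR k)))) K
     - (psum (fun k => if Nat.eqb k k0 then RtoC 0 else sum_term zeta x rho N s k) (S N)
        + (theta_weight x rho k0 (- RtoC (INR N)) / (t - - RtoC (INR N))
           + (theta_weight x rho k0 (- RtoC (INR N)) * RtoC Euler_gamma + l))))%C.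
Proof.
  intros Hz Hx HK Hk0 Hs Hl. set (T := (- RtoC (INR N))%C) in *.
  set (P := fun t => (theta_weight x rho k0 T / (t - T) + (theta_weight x rho k0 T * RtoC Euler_gamma + l))%C).
  set (V := fun k t => if Nat.eqb k k0 then P t else (theta_weight x rho k T * zeta (T + (s + RtoC (INR k))))%C).
  apply bigO_ext with (fun t => psum (fun k => theta_weight x rho k t * zeta (t + (s + RtoC (INR k)))) K - psum (fun k => V k t) K)%C.
  - intros t. unfold V. rewrite psum_extract by auto.
    pose proof (weight_term_value zeta x rho N K s (fun k => Nat.eqb k k0) Hx HK) as E.
    fold T in E. rewrite E. reflexivity.
  - apply bigO_psum_minus with (V := V). intros k _. unfold V.
    destruct (Nat.eqb_spec k k0) as [->|Hn].
    + apply pole_term; auto. apply hol_theta_weight.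
    + apply term_regular; auto; [apply hol_cdiff, hol_theta_weight|].
      intros E. apply Hn. apply INR_eq, RtoC_inj.
      replace (RtoC (INR k)) with (T + (s + RtoC (INR k)) - (T + s))%C by ring.
      rewrite E, <- Hs. ring.
Qed.

(** Reduces each case to separate expansions P of the leading term and Q of the sum. The truncation
    K must be large for the remainder to be negligible and must exceed [k0] for the sum to contain
    the polar index. *)
Lemma theta_asymptotic (zeta : C -> C) (Theta : C -> C -> C -> C) (x : R) (rho N : nat) (s : C) :
  is_Riemann_zeta zeta -> 0 < x -> is_Theta x Theta ->
  forall k0, exists K, (N < K)%nat /\ (k0 < K)%nat /\
  forall P Q : C -> C,
  bigO (- RtoC (INR N)) (fun t => theta_lead x rho t * zeta (t + (s - RtoC (INR rho) - 1)) - P t)%C ->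
  bigO (- RtoC (INR N)) (fun t => psum (fun k => theta_weight x rho k t * zeta (t + (s + RtoC (INR k)))) K - Q t)%C ->
  bigO (- RtoC (INR N)) (fun t => Theta (- RtoC (INR rho))%C s t - (P t + Q t))%C.
Proof.
  intros Hz Hx HT k0. set (T := (- RtoC (INR N))%C).
  assert (ET : Re T = - INR N) by reflexivity. pose proof (pos_INR N).
  destruct (INR_unbounded (INR N + Rabs (Re s) + 4)) as [K1 HK1].
  exists (K1 + N + k0 + 1)%nat. split; [lia|]. split; [lia|]. intros P Q HP HQ.
  set (K := (K1 + N + k0 + 1)%nat) in *.
  assert (HK : INR K1 <= INR K) by (apply le_INR; unfold K; lia).
  pose proof (Rabs_le_between (Re s) (Rabs (Re s))) as [Hb _]. specialize (Hb (Rle_refl _)).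
  pose proof (theta_continuation zeta Theta x rho K s T Hz Hx HT ltac:(unfold K; lia) ltac:(lra) ltac:(lra)) as HC.
  (* The remainder is differentiable at T and vanishes there, hence is O(|t - T|). *)
  assert (HR : bigO T (fun t => theta_rem x (rho + K) rho s t)).
  { apply bigO_ext with (fun t => theta_rem x (rho + K) rho s t - theta_rem x (rho + K) rho s T)%C.
    - intros t. unfold T. rewrite (theta_rem_zero x (rho + K) rho Hx s N); [ring|unfold K; lia|rewrite plus_INR; lra].
    - apply bigO_const. apply cdiff_theta_rem; auto; rewrite ?plus_INR, ET; lra. }
  eapply bigO_pnear_ext; [|apply (bigO_plus _ _ _ (bigO_plus _ _ _ HP HQ) HR)].
  revert HC. apply pnear_imp. intros t ->. rewrite theta_main_eq. ring.
Qed.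

Lemma lead_regular (zeta : C -> C) (x : R) (rho N : nat) (s : C) : is_Riemann_zeta zeta -> 0 < x ->
  (- RtoC (INR N) + (s - RtoC (INR rho) - 1))%C <> RtoC 1 ->
  bigO (- RtoC (INR N)) (fun t => theta_lead x rho t * zeta (t + (s - RtoC (INR rho) - 1))
    - RtoC (lead_value rho N * x ^ (N + S rho)) * zeta (- RtoC (INR N) + (s - RtoC (INR rho) - 1)))%C.
Proof.
  intros Hz Hx Hs. rewrite <- theta_lead_value by auto. apply term_regular; auto.
  eexists. apply theta_lead_deriv, Hx.
Qed.

Lemma lead_pole (zeta : C -> C) (x : R) (rho N : nat) (s : C) : is_Riemann_zeta zeta -> 0 < x ->
  (- RtoC (INR N) + (s - RtoC (INR rho) - 1))%C = RtoC 1 ->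
  bigO (- RtoC (INR N)) (fun t => theta_lead x rho t * zeta (t + (s - RtoC (INR rho) - 1))
    - (RtoC (lead_value rho N * x ^ (N + S rho)) / (t - - RtoC (INR N))
       + (RtoC (lead_value rho N * x ^ (N + S rho)) * RtoC Euler_gamma
          + RtoC (lead_value rho N * x ^ (N + S rho) * (harmonic (N + S rho) - harmonic N - ln x)))))%C.
Proof.
  intros Hz Hx Hs. rewrite <- theta_lead_value by auto. apply pole_term; auto.
  - apply hol_mult; [apply hol_lead_coef; rewrite re_opp, re_RtoC; pose proof (pos_INR N); lra|apply hol_cpow_minus].
  - apply theta_lead_deriv, Hx.
Qed.

(** * Integer parameters *)

Lemma IZC_nat (n : nat) : IZC (Z.of_nat n) = RtoC (INR n).
Proof. unfold IZC. rewrite INR_IZR_INZ. reflexivity. Qed.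

Lemma IZC_plus (a b : Z) : IZC (a + b) = (IZC a + IZC b)%C.
Proof. unfold IZC. rewrite plus_IZR, RtoC_plus. reflexivity. Qed.

Lemma IZC_opp (a : Z) : IZC (- a) = (- IZC a)%C.
Proof. unfold IZC. rewrite opp_IZR, RtoC_opp. reflexivity. Qed.

Lemma IZC_minus (a b : Z) : IZC (a - b) = (IZC a - IZC b)%C.
Proof. unfold Z.sub. rewrite IZC_plus, IZC_opp. reflexivity. Qed.

Lemma IZC_inj (a b : Z) : IZC a = IZC b -> a = b.
Proof. intros H. apply eq_IZR, RtoC_inj, H. Qed.

Lemma Zfact_nat (z : Z) (n : nat) : z = Z.of_nat n -> Zfact z = INR (fact n).
Proof. intros ->. unfold Zfact. rewrite Nat2Z.id. reflexivity. Qed.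

Lemma zeta_IZC_neg (zeta : C -> C) (z : Z) (q : nat) : is_Riemann_zeta zeta -> z = (- Z.of_nat q)%Z ->
  zeta (IZC z) = RtoC (zeta_neg_value q).
Proof. intros Hz ->. rewrite IZC_opp, IZC_nat. apply zeta_neg, Hz. Qed.

Lemma powerRZ_nat_opp (x : R) (z : Z) (n : nat) : 0 < x -> z = (- Z.of_nat n)%Z -> powerRZ x z = / x ^ n.
Proof. intros Hx ->. rewrite powerRZ_neg', <- pow_powerRZ. reflexivity. Qed.

Lemma powerRZ_m1_opp (z : Z) (n : nat) : z = (- Z.of_nat n)%Z -> powerRZ (-1) z = (-1) ^ n.
Proof.
  intros ->. rewrite powerRZ_neg', <- pow_powerRZ.
  pose proof (pow_m1_sq n) as E. set (a := (-1) ^ n) in *.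
  apply Rmult_eq_reg_l with a; [|intros H; rewrite H in E; lra].
  rewrite E. apply Rinv_r. intros H; rewrite H in E; lra.
Qed.

Lemma Csum_psum (a b : nat -> C) (n : nat) : (forall k, (k <= n)%nat -> a k = b k) -> Csum a n = psum b (S n).
Proof. intros H. unfold Csum. rewrite sum_n_psum. apply psum_ext. intros k Hk. apply H. lia. Qed.

Lemma IZC_1 : IZC 1 = RtoC 1.
Proof. reflexivity. Qed.

Ltac push_IZC :=
  repeat progress (rewrite ?IZC_minus, ?IZC_plus, ?IZC_opp, ?IZC_nat, ?IZC_1, ?plus_INR, ?S_INR, ?RtoC_plus).

Lemma weight_value_frac (x : R) (rho N k : nat) : 0 < x -> (k <= N)%nat ->
  weight_value x rho N k
  = INR (fact N) * zeta_neg_value (rho + k) / (/ x ^ (N - k) * INR (fact k) * INR (fact (N - k))).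
Proof.
  intros Hx Hk. unfold weight_value. field.
  repeat split; try apply INR_fact_neq_0. apply pow_nonzero; lra.
Qed.

Lemma weight_denominator_neq_0 (x : R) (N k : nat) : 0 < x ->
  / x ^ (N - k) * INR (fact k) * INR (fact (N - k)) <> 0.
Proof.
  intros Hx. repeat apply Rmult_integral_contrapositive_currified; try apply INR_fact_neq_0.
  apply Rinv_neq_0_compat, pow_nonzero; lra.
Qed.

(** * The four cases for r = - rho, t0 = - N and l = N + rho + 1 *)

Lemma theta_case_I (zeta : C -> C) (Theta : C -> C -> C -> C) (x : R) (rho N : nat) (s : C) :
  is_Riemann_zeta zeta -> 0 < x -> is_Theta x Theta ->
  (forall k, (- RtoC (INR N) + (s + RtoC (INR k)))%C <> RtoC 1) ->
  (- RtoC (INR N) + (s - RtoC (INR rho) - 1))%C <> RtoC 1 ->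
  bigO (- RtoC (INR N)) (fun t => Theta (- RtoC (INR rho))%C s t
    - (RtoC (lead_value rho N * x ^ (N + S rho)) * zeta (- RtoC (INR N) + (s - RtoC (INR rho) - 1))
       + psum (sum_term zeta x rho N s) (S N)))%C.
Proof.
  intros Hz Hx HT Hs Hl.
  destruct (theta_asymptotic zeta Theta x rho N s Hz Hx HT 0) as (K & HN & _ & HA).
  apply (HA (fun _ => RtoC (lead_value rho N * x ^ (N + S rho)) * zeta (- RtoC (INR N) + (s - RtoC (INR rho) - 1)))%C
    (fun _ => psum (sum_term zeta x rho N s) (S N))).
  - apply lead_regular; auto.
  - apply sum_regular; auto.
Qed.

(** The leading argument of zeta is 1. The arguments in the sum exceed it by k + rho + 1 > 0, so
    none of them is at the pole. *)
Lemma theta_case_II (zeta : C -> C) (Theta : C -> C -> C -> C) (x : R) (rho N : nat) (s : C) :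
  is_Riemann_zeta zeta -> 0 < x -> is_Theta x Theta ->
  (- RtoC (INR N) + (s - RtoC (INR rho) - 1))%C = RtoC 1 ->
  bigO (- RtoC (INR N)) (fun t => Theta (- RtoC (INR rho))%C s t
    - (RtoC (lead_value rho N * x ^ (N + S rho)) / (t - - RtoC (INR N))
       + RtoC (lead_value rho N * x ^ (N + S rho) * (Euler_gamma - ln x + harmonic (N + S rho) - harmonic N))
       + psum (sum_term zeta x rho N s) (S N)))%C.
Proof.
  intros Hz Hx HT Hl.
  destruct (theta_asymptotic zeta Theta x rho N s Hz Hx HT 0) as (K & HN & _ & HA).
  eapply bigO_ext; [|eapply HA; [apply lead_pole; auto|apply sum_regular; auto]].
  - intros t. cbv beta. set (A := lead_value rho N * x ^ (N + S rho)).
    replace (A * (Euler_gamma - ln x + harmonic (N + S rho) - harmonic N))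
      with (A * Euler_gamma + A * (harmonic (N + S rho) - harmonic N - ln x)) by ring.
    rewrite RtoC_plus, (RtoC_mult A Euler_gamma). ring.
  - intros k E. assert (E2 : RtoC (INR k + INR rho + 1) = RtoC 0).
    { rewrite !RtoC_plus. replace (RtoC (INR k) + RtoC (INR rho) + 1)%C with
        ((- RtoC (INR N) + (s + RtoC (INR k))) - (- RtoC (INR N) + (s - RtoC (INR rho) - 1)))%C by ring.
      rewrite E, Hl. ring. }
    apply RtoC_inj in E2. pose proof (pos_INR k). pose proof (pos_INR rho). lra.
Qed.

(** For s = - j the polar index is N + j + 1. The weight vanishes there to first order, so the
    product with zeta tends to the derivative of the weight, which is the extra constant. *)
Lemma theta_case_III (zeta : C -> C) (Theta : C -> C -> C -> C) (x : R) (rho N j : nat) (s : C) :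
  is_Riemann_zeta zeta -> 0 < x -> is_Theta x Theta -> s = (- RtoC (INR j))%C ->
  bigO (- RtoC (INR N)) (fun t => Theta (- RtoC (INR rho))%C s t
    - (RtoC (lead_value rho N * x ^ (N + S rho)) * zeta (- RtoC (INR N) + (s - RtoC (INR rho) - 1))
       + (psum (sum_term zeta x rho N s) (S N)
          + RtoC (- (zeta_neg_value (rho + S (N + j)) * (-1) ^ j * (INR (fact N) * INR (fact j) / INR (fact (S (N + j)))) / x ^ S j)))))%C.
Proof.
  intros Hz Hx HT Hs.
  destruct (theta_asymptotic zeta Theta x rho N s Hz Hx HT (S (N + j))) as (K & HN & HK & HA).
  eapply bigO_ext; [|eapply HA; [apply lead_regular; auto|
    eapply (sum_pole zeta x rho N K (S (N + j))); auto; [|apply theta_weight_deriv_high; auto]]].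
  - intros t. cbv beta. rewrite theta_weight_high by lia.
    rewrite (psum_ext (fun k => if Nat.eqb k (S (N + j)) then RtoC 0 else sum_term zeta x rho N s k) (sum_term zeta x rho N s)).
    + unfold Cdiv. ring.
    + intros k Hk. destruct (Nat.eqb_spec k (S (N + j))); [lia|reflexivity].
  - rewrite Hs. intros E. apply (f_equal Re) in E.
    rewrite re_plus, !Re_minus, !re_opp, !re_RtoC in E.
    pose proof (pos_INR N). pose proof (pos_INR j). pose proof (pos_INR rho). lra.
  - rewrite Hs, S_INR, plus_INR, !RtoC_plus. ring.
Qed.

(** For a positive s the polar index N + 1 - s is at most N, where the weight is given by
    [weight_value]; its logarithmic derivative supplies the harmonic numbers and the logarithm. *)
Lemma theta_case_IV (zeta : C -> C) (Theta : C -> C -> C -> C) (x : R) (rho N k0 : nat) (s : C) :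
  is_Riemann_zeta zeta -> 0 < x -> is_Theta x Theta -> (k0 <= N)%nat ->
  s = (RtoC (INR N) + 1 - RtoC (INR k0))%C ->
  bigO (- RtoC (INR N)) (fun t => Theta (- RtoC (INR rho))%C s t
    - (RtoC (lead_value rho N * x ^ (N + S rho)) * zeta (- RtoC (INR N) + (s - RtoC (INR rho) - 1))
       + (psum (fun k => if Nat.eqb k k0 then RtoC 0 else sum_term zeta x rho N s k) (S N)
          + (RtoC (weight_value x rho N k0) / (t - - RtoC (INR N))
             + RtoC (weight_value x rho N k0 * (Euler_gamma - harmonic N + harmonic (N - k0) - ln x))))))%C.
Proof.
  intros Hz Hx HT Hk Hs.
  destruct (theta_asymptotic zeta Theta x rho N s Hz Hx HT k0) as (K & HN & HK & HA).
  eapply bigO_ext; [|eapply HA; [apply lead_regular; auto|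
    eapply (sum_pole zeta x rho N K k0); auto; [|apply theta_weight_deriv_low; auto]]].
  - intros t. cbv beta. rewrite theta_weight_low by auto. set (A := weight_value x rho N k0).
    replace (A * (Euler_gamma - harmonic N + harmonic (N - k0) - ln x))
      with (A * Euler_gamma + A * (harmonic (N - k0) - harmonic N - ln x)) by ring.
    rewrite RtoC_plus, (RtoC_mult A Euler_gamma). ring.
  - rewrite Hs. intros E. apply (f_equal Re) in E.
    rewrite re_plus, !Re_minus, re_plus, !re_opp, !re_RtoC in E.
    pose proof (pos_INR k0). pose proof (pos_INR rho). lra.
  - rewrite Hs. ring.
Qed.

Theorem theorem2p3 (zeta : C -> C) (Theta : C -> C -> C -> C)
    (x : R) (r : Z) (l : nat)
    (Hzeta : is_Riemann_zeta zeta)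
    (Hx : 0 < x)
    (HTheta : is_Theta x Theta)
    (Hr : (r <= 0)%Z)
    (Hl : (1 - r <= Z.of_nat l)%Z) :
  let L : Z := Z.of_nat l in
  let N : nat := Z.to_nat (r + L - 1) in
  let t0 : C := IZC (1 - r - L) in
  (* Case I *)
  (forall s : C,
     ((exists z : Z, s = IZC z /\ (r + L < z)%Z /\ z <> (L + 1)%Z) \/
      (forall z : Z, s <> IZC z)) ->
     eq_up_to_O t0 (fun t => Theta (IZC r) s t) (fun t =>
       RtoC (powerRZ (-1) (r - 1) * (Zfact (r + L - 1) / Zfact L) * x ^ l
               * Gamma (1 - IZR r)) * zeta (s - IZC L)
       + Csum (fun k : nat =>
           let K := Z.of_nat k in
           RtoC (Zfact (r + L - 1)) * zeta (IZC (r - K))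
           / RtoC (powerRZ x (1 - r - L + K) * Zfact K * Zfact (r + L - K - 1))
           * zeta (- IZC r + s - IZC L + IZC K + 1)) N)%C)
  /\
  (* Case II *)
  (forall s : Z, (r + L < s)%Z -> s = (L + 1)%Z ->
     eq_up_to_O t0 (fun t => Theta (IZC r) (IZC s) t) (fun t =>
       RtoC (powerRZ (-1) (r - 1) * Zfact (- r) * x ^ l * Zfact (r + L - 1))
         / (RtoC (Zfact L) * (t - t0))
       + RtoC (powerRZ (-1) (r - 1) * Zfact (- r) * x ^ l
                 * (Zfact (r + L - 1) / Zfact L)
                 * (Euler_gamma - ln x + harmonic l - harmonic N))
       + Csum (fun k : nat =>
           let K := Z.of_nat k in
           RtoC (Binomial.C N k)
           * (zeta (IZC (r - K)) / RtoC (powerRZ x (K - r - L + 1)))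
           * zeta (IZC (K - r + 2))) N)%C)
  /\
  (* Case III *)
  (forall s : Z, (s <= 0)%Z -> (s <= r + L)%Z ->
     eq_up_to_O t0 (fun t => Theta (IZC r) (IZC s) t) (fun t =>
       RtoC (powerRZ (-1) (r - 1) * x ^ l
               * (Zfact (- r) * Zfact (r + L - 1) / Zfact L)) * zeta (IZC (s - L))
       + Csum (fun k : nat =>
           let K := Z.of_nat k in
           zeta (IZC (r - K)) * RtoC (Zfact (r + L - 1))
           / RtoC (powerRZ x (K - r - L + 1) * Zfact K * Zfact (r + L - K - 1))
           * zeta (IZC (s + 1 - r - L + K))) N
       + RtoC (powerRZ (-1) (s - 1) * powerRZ x (s - 1)
                 * (Zfact (r + L - 1) * Zfact (- s) / Zfact (r + L - s)))
         * zeta (IZC (s - L)))%C)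
  /\
  (* Case IV *)
  (forall s : Z, (1 <= s)%Z -> (s <= r + L)%Z ->
     eq_up_to_O t0 (fun t => Theta (IZC r) (IZC s) t) (fun t =>
       RtoC (powerRZ x (s - 1)
               * (Zfact (r + L - 1) / (Zfact (r + L - s) * Zfact (s - 1))))
         * (zeta (IZC (s - L)) / (t - t0))
       + RtoC (powerRZ x (s - 1)
                 * (Zfact (r + L - 1) / (Zfact (r + L - s) * Zfact (s - 1)))
                 * (Euler_gamma - harmonic N + harmonic (Z.to_nat (s - 1)) - ln x))
         * zeta (IZC (s - L))
       - RtoC (powerRZ (-1) r * x ^ l
                 * (Zfact (- r) * Zfact (r + L - 1) / Zfact L)) * zeta (IZC (s - L))
       + Csum (fun k : nat =>
           let K := Z.of_nat k in
           if Z.eq_dec K (r + L - s) then RtoC 0 else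
             RtoC (Zfact (r + L - 1)) * zeta (IZC (r - K))
             / RtoC (Zfact (r + L - K - 1) * powerRZ x (K - r - L + 1) * Zfact K)
             * zeta (IZC (s - r - L + K + 1))) N)%C).

Proof.
  (* Natural parameters remove every truncated conversion: r = - rho, l = n0 + rho + 1 and t0 = -
     n0. *)
  set (rho := Z.to_nat (- r)). set (n0 := Z.to_nat (r + Z.of_nat l - 1)).
  assert (Er : r = (- Z.of_nat rho)%Z) by (unfold rho; lia).
  assert (El : l = (n0 + S rho)%nat) by (unfold n0, rho; lia).
  clearbody rho n0. subst r l. clear Hr Hl. intros L N t0.
  assert (EL : L = (Z.of_nat n0 + Z.of_nat rho + 1)%Z) by (unfold L; lia).
  assert (EN : N = n0) by (unfold N; lia). clearbody N. subst N.
  assert (Et0 : t0 = (- RtoC (INR n0))%C).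
  { unfold t0. rewrite EL.
    replace (1 - - Z.of_nat rho - (Z.of_nat n0 + Z.of_nat rho + 1))%Z with (- Z.of_nat n0)%Z by lia.
    rewrite IZC_opp, IZC_nat. reflexivity. }
  assert (EIr : IZC (- Z.of_nat rho) = (- RtoC (INR rho))%C) by (rewrite IZC_opp, IZC_nat; reflexivity).
  assert (FN : Zfact (- Z.of_nat rho + L - 1) = INR (fact n0)) by (apply Zfact_nat; lia).
  assert (FL : Zfact L = INR (fact (n0 + S rho))) by (apply Zfact_nat; lia).
  assert (FR : Zfact (- - Z.of_nat rho) = INR (fact rho)) by (apply Zfact_nat; lia).
  assert (FK : forall k, Zfact (Z.of_nat k) = INR (fact k)) by (intros; apply Zfact_nat; reflexivity).
  assert (FD : forall k, (k <= n0)%nat -> Zfact (- Z.of_nat rho + L - Z.of_nat k - 1) = INR (fact (n0 - k)))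
    by (intros; apply Zfact_nat; lia).
  assert (PX : forall k, (k <= n0)%nat -> powerRZ x (Z.of_nat k - - Z.of_nat rho - L + 1) = / x ^ (n0 - k))
    by (intros; apply powerRZ_nat_opp; auto; lia).
  assert (ZN : forall k, zeta (IZC (- Z.of_nat rho - Z.of_nat k)) = RtoC (zeta_neg_value (rho + k)))
    by (intros; apply zeta_IZC_neg; auto; lia).
  assert (M1 : powerRZ (-1) (- Z.of_nat rho - 1) = (-1) ^ S rho) by (apply powerRZ_m1_opp; lia).
  assert (WD := fun k => weight_denominator_neq_0 x n0 k Hx).
  rewrite Et0, EIr. clear Et0 t0. clearbody L. subst L.
  set (L := (Z.of_nat n0 + Z.of_nat rho + 1)%Z) in *.
  split; [|split; [|split]].
  - intros s Hs. apply bigO_eq_up_to_O.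
    (* An argument of zeta can be 1 only for an integer s: for s = n0 + 1 - k in the sum and for s =
       L + 1 in the leading term. Both are excluded here. *)
    assert (Hz : forall z : Z, s = IZC z -> (Z.of_nat n0 + 1 < z)%Z /\ z <> (L + 1)%Z).
    { intros z Ez. destruct Hs as [[z' [Ez' [H1 H2]]]|Hn]; [|exfalso; apply (Hn z Ez)].
      rewrite Ez in Ez'. apply IZC_inj in Ez'. subst z'. split; [unfold L in H1; lia|exact H2]. }
    eapply bigO_ext; [|apply (theta_case_I zeta Theta x rho n0 s); auto].
    + intros t. cbv beta.
      rewrite (Csum_psum _ (sum_term zeta x rho n0 s) n0).
      * rewrite M1, FN, FL.
        replace (1 - IZR (- Z.of_nat rho)) with (1 + INR rho) by (rewrite opp_IZR, <- INR_IZR_INZ; ring).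
        rewrite Gamma_fact.
        replace (s - IZC L)%C with (- RtoC (INR n0) + (s - RtoC (INR rho) - 1))%C by (unfold L; push_IZC; ring).
        replace ((-1) ^ S rho * (INR (fact n0) / INR (fact (n0 + S rho))) * x ^ (n0 + S rho) * INR (fact rho))
          with (lead_value rho n0 * x ^ (n0 + S rho)) by (unfold lead_value, Rdiv; ring).
        reflexivity.
      * intros k Hk. cbv beta zeta. rewrite FN, FK, FD, ZN by auto.
        replace (1 - - Z.of_nat rho - L + Z.of_nat k)%Z with (Z.of_nat k - - Z.of_nat rho - L + 1)%Z by lia.
        rewrite PX by auto. unfold sum_term. rewrite weight_value_frac by auto.
        rewrite <- RtoC_mult, <- RtoC_div by apply WD. f_equal. f_equal.
        unfold L; push_IZC; ring.
    + intros k E. destruct (Hz (Z.of_nat n0 + 1 - Z.of_nat k)%Z); [|lia].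
      push_IZC. rewrite <- E. ring.
    + intros E. destruct (Hz (L + 1)%Z) as [_ H]; [|auto].
      transitivity ((- RtoC (INR n0) + (s - RtoC (INR rho) - 1)) + RtoC (INR n0) + RtoC (INR rho) + 1)%C; [ring|].
      rewrite E. unfold L. push_IZC. ring.
  - intros s _ Es. apply bigO_eq_up_to_O. subst s.
    assert (Hs : (- RtoC (INR n0) + (IZC (L + 1) - RtoC (INR rho) - 1))%C = RtoC 1) by (unfold L; push_IZC; ring).
    eapply bigO_pnear_ext; [|apply (theta_case_II zeta Theta x rho n0 (IZC (L + 1))); auto].
    (* The two forms of the polar term are compared only away from the expansion point, where the
       denominator is nonzero. *)
    generalize (pnear_neq (- RtoC (INR n0)) (- RtoC (INR n0))). apply pnear_imp. intros t Ht.
    rewrite (Csum_psum _ (sum_term zeta x rho n0 (IZC (L + 1))) n0).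
    + rewrite M1, FN, FL, FR.
      assert (Ht' : (t - - RtoC (INR n0))%C <> 0%C) by (apply Cminus_eq_contra; auto).
      assert (Hf : RtoC (INR (fact (n0 + S rho))) <> 0%C) by (apply RtoC_neq, INR_fact_neq_0).
      replace ((-1) ^ S rho * INR (fact rho) * x ^ (n0 + S rho) * (INR (fact n0) / INR (fact (n0 + S rho))) * (Euler_gamma - ln x + harmonic (n0 + S rho) - harmonic n0))
        with (lead_value rho n0 * x ^ (n0 + S rho) * (Euler_gamma - ln x + harmonic (n0 + S rho) - harmonic n0))
        by (unfold lead_value, Rdiv; ring).
      replace ((-1) ^ S rho * INR (fact rho) * x ^ (n0 + S rho) * INR (fact n0))
        with (lead_value rho n0 * x ^ (n0 + S rho) * INR (fact (n0 + S rho)))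
        by (unfold lead_value; field; apply INR_fact_neq_0).
      rewrite (RtoC_mult _ (INR (fact (n0 + S rho)))). field. auto.
    + intros k Hk. cbv beta zeta. rewrite ZN, PX by auto. unfold sum_term.
      replace (IZC (Z.of_nat k - - Z.of_nat rho + 2)) with (- RtoC (INR n0) + (IZC (L + 1) + RtoC (INR k)))%C.
      * rewrite <- RtoC_div, <- RtoC_mult by (apply Rinv_neq_0_compat, pow_nonzero; lra). f_equal. f_equal.
        unfold weight_value, Binomial.C, Rdiv. rewrite Rinv_inv. ring.
      * replace (Z.of_nat k - - Z.of_nat rho + 2)%Z with (Z.of_nat k - - Z.of_nat rho + 1 + 1)%Z by lia.
        unfold L. push_IZC. ring.
  - intros s Hs0 Hs1. apply bigO_eq_up_to_O.
    set (j := Z.to_nat (- s)). assert (Ej : s = (- Z.of_nat j)%Z) by (unfold j; lia). clearbody j. subst s.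
    eapply bigO_ext; [|apply (theta_case_III zeta Theta x rho n0 j (IZC (- Z.of_nat j))); auto; push_IZC; reflexivity].
    intros t. cbv beta. rewrite (Csum_psum _ (sum_term zeta x rho n0 (IZC (- Z.of_nat j))) n0).
    + rewrite M1, FN, FL, FR.
      rewrite (Zfact_nat (- - Z.of_nat j) j) by lia.
      rewrite (Zfact_nat (- Z.of_nat rho + L - - Z.of_nat j) (S (n0 + j))) by (unfold L; lia).
      rewrite (powerRZ_m1_opp (- Z.of_nat j - 1) (S j)) by lia.
      rewrite (powerRZ_nat_opp x (- Z.of_nat j - 1) (S j)) by (auto; lia).
      (* Here s - L = - (rho + n0 + j + 1): the zeta value of the leading term is also the constant
         in the weight of the polar index, so the same factor appears in the extra term. *)
      rewrite (zeta_IZC_neg zeta (- Z.of_nat j - L) (rho + S (n0 + j))) by (auto; unfold L; lia).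
      replace (zeta (- RtoC (INR n0) + (IZC (- Z.of_nat j) - RtoC (INR rho) - 1))%C) with (RtoC (zeta_neg_value (rho + S (n0 + j)))).
      * replace ((-1) ^ S rho * x ^ (n0 + S rho) * (INR (fact rho) * INR (fact n0) / INR (fact (n0 + S rho))))
          with (lead_value rho n0 * x ^ (n0 + S rho)) by (unfold lead_value, Rdiv; ring).
        replace (- (zeta_neg_value (rho + S (n0 + j)) * (-1) ^ j * (INR (fact n0) * INR (fact j) / INR (fact (S (n0 + j)))) / x ^ S j))
          with ((-1) ^ S j * / x ^ S j * (INR (fact n0) * INR (fact j) / INR (fact (S (n0 + j)))) * zeta_neg_value (rho + S (n0 + j)))
          by (unfold Rdiv; cbn [pow]; ring).
        rewrite (RtoC_mult _ (zeta_neg_value (rho + S (n0 + j)))). ring.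
      * rewrite <- (zeta_IZC_neg zeta (- Z.of_nat j - L) (rho + S (n0 + j))) by (auto; unfold L; lia).
        f_equal. unfold L. push_IZC. ring.
    + intros k Hk. cbv beta zeta. rewrite FN, FK, FD, ZN, PX by auto. unfold sum_term. rewrite weight_value_frac by auto.
      rewrite <- RtoC_mult, <- RtoC_div by apply WD. f_equal.
      * f_equal. unfold Rdiv. ring.
      * f_equal. unfold L. push_IZC. ring.
  - intros s Hs0 Hs1. apply bigO_eq_up_to_O.
    (* The index r + l - s, excluded from the sum in the statement, is the one at the pole. *)
    set (k0 := Z.to_nat (- Z.of_nat rho + L - s)).
    assert (Hk0 : (k0 <= n0)%nat) by (unfold k0, L; lia).
    assert (Es : s = (Z.of_nat n0 + 1 - Z.of_nat k0)%Z) by (unfold k0, L in *; lia). clearbody k0. subst s.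
    set (s := (Z.of_nat n0 + 1 - Z.of_nat k0)%Z) in *.
    eapply bigO_ext; [|apply (theta_case_IV zeta Theta x rho n0 k0 (IZC s)); auto; unfold s; push_IZC; reflexivity].
    intros t. cbv beta.
    rewrite (Csum_psum _ (fun k => if Nat.eqb k k0 then RtoC 0 else sum_term zeta x rho n0 (IZC s) k) n0).
    + rewrite FN, FL, FR.
      rewrite (Zfact_nat (- Z.of_nat rho + L - s) k0) by (unfold L, s; lia).
      rewrite (Zfact_nat (s - 1) (n0 - k0)) by (unfold s; lia).
      replace (Z.to_nat (s - 1)) with (n0 - k0)%nat by (unfold s; lia).
      rewrite (powerRZ_m1_opp (- Z.of_nat rho) rho) by lia.
      replace (powerRZ x (s - 1)) with (x ^ (n0 - k0)) by (rewrite pow_powerRZ; f_equal; unfold s; lia).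
      (* Since s - L = - (rho + k0), the factor zeta (s - L) of the polar term is the constant in
         the weight of index k0. *)
      rewrite (zeta_IZC_neg zeta (s - L) (rho + k0)) by (auto; unfold L, s; lia).
      replace (zeta (- RtoC (INR n0) + (IZC s - RtoC (INR rho) - 1))%C) with (RtoC (zeta_neg_value (rho + k0))).
      * replace (x ^ (n0 - k0) * (INR (fact n0) / (INR (fact k0) * INR (fact (n0 - k0)))) * (Euler_gamma - harmonic n0 + harmonic (n0 - k0) - ln x))
          with ((x ^ (n0 - k0) * (INR (fact n0) / (INR (fact k0) * INR (fact (n0 - k0))))) * (Euler_gamma - harmonic n0 + harmonic (n0 - k0) - ln x)) by ring.
        replace (weight_value x rho n0 k0) with (x ^ (n0 - k0) * (INR (fact n0) / (INR (fact k0) * INR (fact (n0 - k0)))) * zeta_neg_value (rho + k0))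
          by (unfold weight_value; ring).
        set (W := x ^ (n0 - k0) * (INR (fact n0) / (INR (fact k0) * INR (fact (n0 - k0))))).
        replace (W * zeta_neg_value (rho + k0) * (Euler_gamma - harmonic n0 + harmonic (n0 - k0) - ln x))
          with (W * (Euler_gamma - harmonic n0 + harmonic (n0 - k0) - ln x) * zeta_neg_value (rho + k0)) by ring.
        (* The sign (-1)^(rho + 1) of [lead_value] accounts for the subtraction in this case. *)
        replace (lead_value rho n0 * x ^ (n0 + S rho)) with
          (- ((-1) ^ rho * x ^ (n0 + S rho) * (INR (fact rho) * INR (fact n0) / INR (fact (n0 + S rho)))))
          by (unfold lead_value, Rdiv; cbn [pow]; ring).
        rewrite RtoC_opp, !(RtoC_mult _ (zeta_neg_value (rho + k0))). unfold Cdiv. ring.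
      * rewrite <- (zeta_IZC_neg zeta (s - L) (rho + k0)) by (auto; unfold L, s; lia).
        f_equal. unfold L. push_IZC. ring.
    + intros k Hk. cbv beta zeta.
      destruct (Z.eq_dec (Z.of_nat k) (- Z.of_nat rho + L - s)) as [Ek|Ek];
      destruct (Nat.eqb_spec k k0) as [Ek'|Ek']; try (unfold L, s in Ek; lia); [reflexivity|].
      rewrite FN, FK, FD, ZN, PX by auto. unfold sum_term. rewrite weight_value_frac by auto.
      replace (INR (fact (n0 - k)) * / x ^ (n0 - k) * INR (fact k))
        with (/ x ^ (n0 - k) * INR (fact k) * INR (fact (n0 - k))) by ring.
      rewrite <- RtoC_mult, <- RtoC_div by apply WD. f_equal. f_equal.
      unfold L. push_IZC. ring.
Qed.
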